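(* Let $M$ be a model of ZFA in which the set $A$ of atoms is countable and $\leq$ is (in $M$) a dense linear order without endpoints on $A$. In $M$, let $\Sigma$ be the group of order preserving automorphisms of $\langle A,\leq\rangle$, and let $\mathcal{F}$ be the filter of subgroups of $\Sigma$ generated by the subgroups $\operatorname{Stab}(a)$ for $a\in A$. Then Frucht's Theorem holds in the permutation model $M'=M/\mathcal{F}$ (the ordered Mostowski model).
   Context: ZFA is ZF modified to allow a set $A$ of atoms (objects with no elements, distinct from each other and from $\varnothing$; extensionality is restricted to non-atoms). A bijection $\pi$ of $A$ acts on the whole universe by its given action on atoms and, recursively, $\pi[S]=\{\pi[x]\mid x\in S\}$ for sets $S$. For $S\in M$, $\operatorname{Stab}(S)=\{\sigma\in\Sigma\mid \sigma[S]=S\}$. The filter generated by the subgroups $\operatorname{Stab}(a)$ consists of all subgroups of $\Sigma$ containing a finite intersection of such stabilizers; it is a normal filter. An $S\in M$ is symmetric if $\operatorname{Stab}(S)\in\mathcal{F}$, and hereditarily symmetric if $S$ and every element of its transitive closure are symmetric. The permutation model $M/\mathcal{F}$ is the class of hereditarily symmetric elements of $M$; it is a model of ZFA with the same set of atoms. A graph is a pair $\langle V(G),E(G)\rangle$ with $V(G)$ a set and $E(G)\subseteq V(G)^2$ symmetric and irreflexive; its automorphisms are the bijections of $V(G)$ preserving edges and non-edges. Frucht's Theorem is the statement that every group is isomorphic to the automorphism group of some graph. *)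

(* Defs.v *)
Set Implicit Arguments.
Unset Strict Implicit.

(* Structures for the language of ZFA: a membership relation together with a
   unary predicate singling out the atoms.  No well-foundedness is assumed from
   outside, so everything below (finiteness, recursion, transitive closure, ...)
   is expressed inside the structure: all quantifiers range over its carrier. *)
Record eps_structure : Type := EpsStructure {
  carrier :> Type;
  mem : carrier -> carrier -> Prop;
  atom : carrier -> Prop
}.

Declare Scope eps_scope.
Delimit Scope eps_scope with eps.
Notation "x ∈ y" := (mem x y) (at level 70, no associativity) : eps_scope.
Notation "x ∉ y" := (~ mem x y) (at level 70, no associativity) : eps_scope.
Local Open Scope eps_scope.

(* First-order formulas with de Bruijn indices, for the two axiom schemes. *)
Inductive formula : Type :=
| fMem (i j : nat)
| fEq (i j : nat)
| fAtom (i : nat)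
| fFalse
| fImp (p q : formula)
| fAnd (p q : formula)
| fOr (p q : formula)
| fAll (p : formula)
| fEx (p : formula).

Definition scons (T : Type) (x : T) (e : nat -> T) (n : nat) : T :=
  match n with O => x | S k => e k end.

Fixpoint sat (M : eps_structure) (e : nat -> M) (p : formula) : Prop :=
  match p with
  | fMem i j => e i ∈ e j
  | fEq i j => e i = e j
  | fAtom i => atom (e i)
  | fFalse => False
  | fImp p q => sat e p -> sat e q
  | fAnd p q => sat e p /\ sat e q
  | fOr p q => sat e p \/ sat e q
  | fAll p => forall x : M, sat (scons x e) p
  | fEx p => exists x : M, sat (scons x e) p
  end.

Section SetTheory.

Variable M : eps_structure.
Implicit Types x y z p s t u v w f g h d e i n : M.

Definition is_set x : Prop := ~ atom x.

Definition subset x y : Prop := forall z, z ∈ x -> z ∈ y.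

Definition is_empty x : Prop := is_set x /\ forall z, z ∉ x.

Definition is_upair p x y : Prop := forall z, z ∈ p <-> z = x \/ z = y.

(* s = n ∪ {n} *)
Definition is_succ n s : Prop := forall z, z ∈ s <-> z ∈ n \/ z = n.

Definition inductive w : Prop :=
  (exists o, is_empty o /\ o ∈ w) /\
  (forall n, n ∈ w -> exists s, is_succ n s /\ s ∈ w).

(* In the presence of atoms, inclusion does not imply being a set: an atom is
   vacuously included in everything, hence the [is_set] conditions below. *)
Record ZFA : Prop := {
  zfa_atoms : exists A, is_set A /\ forall x, x ∈ A <-> atom x;
  zfa_atom_empty : forall a : M, atom a -> forall x, x ∉ a;
  zfa_extensionality : forall x y, is_set x -> is_set y ->
    (forall z, z ∈ x <-> z ∈ y) -> x = y;
  zfa_empty : exists x, is_empty x;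
  zfa_pairing : forall x y, exists p, is_upair p x y;
  zfa_union : forall x, exists u, is_set u /\
    forall z, z ∈ u <-> exists y, y ∈ x /\ z ∈ y;
  zfa_power : forall x, exists u, is_set u /\
    forall z, z ∈ u <-> is_set z /\ subset z x;
  zfa_infinity : exists w, inductive w;
  zfa_foundation : forall x, (exists y, y ∈ x) ->
    exists y, y ∈ x /\ forall z, z ∈ x -> z ∉ y;
  zfa_separation : forall (phi : formula) (env : nat -> M) x,
    exists y, is_set y /\
      forall z, z ∈ y <-> z ∈ x /\ sat (scons z env) phi;
  zfa_replacement : forall (phi : formula) (env : nat -> M) x,
    (forall u v w, u ∈ x -> sat (scons u (scons v env)) phi ->
       sat (scons u (scons w env)) phi -> v = w) ->
    exists y, is_set y /\
      forall v, v ∈ y <-> exists u, u ∈ x /\ sat (scons u (scons v env)) phi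
}.

(* Kuratowski pair: p = {{x}, {x, y}} *)
Definition is_pair p x y : Prop :=
  exists s t, is_upair s x x /\ is_upair t x y /\ is_upair p s t.

(* (x, y) ∈ r; for a function r this says r(x) = y. *)
Definition rel (r x y : M) : Prop := exists p, is_pair p x y /\ p ∈ r.

Definition is_relation_on (r X Y : M) : Prop :=
  is_set r /\
  forall p, p ∈ r -> exists x y, x ∈ X /\ y ∈ Y /\ is_pair p x y.

Definition is_product (P X Y : M) : Prop :=
  is_set P /\ forall p, p ∈ P <-> exists x y, x ∈ X /\ y ∈ Y /\ is_pair p x y.

Definition is_function_on f (X : M) : Prop :=
  is_set f /\
  (forall p, p ∈ f -> exists x y, x ∈ X /\ is_pair p x y) /\
  (forall x, x ∈ X -> exists! y, rel f x y).

Definition maps f (X Y : M) : Prop :=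
  is_function_on f X /\ forall x y, rel f x y -> y ∈ Y.

Definition injection f (X Y : M) : Prop :=
  maps f X Y /\ forall x y z, rel f x z -> rel f y z -> x = y.

Definition bijection f (X Y : M) : Prop :=
  injection f X Y /\ forall y, y ∈ Y -> exists x, rel f x y.

Definition is_omega w : Prop :=
  is_set w /\ inductive w /\ forall v, inductive v -> subset w v.

Definition finite x : Prop :=
  exists w n f, is_omega w /\ n ∈ w /\ bijection f x n.

Definition countable x : Prop :=
  exists w f, is_omega w /\ injection f x w.

Definition transitive x : Prop := forall y, y ∈ x -> subset y x.

Definition is_transitive_closure x t : Prop :=
  is_set t /\ transitive t /\ subset x t /\
  forall u, transitive u -> subset x u -> subset t u.

Definition is_identity i (X : M) : Prop :=
  is_set i /\ forall p, p ∈ i <-> exists x, x ∈ X /\ is_pair p x x.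

(* h = f ∘ g *)
Definition is_composition f g h : Prop :=
  is_set h /\
  forall p, p ∈ h <-> exists x y z, rel g x y /\ rel f y z /\ is_pair p x z.

Definition is_inverse f g : Prop :=
  is_set g /\ forall p, p ∈ g <-> exists x y, rel f x y /\ is_pair p y x.

(* f is an automorphism of the relational structure <X, r>. *)
Definition is_automorphism f (X r : M) : Prop :=
  bijection f X X /\
  forall x y x' y', rel f x x' -> rel f y y' -> (rel r x y <-> rel r x' y').

Definition is_automorphism_group (S X r : M) : Prop :=
  is_set S /\ forall f, f ∈ S <-> is_automorphism f X r.

Definition is_atom_set (A : M) : Prop :=
  is_set A /\ forall x, x ∈ A <-> atom x.

Definition linear_order (A le : M) : Prop :=
  is_relation_on le A A /\
  (forall x, x ∈ A -> rel le x x) /\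
  (forall x y, rel le x y -> rel le y x -> x = y) /\
  (forall x y z, rel le x y -> rel le y z -> rel le x z) /\
  (forall x y, x ∈ A -> y ∈ A -> rel le x y \/ rel le y x).

Definition strict (le x y : M) : Prop := rel le x y /\ x <> y.

Definition dense_linear_order_without_endpoints (A le : M) : Prop :=
  linear_order A le /\
  (forall x y, strict le x y -> exists z, strict le x z /\ strict le z y) /\
  (forall x, x ∈ A -> (exists y, strict le y x) /\ exists z, strict le x z).

(* The action of a permutation [pi] of the atoms, defined by recursion on
   membership: pi[x] = y iff some h in M, defined on a transitive set d
   containing x and obeying the recursion clauses on d, has h(x) = y. *)
Definition action_approx (pi d h : M) : Prop :=
  transitive d /\ is_function_on h d /\
  forall x y, rel h x y ->
    (atom x -> rel pi x y) /\
    (is_set x -> is_set y /\ forall v, v ∈ y <-> exists u, u ∈ x /\ rel h u v).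

Definition acts (pi x y : M) : Prop :=
  exists d h, action_approx pi d h /\ x ∈ d /\ rel h x y.

(* H = Stab(x) = {pi ∈ Sigma | pi[x] = x} *)
Definition is_stabilizer (Sigma x H : M) : Prop :=
  is_set H /\ forall pi : M, pi ∈ H <-> pi ∈ Sigma /\ acts pi x x.

(* H is a subgroup of the group Sigma of permutations of A. *)
Definition is_subgroup (A Sigma H : M) : Prop :=
  is_set H /\ subset H Sigma /\
  (exists i, is_identity i A /\ i ∈ H) /\
  (forall f g h, f ∈ H -> g ∈ H -> is_composition f g h -> h ∈ H) /\
  (forall f g, f ∈ H -> is_inverse f g -> g ∈ H).

(* F is the filter of subgroups of Sigma generated by the Stab(a), a ∈ A: the
   set of all subgroups containing the intersection (taken inside Sigma) of the
   Stab(a) for a in some finite e ⊆ A. *)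
Definition is_filter_generated_by_stabilizers (A Sigma F : M) : Prop :=
  is_set F /\
  forall H : M, H ∈ F <->
    is_subgroup A Sigma H /\
    exists e, is_set e /\ subset e A /\ finite e /\
      forall pi : M, pi ∈ Sigma ->
        (forall a S : M, a ∈ e -> is_stabilizer Sigma a S -> pi ∈ S) -> pi ∈ H.

Definition symmetric (Sigma F x : M) : Prop :=
  exists H, is_stabilizer Sigma x H /\ H ∈ F.

Definition hereditarily_symmetric (Sigma F x : M) : Prop :=
  symmetric Sigma F x /\
  exists t, is_transitive_closure x t /\
    forall y, y ∈ t -> symmetric Sigma F y.

(* m(x, y) = z, for a binary operation m *)
Definition op (m x y z : M) : Prop := exists p, is_pair p x y /\ rel m p z.

Definition is_group (G m : M) : Prop :=
  is_set G /\
  (exists P, is_product P G G /\ maps m P G) /\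
  (forall x y z xy yz u v, op m x y xy -> op m xy z u ->
     op m y z yz -> op m x yz v -> u = v) /\
  (exists e, e ∈ G /\ (forall x, x ∈ G -> op m e x x /\ op m x e x) /\
     forall x, x ∈ G -> exists y, y ∈ G /\ op m x y e /\ op m y x e).

Definition is_graph (V E : M) : Prop :=
  is_set V /\ is_relation_on E V V /\
  (forall x y, rel E x y -> rel E y x) /\
  (forall x, ~ rel E x x).

(* phi is an isomorphism from the group <G, m> onto the group S of
   permutations, under composition. *)
Definition is_isomorphism_to_permutations (phi G m S : M) : Prop :=
  bijection phi G S /\
  forall x y z f g h, op m x y z ->
    rel phi x f -> rel phi y g -> rel phi z h -> is_composition f g h.

Definition Frucht : Prop :=
  forall G m : M, is_group G m ->
    exists V E : M, is_graph V E /\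
      exists S phi : M, is_automorphism_group S V E /\
        is_isomorphism_to_permutations phi G m S.

End SetTheory.

Arguments ZFA : clear implicits.
Arguments Frucht : clear implicits.

Definition permutation_model (M : eps_structure) (Sigma F : M) : eps_structure :=
  @EpsStructure {x : M | hereditarily_symmetric Sigma F x}
    (fun x y => mem (proj1_sig x) (proj1_sig y))
    (fun x => atom (proj1_sig x)).

(* Main.v *)
Require Import Defs.
From Stdlib Require Import List Arith Lia Classical ClassicalEpsilon ProofIrrelevance.
Import ListNotations.
Set Implicit Arguments.
Unset Strict Implicit.
Local Open Scope eps_scope.

(** Two facts together give the theorem.

    The atoms of the permutation model are rigid: an automorphism [f] of the
    order of the atoms that lies in the model is the identity
    ([symmetric_automorphism_trivial]).  Such an [f] is fixed by every
    automorphism of the order that fixes some finite set [e] pointwise.  If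
    [f] moved an atom [a] outside [e] to [b], an automorphism fixing [e] and
    [b] but moving [a], which exists by back-and-forth because the order is
    countable and dense ([moving_automorphism]), would contradict injectivity.
    So [f] is the identity off [e]; as intervals are infinite, monotonicity
    then makes it the identity on [e] as well.

    In any model of ZFA whose atoms carry a rigid partial order without minimal
    elements, every group [G] is the automorphism group of a graph
    ([group_is_automorphism_group]); the axiom of choice is replaced by the
    fact that a transitive set [T] containing the set of atoms is rigid too, by
    induction on membership.  So the elements of [T] can serve as colours.
    With [G] a subset of [T], take two copies [Src g], [Tgt g] of [G] and
    record, for all [g] and [c] in [G], that the arrow from [Src g] to
    [Tgt (g c)] has the colour [c]: the permutations that preserve this are
    exactly the left translations of [G].  The structure on [T] and the
    coloured arrows are both given by a family of subsets, the blocks, of one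
    set of points; the graph has the points as a clique, the blocks as an
    independent set, and membership of points in blocks as the other edges.

    To apply the second fact to the permutation model, that model is shown to
    satisfy ZFA ([model_ZFA]).  A permutation of the atoms extends to an
    automorphism of the whole structure, so it preserves every first-order
    condition on objects that it fixes; hence whatever is uniquely definable
    from symmetric parameters is symmetric ([symmetric_def]).  All uses of
    separation, replacement and induction need explicit formulas; the predicate
    [Def] and the tactic [def] produce them from the shape of a condition. *)

(** * First-order definability with parameters *)

Definition up (r : nat -> nat) (n : nat) : nat :=
  match n with O => O | S k => S (r k) end.

Fixpoint rename (r : nat -> nat) (p : formula) : formula :=
  match p with
  | fMem i j => fMem (r i) (r j)
  | fEq i j => fEq (r i) (r j)
  | fAtom i => fAtom (r i)
  | fFalse => fFalse
  | fImp p q => fImp (rename r p) (rename r q)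
  | fAnd p q => fAnd (rename r p) (rename r q)
  | fOr p q => fOr (rename r p) (rename r q)
  | fAll p => fAll (rename (up r) p)
  | fEx p => fEx (rename (up r) p)
  end.

Lemma sat_ext (M : eps_structure) (p : formula) : forall e e' : nat -> M,
  (forall n, e n = e' n) -> sat e p <-> sat e' p.
Proof.
  induction p; simpl; intros e e' H; rewrite ?H; try tauto.
  - rewrite (IHp1 _ _ H), (IHp2 _ _ H); tauto.
  - rewrite (IHp1 _ _ H), (IHp2 _ _ H); tauto.
  - rewrite (IHp1 _ _ H), (IHp2 _ _ H); tauto.
  - assert (E : forall x, sat (scons x e) p <-> sat (scons x e') p)
      by (intro x; apply IHp; intros [|n]; simpl; auto).
    split; intros H1 x; apply E, H1.
  - assert (E : forall x, sat (scons x e) p <-> sat (scons x e') p)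
      by (intro x; apply IHp; intros [|n]; simpl; auto).
    split; intros [x H1]; exists x; apply E, H1.
Qed.

Lemma sat_rename (M : eps_structure) (p : formula) : forall r (e : nat -> M),
  sat e (rename r p) <-> sat (fun n => e (r n)) p.
Proof.
  induction p; simpl; intros r e; try tauto.
  - rewrite IHp1, IHp2; tauto.
  - rewrite IHp1, IHp2; tauto.
  - rewrite IHp1, IHp2; tauto.
  - assert (E : forall x, sat (scons x e) (rename (up r) p) <->
                          sat (scons x (fun n => e (r n))) p).
    { intro x; rewrite IHp; apply sat_ext; intros [|n]; reflexivity. }
    split; intros H1 x; apply E, H1.
  - assert (E : forall x, sat (scons x e) (rename (up r) p) <->
                          sat (scons x (fun n => e (r n))) p).
    { intro x; rewrite IHp; apply sat_ext; intros [|n]; reflexivity. }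
    split; intros [x H1]; exists x; apply E, H1.
Qed.

(** The parameters come before all variables, so that merging two lists of
    parameters only renames variables. *)
Definition params (M : Type) (l : list M) (e : nat -> M) (n : nat) : M :=
  nth n l (e (n - length l)).

(** Definability of a condition on assignments by one formula with finitely
    many parameters from the class [K].  Restricting the parameters lets the
    same notion serve for the axiom schemes, where [K] is everything, and for
    invariance under automorphisms, where [K] consists of fixed objects. *)
Definition Def (M : eps_structure) (K : M -> Prop)
    (P : (nat -> M) -> Prop) : Prop :=
  exists phi l, Forall K l /\ forall e, sat (params l e) phi <-> P e.

(** The graph of the function [t] is definable; variable 0 is its value. *)
Definition TDef (M : eps_structure) (K : M -> Prop)
    (t : (nat -> M) -> M) : Prop :=
  Def K (fun e => e 0 = t (fun n => e (S n))).

Section Closure.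

Variable M : eps_structure.
Variable K : M -> Prop.
Implicit Types P Q : (nat -> M) -> Prop.
Implicit Types s t : (nat -> M) -> M.

Lemma def_ext P Q : (forall e, P e <-> Q e) -> Def K P -> Def K Q.
Proof.
  intros E (phi & l & Hl & H); exists phi, l; split; auto.
  intro e; rewrite H; apply E.
Qed.

Lemma def_rename (r : nat -> nat) P :
  Def K P -> Def K (fun e => P (fun n => e (r n))).
Proof.
  intros (phi & l & Hl & H).
  (* parameters keep their places, variables are renamed by r *)
  exists (rename (fun n => if n <? length l then n
                           else r (n - length l) + length l) phi), l.
  split; auto. intro e; rewrite sat_rename, <- H.
  apply sat_ext; intro n; unfold params; cbv beta.
  destruct (Nat.ltb_spec n (length l)) as [L|L].
  - apply nth_indep; auto.
  - rewrite !nth_overflow by lia.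
    rewrite Nat.add_sub; reflexivity.
Qed.

(** Both formulas are made to read the same concatenated list of parameters. *)
Lemma def_common P Q : Def K P -> Def K Q ->
  exists phi psi l, Forall K l /\ forall e,
    (sat (params l e) phi <-> P e) /\ (sat (params l e) psi <-> Q e).
Proof.
  intros (phi & l & Hl & H) (psi & k & Hk & H').
  exists (rename (fun n => if n <? length l then n else n + length k) phi),
    (rename (fun n => n + length l) psi), (l ++ k).
  split; [apply Forall_app; auto|].
  intro e; rewrite !sat_rename, <- H, <- H'.
  split; apply sat_ext; intro n; unfold params; cbv beta; rewrite length_app.
  - destruct (Nat.ltb_spec n (length l)) as [L|L].
    + rewrite app_nth1 by auto. apply nth_indep; auto.
    + rewrite app_nth2 by lia. rewrite !nth_overflow by lia. f_equal; lia.
  - rewrite app_nth2 by lia.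
    replace (n + length l - length l) with n by lia.
    replace (n + length l - (length l + length k)) with (n - length k) by lia.
    reflexivity.
Qed.

Lemma def_and P Q : Def K P -> Def K Q -> Def K (fun e => P e /\ Q e).
Proof.
  intros HP HQ; destruct (def_common HP HQ) as (f & g & l & Hl & H).
  exists (fAnd f g), l; split; auto; intro e; simpl.
  destruct (H e); tauto.
Qed.

Lemma def_or P Q : Def K P -> Def K Q -> Def K (fun e => P e \/ Q e).
Proof.
  intros HP HQ; destruct (def_common HP HQ) as (f & g & l & Hl & H).
  exists (fOr f g), l; split; auto; intro e; simpl.
  destruct (H e); tauto.
Qed.

Lemma def_imp P Q : Def K P -> Def K Q -> Def K (fun e => P e -> Q e).
Proof.
  intros HP HQ; destruct (def_common HP HQ) as (f & g & l & Hl & H).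
  exists (fImp f g), l; split; auto; intro e; simpl.
  destruct (H e); tauto.
Qed.

Lemma def_False : Def K (fun _ => False).
Proof. exists fFalse, nil; split; auto; simpl; tauto. Qed.

Lemma def_True : Def K (fun _ => True).
Proof. exists (fImp fFalse fFalse), nil; split; auto; simpl; tauto. Qed.

Lemma def_not P : Def K P -> Def K (fun e => ~ P e).
Proof. intro H; apply (def_imp H def_False). Qed.

Lemma def_iff P Q : Def K P -> Def K Q -> Def K (fun e => P e <-> Q e).
Proof. intros HP HQ; apply def_and; apply def_imp; auto. Qed.

(** A quantifier binds a variable placed before the parameters, whereas the
    bound variable has to come right after the [k] parameters. *)
Definition pull k (n : nat) : nat :=
  if n <? k then S n else if n =? k then 0 else n.

Lemma params_scons (l : list M) x e n :
  scons x (params l e) (pull (length l) n) = params l (scons x e) n.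
Proof.
  unfold pull, params.
  destruct (Nat.ltb_spec n (length l)) as [L|L]; cbn [scons].
  - apply nth_indep; auto.
  - destruct (Nat.eqb_spec n (length l)) as [E|E]; cbn [scons].
    + rewrite nth_overflow by lia. replace (n - length l) with 0 by lia.
      reflexivity.
    + destruct n as [|n]; [lia|]; cbn [scons].
      rewrite !nth_overflow by lia.
      replace (S n - length l) with (S (n - length l)) by lia.
      reflexivity.
Qed.

Lemma def_all (P : M -> (nat -> M) -> Prop) :
  Def K (fun e => P (e 0) (fun n => e (S n))) ->
  Def K (fun e => forall x, P x e).
Proof.
  intros (phi & l & Hl & H).
  exists (fAll (rename (pull (length l)) phi)), l; split; auto.
  intro e; simpl.
  assert (E : forall x, sat (scons x (params l e))
      (rename (pull (length l)) phi) <-> P x e).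
  { intro x; rewrite sat_rename, (sat_ext _ (params_scons l x e)).
    apply H. }
  split; intros H1 x; apply E, H1.
Qed.

Lemma def_ex (P : M -> (nat -> M) -> Prop) :
  Def K (fun e => P (e 0) (fun n => e (S n))) ->
  Def K (fun e => exists x, P x e).
Proof.
  intros (phi & l & Hl & H).
  exists (fEx (rename (pull (length l)) phi)), l; split; auto.
  intro e; simpl.
  assert (E : forall x, sat (scons x (params l e))
      (rename (pull (length l)) phi) <-> P x e).
  { intro x; rewrite sat_rename, (sat_ext _ (params_scons l x e)).
    apply H. }
  split; intros [x H1]; exists x; apply E, H1.
Qed.

Lemma tdef_var i : TDef K (fun e => e i).
Proof. exists (fEq 0 (S i)), nil; split; auto; simpl; tauto. Qed.

Lemma tdef_const a : K a -> TDef K (fun _ => a).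
Proof.
  intro Ka; exists (fEq 1 0), [a]; split; auto; simpl; tauto.
Qed.

Lemma tdef_rename (r : nat -> nat) t :
  TDef K t -> TDef K (fun e => t (fun n => e (r n))).
Proof. intro H; apply (def_rename (up r) H). Qed.

Lemma def_subst t (P : M -> (nat -> M) -> Prop) :
  TDef K t -> Def K (fun e => P (e 0) (fun n => e (S n))) ->
  Def K (fun e => P (t e) e).
Proof.
  intros Ht HP.
  apply def_ext with (fun e => exists x, x = t e /\ P x e).
  - intro e; split; [intros (x & -> & H); auto | eauto].
  - apply def_ex, def_and; auto.
Qed.

Lemma def_eq s t : TDef K s -> TDef K t -> Def K (fun e => s e = t e).
Proof.
  intros Hs Ht; apply (def_subst (P := fun x e => x = t e) Hs), Ht.
Qed.

Lemma def_mem s t : TDef K s -> TDef K t -> Def K (fun e => s e ∈ t e).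
Proof.
  intros Hs Ht.
  apply (def_subst (P := fun x e => x ∈ t e) Hs).
  apply (def_subst (P := fun x e => e 0 ∈ x) (tdef_rename S Ht)).
  exists (fMem 1 0), nil; split; auto; simpl; tauto.
Qed.

Lemma def_atom t : TDef K t -> Def K (fun e => atom (t e)).
Proof.
  intro Ht; apply (def_subst (P := fun x e => atom x) Ht).
  exists (fAtom 0), nil; split; auto; simpl; tauto.
Qed.

Lemma def_app1 (R : M -> Prop) s : Def K (fun e => R (e 0)) ->
  TDef K s -> Def K (fun e => R (s e)).
Proof.
  intros H Hs; apply (def_subst (P := fun x _ => R x) Hs), H.
Qed.

Lemma def_app2 (R : M -> M -> Prop) s t : Def K (fun e => R (e 0) (e 1)) ->
  TDef K s -> TDef K t -> Def K (fun e => R (s e) (t e)).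
Proof.
  intros H Hs Ht; apply (def_subst (P := fun x e => R x (t e)) Hs).
  apply (def_subst (P := fun y e => R (e 0) y) (tdef_rename S Ht)).
  exact (def_rename (fun n => match n with 0 => 1 | _ => 0 end) H).
Qed.

Lemma def_app3 (R : M -> M -> M -> Prop) r s t :
  Def K (fun e => R (e 0) (e 1) (e 2)) ->
  TDef K r -> TDef K s -> TDef K t -> Def K (fun e => R (r e) (s e) (t e)).
Proof.
  intros H Hr Hs Ht; apply (def_subst (P := fun x e => R x (s e) (t e)) Hr).
  apply (def_subst (P := fun y e => R (e 0) y (t (fun n => e (S n))))
    (tdef_rename S Hs)).
  apply (def_subst (P := fun z e => R (e 1) (e 0) z)
    (tdef_rename (fun n => S (S n)) Ht)).
  exact (def_rename (fun n => match n with 0 => 2 | 1 => 1 | _ => 0 end) H).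
Qed.

End Closure.

Lemma def_mono (M : eps_structure) (K K' : M -> Prop) P :
  (forall x, K x -> K' x) -> Def K P -> Def K' P.
Proof.
  intros HK (phi & l & Hl & H); exists phi, l; split; auto.
  eapply Forall_impl; eauto.
Qed.

(** One step of a structural search for a formula: connectives, quantifiers and
    atomic conditions are handled by the closure lemmas, hypotheses give the
    definability of abstract predicates, and any other predicate or operation
    is unfolded. *)
Ltac head_of t := lazymatch t with ?f _ => head_of f | _ => t end.

Ltac unfold_head t := let h := head_of t in unfold h.

Ltac def_step :=
  cbv beta;
  match goal with
  | H : TDef ?K ?t |- TDef ?K ?t => exact H
  | H : TDef ?K ?t |- TDef ?K (fun e => ?t _) => exact (@tdef_rename _ K _ t H)
  | H : Def ?K (fun e => ?R (e 0)) |- Def ?K (fun e => ?R _) =>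
      apply (def_app1 (R := R) H)
  | H : Def ?K (fun e => ?R (e 0) (e 1)) |- Def ?K (fun e => ?R _ _) =>
      apply (def_app2 (R := R) H)
  | H : Def ?K (fun e => ?R (e 0) (e 1) (e 2)) |- Def ?K (fun e => ?R _ _ _) =>
      apply (def_app3 (R := R) H)
  | |- TDef _ (fun e => e _) => apply tdef_var
  | |- TDef _ (fun _ => ?c) =>
      apply tdef_const; solve [exact I | assumption | auto]
  | |- Def _ (fun e => _ /\ _) => apply def_and
  | |- Def _ (fun e => _ \/ _) => apply def_or
  | |- Def _ (fun e => ~ _) => apply def_not
  | |- Def _ (fun e => _ <-> _) => apply def_iff
  | |- Def _ (fun e => False) => apply def_False
  | |- Def _ (fun e => True) => apply def_True
  | |- Def _ (fun e => @ex _ _) => apply def_ex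
  | |- Def _ (fun e => _ = _) => apply def_eq
  | |- Def _ (fun e => mem _ _) => apply def_mem
  | |- Def _ (fun e => atom _) => apply def_atom
  | |- Def _ (fun e => _ -> _) => apply def_imp
  | |- Def _ (fun e => forall x, _) => apply def_all
  | |- Def _ (fun e => ?f _) => unfold_head f
  | |- Def _ (fun e => ?f _ _) => unfold_head f
  | |- Def _ (fun e => ?f _ _ _) => unfold_head f
  | |- Def _ (fun e => ?f _ _ _ _) => unfold_head f
  | |- TDef _ (fun e => ?f _) => unfold_head f
  | |- TDef _ (fun e => ?f _ _) => unfold_head f
  | |- TDef _ (fun e => ?f _ _ _) => unfold_head f
  end.

(** * Elementary set theory inside a model of ZFA *)

(** The operations below are used both in the ground model and in the
    permutation model; as a class, the axioms are found for either. *)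
Existing Class ZFA.

Lemma ZFA_inhabited (M : eps_structure) (Z : ZFA M) : inhabited M.
Proof. destruct (zfa_empty Z) as [x _]; exact (inhabits x). Qed.

(** This first-order condition on [z] is the graph of the description operator
    [the]: its value is the unique solution of [P], or the empty set if [P] does
    not have exactly one solution. *)
Definition the_spec (M : eps_structure) (P : M -> Prop) (z : M) : Prop :=
  (P z /\ forall z', P z' -> z' = z) \/
  (~ (exists z', P z' /\ forall z'', P z'' -> z'' = z') /\ is_empty z).

Definition the (M : eps_structure) {Z : ZFA M} (P : M -> Prop) : M :=
  epsilon (ZFA_inhabited Z) (the_spec P).

Section Description.
Context {M : eps_structure} {Z : ZFA M}.
Implicit Types a x y z p s t u v w f g h d : M.

Lemma ext x y : is_set x -> is_set y -> (forall z, z ∈ x <-> z ∈ y) -> x = y.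
Proof. apply (zfa_extensionality Z). Qed.

Lemma empty_unique x y : is_empty x -> is_empty y -> x = y.
Proof. intros [A1 A2] [B1 B2]; apply ext; firstorder. Qed.

Lemma the_correct (P : M -> Prop) : the_spec P (the P).
Proof.
  unfold the. apply epsilon_spec.
  destruct (classic (exists z', P z' /\ forall z'', P z'' -> z'' = z'))
    as [(z & H1 & H2) | N].
  - exists z; left; auto.
  - destruct (zfa_empty Z) as [x Hx]; exists x; right; auto.
Qed.

Lemma the_eq (P : M -> Prop) z : P z -> (forall z', P z' -> z' = z) ->
  the P = z.
Proof.
  intros H1 H2; destruct (the_correct P) as [[H3 _] | [N _]].
  - auto.
  - destruct N; eauto.
Qed.

Lemma the_spec_iff (P : M -> Prop) z : z = the P <-> the_spec P z.
Proof.
  split; [intros ->; apply the_correct|].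
  intros [[H1 H2] | [N E]]; [symmetry; apply the_eq; auto|].
  destruct (the_correct P) as [[H3 H4] | [_ E']].
  - destruct N; eauto.
  - apply empty_unique; auto.
Qed.

(** A function introduced by a definable description is definable, since
    [the_spec] is a formula in [P]. *)
Lemma tdef_the (K : M -> Prop) (P : M -> (nat -> M) -> Prop) :
  Def K (fun e => P (e 0) (fun n => e (S n))) ->
  TDef K (fun e => the (fun z => P z e)).
Proof.
  intro H; unfold TDef.
  assert (H' : forall r : nat -> nat,
    Def K (fun e => P (e (r 0)) (fun n => e (r (S n))))).
  { intro r; exact (def_rename r H). }
  eapply def_ext; [intro e; symmetry; apply the_spec_iff|].
  unfold the_spec; cbv beta.
  apply def_or; [apply def_and | apply def_and].
  - exact (H' (fun n => n)).
  - apply def_all, def_imp; [|repeat def_step].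
    exact (H' (fun n => match n with 0 => 0 | S k => S (S k) end)).
  - apply def_not, def_ex, def_and.
    + exact (H' (fun n => match n with 0 => 0 | S k => S (S k) end)).
    + apply def_all, def_imp; [|repeat def_step].
      exact (H' (fun n => match n with 0 => 0 | S k => S (S (S k)) end)).
  - repeat def_step.
Qed.

End Description.

Ltac def :=
  repeat first
    [ lazymatch goal with |- TDef _ (fun e => the _) => apply tdef_the end
    | def_step ].

Notation dfn := (Def (fun _ => True)).

Section Basics.
Context {M : eps_structure} {Z : ZFA M}.
Implicit Types a x y z p s t u v w f g h d : M.

Lemma mem_set x y : x ∈ y -> is_set y.
Proof. intros H A; exact (zfa_atom_empty Z A H). Qed.

Lemma separation (P : M -> Prop) x : dfn (fun e => P (e 0)) ->
  exists y, is_set y /\ forall z, z ∈ y <-> z ∈ x /\ P z.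
Proof.
  intros (phi & l & _ & H).
  destruct (zfa_separation Z (rename (pull (length l)) phi)
    (params l (fun _ => x)) x) as (y & Hy & E).
  exists y; split; auto. intro z; rewrite E, sat_rename.
  rewrite (sat_ext _ (params_scons l z (fun _ => x))), H; reflexivity.
Qed.

(** In [zfa_replacement] the variables come before the parameters, in the order
    argument, value. *)
Lemma replacement (P : M -> M -> Prop) x : dfn (fun e => P (e 0) (e 1)) ->
  (forall u v w, u ∈ x -> P u v -> P u w -> v = w) ->
  exists y, is_set y /\ forall v, v ∈ y <-> exists u, u ∈ x /\ P u v.
Proof.
  intros (phi & l & _ & H) Hf.
  set (psi := rename (fun n => if n <? length l then S (S n) else
                 if n =? length l then 0 else
                 if n =? S (length l) then 1 else n) phi).
  assert (E : forall u v, sat (scons u (scons v (params l (fun _ => x)))) psi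
                <-> P u v).
  { intros u v. unfold psi; rewrite sat_rename.
    rewrite <- (H (scons u (scons v (fun _ => x)))).
    apply sat_ext; intro n; unfold params; cbv beta.
    destruct (Nat.ltb_spec n (length l)) as [L|L]; cbn [scons].
    - apply nth_indep; auto.
    - rewrite (nth_overflow l) by lia.
      destruct (Nat.eqb_spec n (length l)) as [D|D]; cbn [scons].
      + replace (n - length l) with 0 by lia; reflexivity.
      + destruct (Nat.eqb_spec n (S (length l))) as [D'|D']; cbn [scons].
        * replace (n - length l) with 1 by lia; reflexivity.
        * destruct n as [|[|n]]; [lia|lia|]; cbn [scons].
          rewrite nth_overflow by lia.
          replace (S (S n) - length l) with (S (S (n - length l))) by lia.
          reflexivity. }
  destruct (@zfa_replacement M Z psi (params l (fun _ => x)) x) as (y & Hy & E').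
  - intros u v w Hu; rewrite !E; eauto.
  - exists y; split; auto. intro v; rewrite E'.
    split; intros (u & H1 & H2); exists u; split; auto; apply E; auto.
Qed.

Definition emp : M := the (fun x => is_empty x).
Lemma emp_empty : is_empty emp.
Proof.
  destruct (zfa_empty Z) as [x Hx].
  unfold emp; erewrite the_eq; eauto using empty_unique.
Qed.
Lemma emp_set : is_set emp.
Proof. apply emp_empty. Qed.
Lemma emp_mem x : x ∉ emp.
Proof. apply emp_empty. Qed.
Lemma eq_emp x : is_set x -> (forall z, z ∉ x) -> x = emp.
Proof. intros; apply empty_unique; [split; auto | apply emp_empty]. Qed.

Definition upr x y : M := the (fun p => is_upair p x y).
Lemma upair_unique p q x y : is_upair p x y -> is_upair q x y -> p = q.
Proof.
  intros H1 H2; apply ext.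
  - apply (@mem_set x), H1; auto.
  - apply (@mem_set x), H2; auto.
  - intro z; rewrite (H1 z), (H2 z); tauto.
Qed.
Lemma upr_spec x y : is_upair (upr x y) x y.
Proof.
  destruct (zfa_pairing Z x y) as [p Hp].
  unfold upr; rewrite (the_eq (P := fun p => is_upair p x y) Hp); auto.
  intros; eapply upair_unique; eauto.
Qed.
Lemma upr_mem z x y : z ∈ upr x y <-> z = x \/ z = y.
Proof. apply upr_spec. Qed.
Lemma upair_iff p x y : is_upair p x y <-> p = upr x y.
Proof.
  split; [|intros ->; apply upr_spec].
  intro; eapply upair_unique; eauto using upr_spec.
Qed.

Definition pr x y : M := upr (upr x x) (upr x y).
Lemma pair_iff p x y : is_pair p x y <-> p = pr x y.
Proof.
  unfold is_pair, pr; split.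
  - intros (s & t & H1 & H2 & H3).
    rewrite upair_iff in H1, H2, H3; congruence.
  - intros ->; exists (upr x x), (upr x y); rewrite !upair_iff; auto.
Qed.
Lemma rel_iff r x y : rel r x y <-> pr x y ∈ r.
Proof.
  unfold rel; split.
  - intros (p & H1 & H2); rewrite pair_iff in H1; congruence.
  - intro H; exists (pr x y); rewrite pair_iff; auto.
Qed.

Lemma upr_eq x y x' y' : upr x y = upr x' y' ->
  (x = x' /\ y = y') \/ (x = y' /\ y = x').
Proof.
  intro H.
  assert (E : forall z, (z = x \/ z = y) <-> (z = x' \/ z = y'))
    by (intro z; rewrite <- !upr_mem, H; tauto).
  pose proof (proj1 (E x) (or_introl eq_refl)) as H1.
  pose proof (proj1 (E y) (or_intror eq_refl)) as H2.
  pose proof (proj2 (E x') (or_introl eq_refl)) as H3.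
  pose proof (proj2 (E y') (or_intror eq_refl)) as H4.
  intuition congruence.
Qed.
Lemma pr_inj x y x' y' : pr x y = pr x' y' -> x = x' /\ y = y'.
Proof.
  intro H; destruct (upr_eq H) as [[H1 H2] | [H1 H2]];
    destruct (upr_eq H1); destruct (upr_eq H2); intuition congruence.
Qed.

Lemma no_cycle1 x : x ∉ x.
Proof.
  intro H. destruct (zfa_foundation Z (x := upr x x)) as (y & H1 & H2).
  - exists x; apply upr_mem; auto.
  - apply upr_mem in H1; assert (y = x) by tauto; subst.
    apply (H2 x); auto. apply upr_mem; auto.
Qed.
Lemma no_cycle2 x y : x ∈ y -> y ∉ x.
Proof.
  intros H H'. destruct (zfa_foundation Z (x := upr x y)) as (z & H1 & H2).
  - exists x; apply upr_mem; auto.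
  - apply upr_mem in H1; destruct H1 as [-> | ->].
    + apply (H2 y); auto. apply upr_mem; auto.
    + apply (H2 x); auto. apply upr_mem; auto.
Qed.

Definition U x : M := the (fun u => is_set u /\
  forall z, z ∈ u <-> exists y, y ∈ x /\ z ∈ y).
Lemma U_spec x : is_set (U x) /\ forall z, z ∈ U x <-> exists y, y ∈ x /\ z ∈ y.
Proof.
  destruct (zfa_union Z x) as [u Hu]; unfold U; rewrite (the_eq Hu); auto.
  intros u' [H1 H2]; apply ext; auto; [apply Hu|].
  intro z; rewrite H2; symmetry; apply Hu.
Qed.
Lemma U_set x : is_set (U x).
Proof. apply U_spec. Qed.
Lemma U_mem z x : z ∈ U x <-> exists y, y ∈ x /\ z ∈ y.
Proof. apply U_spec. Qed.

Definition bun x y : M := U (upr x y).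
Lemma bun_set x y : is_set (bun x y).
Proof. apply U_set. Qed.
Lemma bun_mem z x y : z ∈ bun x y <-> z ∈ x \/ z ∈ y.
Proof.
  unfold bun; rewrite U_mem; split.
  - intros (u & H1 & H2); apply upr_mem in H1; destruct H1; subst; auto.
  - intros [H|H]; eexists; (split; [apply upr_mem|exact H]); auto.
Qed.
Definition adj x a : M := bun x (upr a a).
Lemma adj_set x y : is_set (adj x y).
Proof. apply U_set. Qed.
Lemma adj_mem z x a : z ∈ adj x a <-> z ∈ x \/ z = a.
Proof. unfold adj; rewrite bun_mem, upr_mem; tauto. Qed.

Definition suc n : M := adj n n.
Lemma succ_iff n s : is_succ n s <-> s = suc n.
Proof.
  split.
  - intro H; apply ext; [|apply adj_set|].
    + apply (@mem_set n), H; auto.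
    + intro z; unfold suc; rewrite adj_mem; apply H.
  - intros -> z; apply adj_mem.
Qed.
Lemma suc_mem z n : z ∈ suc n <-> z ∈ n \/ z = n.
Proof. apply adj_mem. Qed.
Lemma suc_inj n m : is_set n -> is_set m -> suc n = suc m -> n = m.
Proof.
  intros Hn Hm H.
  assert (E : forall z, (z ∈ n \/ z = n) <-> (z ∈ m \/ z = m))
    by (intro z; rewrite <- !suc_mem, H; tauto).
  destruct (proj1 (E n) (or_intror eq_refl)) as [H1|H1]; auto.
  destruct (proj2 (E m) (or_intror eq_refl)) as [H2|H2]; auto.
  destruct (no_cycle2 H1 H2).
Qed.
Lemma suc_not_emp n : suc n <> emp.
Proof.
  intro H; apply (@emp_mem n); rewrite <- H; apply suc_mem; auto.
Qed.

End Basics.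

(** * Natural numbers and recursion *)

Section Omega.
Context {M : eps_structure} {Z : ZFA M}.
Implicit Types a x y z p u v w f g h d k n m : M.

Lemma inductive_iff w :
  inductive w <-> emp ∈ w /\ forall n, n ∈ w -> suc n ∈ w.
Proof.
  unfold inductive; split.
  - intros [(o & Ho & Hw) H]; split.
    + rewrite <- (empty_unique Ho emp_empty); auto.
    + intros n Hn; destruct (H n Hn) as (s & Hs & Hsw).
      rewrite succ_iff in Hs; subst; auto.
  - intros [H1 H2]; split; [exists emp; split; auto using emp_empty|].
    intros n Hn; exists (suc n); rewrite succ_iff; auto.
Qed.

Lemma omega_exists : exists w, is_omega w.
Proof.
  destruct (zfa_infinity Z) as [w Hw].
  destruct (@separation M Z (fun n => forall v, inductive v -> n ∈ v) w)
    as (o & Ho & E); [def|].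
  assert (Ei : emp ∈ o /\ forall n, n ∈ o -> suc n ∈ o).
  { split.
    - apply E; split; [apply inductive_iff; auto|].
      intros v Hv; apply inductive_iff in Hv; apply Hv.
    - intros n Hn; apply E in Hn; destruct Hn as [Hn1 Hn2]; apply E; split.
      + apply inductive_iff in Hw; apply Hw; auto.
      + intros v Hv. pose proof (Hn2 v Hv); apply inductive_iff in Hv.
        apply Hv; auto. }
  exists o; repeat split; auto; try (apply inductive_iff; auto).
  intros v Hv n Hn; apply E in Hn; apply Hn; auto.
Qed.

Definition omega : M := the (fun w => is_omega w).
Lemma omega_unique w w' : is_omega w -> is_omega w' -> w = w'.
Proof.
  intros (H1 & H2 & H3) (H1' & H2' & H3'); apply ext; auto.
  intro z; split; [apply H3 | apply H3']; auto.
Qed.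
Lemma omega_spec : is_omega omega.
Proof.
  destruct omega_exists as [w Hw]; unfold omega.
  rewrite (the_eq (P := fun w => is_omega w) Hw); auto.
  intros; apply omega_unique; auto.
Qed.
Lemma omega_iff w : is_omega w <-> w = omega.
Proof.
  split; [intro; apply omega_unique; auto using omega_spec|].
  intros ->; apply omega_spec.
Qed.

Lemma omega_emp : emp ∈ omega.
Proof. apply inductive_iff, omega_spec. Qed.
Lemma omega_suc n : n ∈ omega -> suc n ∈ omega.
Proof. apply inductive_iff, omega_spec. Qed.

Lemma omega_ind (P : M -> Prop) : dfn (fun e => P (e 0)) ->
  P emp -> (forall n, n ∈ omega -> P n -> P (suc n)) ->
  forall n, n ∈ omega -> P n.
Proof.
  intros D H0 HS n Hn.
  destruct (separation omega D) as (y & Hy & E).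
  assert (Hi : inductive y).
  { apply inductive_iff; split; [apply E; auto using omega_emp|].
    intros k Hk; apply E in Hk; destruct Hk; apply E.
    auto using omega_suc. }
  destruct omega_spec as (_ & _ & Hm).
  apply (Hm y Hi), E in Hn; tauto.
Qed.

Lemma omega_set n : n ∈ omega -> is_set n.
Proof.
  revert n; apply omega_ind; [def | apply emp_set | intros; apply adj_set].
Qed.

Lemma omega_suc_le n : n ∈ omega -> forall m, m ∈ n -> suc m ∈ suc n.
Proof.
  revert n; apply (omega_ind (P := fun n => forall m, m ∈ n -> suc m ∈ suc n)).
  - def.
  - intros m Hm; destruct (emp_mem Hm).
  - intros n Hn IH m Hm; apply suc_mem in Hm; apply suc_mem.
    destruct Hm as [Hm| ->]; auto.
Qed.

Lemma omega_emp_le n : n ∈ omega -> emp ∈ suc n.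
Proof.
  revert n; apply (omega_ind (P := fun n => emp ∈ suc n)).
  - def.
  - apply suc_mem; auto.
  - intros n Hn IH; apply suc_mem; auto.
Qed.

(** Foundation yields minimal natural numbers; trichotomy makes them unique, and
    it makes the stages of a recursion comparable. *)
Lemma omega_trichotomy n : n ∈ omega ->
  forall m, m ∈ omega -> m ∈ n \/ m = n \/ n ∈ m.
Proof.
  revert n; apply (omega_ind
    (P := fun n => forall m, m ∈ omega -> m ∈ n \/ m = n \/ n ∈ m)).
  - def.
  - intros m Hm; apply omega_emp_le, suc_mem in Hm; intuition congruence.
  - intros n Hn IH m Hm; rewrite !suc_mem.
    destruct (IH m Hm) as [H1|[H1|H1]]; auto.
    apply (omega_suc_le Hm), suc_mem in H1; intuition congruence.
Qed.

End Omega.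

Section Recursion.
Context {M : eps_structure} {Z : ZFA M}.
Implicit Types a x y z p u v w f g h d k n m r : M.
Variables (x0 : M) (step : M -> M -> M -> Prop).

(** [u] is the [n]-th term of a sequence that starts with [x0] and follows
    [step]; the witness [r] is a set of pairs in which every pair is justified
    by an earlier one. *)
Definition iterate n u : Prop := exists r,
  (forall k w, rel r k w -> (k = emp /\ w = x0) \/
     exists k' w', k' ∈ omega /\ k = suc k' /\ rel r k' w' /\ step k' w' w) /\
  rel r n u.

Lemma def_iterate (K : M -> Prop) (s t : (nat -> M) -> M) :
  TDef K (fun _ => x0) ->
  Def K (fun e => step (e 0) (e 1) (e 2)) ->
  TDef K s -> TDef K t -> Def K (fun e => iterate (s e) (t e)).
Proof.
  intros H0 HD Hs Ht; unfold iterate.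
  def.
Qed.

Lemma iterate_emp : iterate emp x0.
Proof.
  exists (upr (pr emp x0) (pr emp x0)); split.
  - intros k w H; rewrite rel_iff, upr_mem in H.
    left; apply pr_inj; tauto.
  - rewrite rel_iff, upr_mem; auto.
Qed.

Lemma iterate_suc n u v :
  n ∈ omega -> iterate n u -> step n u v -> iterate (suc n) v.
Proof.
  intros Hn (r & H1 & H2) HS.
  exists (adj r (pr (suc n) v)); split.
  - intros k w H; rewrite rel_iff, adj_mem in H; destruct H as [H|H].
    + rewrite <- rel_iff in H.
      destruct (H1 _ _ H) as [H3|(k' & w' & H3 & H4 & H5 & H6)]; auto.
      right; exists k', w'; repeat split; auto.
      rewrite rel_iff in *; apply adj_mem; auto.
    + apply pr_inj in H; destruct H; subst.
      right; exists n, u; repeat split; auto.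
      rewrite rel_iff in *; apply adj_mem; auto.
  - rewrite rel_iff; apply adj_mem; auto.
Qed.

Lemma iterate_emp_inv u : iterate emp u -> u = x0.
Proof.
  intros (r & H1 & H2); destruct (H1 _ _ H2) as [H|(k & w & _ & H & _)].
  - tauto.
  - symmetry in H; destruct (suc_not_emp H).
Qed.

Lemma iterate_suc_inv n v : n ∈ omega -> iterate (suc n) v ->
  exists u, iterate n u /\ step n u v.
Proof.
  intros Hn (r & H1 & H2).
  destruct (H1 _ _ H2) as [H|(k & w & Hk & H & H3 & H4)].
  - destruct (suc_not_emp (proj1 H)).
  - pose proof (suc_inj (omega_set Hn) (omega_set Hk) H); subst k.
    exists w; split; auto; exists r; auto.
Qed.

End Recursion.

(** * Transitive closures and induction on membership *)

Section TransitiveClosure.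
Context {M : eps_structure} {Z : ZFA M}.
Implicit Types a x y z p u v w f g h d k n m r : M.

Let it x : M -> M -> Prop := iterate x (fun _ u v => v = U u).

(** The union of the sets obtained from [x] by iterating the union operation. *)
Lemma transitive_closure_exists x : exists t, is_transitive_closure x t.
Proof.
  assert (D : dfn (fun e => it x (e 0) (e 1))).
  { apply def_iterate; def. }
  assert (Fun : forall n, n ∈ omega -> forall u v, it x n u -> it x n v -> u = v).
  { apply (omega_ind
      (P := fun n => forall u v, it x n u -> it x n v -> u = v)).
    - def.
    - intros u v H1 H2; apply iterate_emp_inv in H1, H2; congruence.
    - intros n Hn IH u v H1 H2.
      apply iterate_suc_inv in H1, H2; auto.
      destruct H1 as (u' & H1 & ->), H2 as (v' & H2 & ->).
      f_equal; eauto. }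
  destruct (replacement (x := omega) D) as (y & Hy & E); [eauto|].
  exists (U y).
  assert (EU : forall z, z ∈ U y <-> exists n u, n ∈ omega /\ it x n u /\ z ∈ u).
  { intro z; rewrite U_mem; split.
    - intros (u & H1 & H2); apply E in H1.
      destruct H1 as (n & H1 & H3); eauto.
    - intros (n & u & H1 & H2 & H3); exists u; split; auto; apply E; eauto. }
  split; [apply U_set|split; [|split]].
  - intros z Hz w Hw; apply EU in Hz; destruct Hz as (n & u & H1 & H2 & H3).
    apply EU; exists (suc n), (U u); split; [auto using omega_suc|split].
    + eapply iterate_suc; eauto.
    + apply U_mem; eauto.
  - intros z Hz; apply EU; exists emp, x.
    split; [apply omega_emp|split; auto]. apply iterate_emp.
  - intros t Ht Hx.
    assert (H : forall n, n ∈ omega -> forall u, it x n u -> subset u t).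
    { apply (omega_ind (P := fun n => forall u, it x n u -> subset u t)).
      - def.
      - intros u H; apply iterate_emp_inv in H; subst; auto.
      - intros n Hn IH v H; apply iterate_suc_inv in H; auto.
        destruct H as (u & H1 & ->). intros z Hz; apply U_mem in Hz.
        destruct Hz as (w & H2 & H3); eapply Ht; eauto; eapply IH; eauto. }
    intros z Hz; apply EU in Hz; destruct Hz as (n & u & H1 & H2 & H3).
    eapply H; eauto.
Qed.

(** Foundation is an axiom about sets only; a counterexample to a property is
    turned into a minimal one inside the transitive closure of its singleton. *)
Lemma eps_ind (P : M -> Prop) : dfn (fun e => P (e 0)) ->
  (forall x, (forall y, y ∈ x -> P y) -> P x) -> forall x, P x.
Proof.
  intros D HP x. apply NNPP; intro N.
  destruct (transitive_closure_exists (upr x x)) as (t & Ht & Tt & Hx & _).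
  destruct (@separation M Z (fun z => ~ P z) t) as (s & Hs & E).
  { def. }
  destruct (zfa_foundation Z (x := s)) as (y & H1 & H2).
  - exists x; apply E; split; auto. apply Hx, upr_mem; auto.
  - apply E in H1; destruct H1 as [H1 H3]; apply H3, HP.
    intros z Hz; apply NNPP; intro N'.
    apply (H2 z); auto; apply E; split; auto. eapply Tt; eauto.
Qed.

End TransitiveClosure.

(** * Functions and finite sets *)

Section Functions.
Context {M : eps_structure} {Z : ZFA M}.
Implicit Types a x y z p u v w f g h d k n m r X Y : M.

Lemma function_exists (R : M -> M -> Prop) X :
  dfn (fun e => R (e 0) (e 1)) ->
  (forall x, x ∈ X -> exists! y, R x y) ->
  exists f, is_function_on f X /\ forall x y, rel f x y <-> x ∈ X /\ R x y.
Proof.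
  intros D H.
  destruct (@replacement M Z (fun x p => exists y, R x y /\ p = pr x y) X)
    as (f & Hf & E).
  - def.
  - intros x p q Hx (y & H1 & ->) (y' & H2 & ->); f_equal.
    destruct (H x Hx) as (y0 & _ & H3).
    rewrite <- (H3 _ H1); auto.
  - assert (E' : forall x y, rel f x y <-> x ∈ X /\ R x y).
    { intros x y; rewrite rel_iff, E; split.
      - intros (x' & H1 & y' & H2 & H3); apply pr_inj in H3.
        destruct H3; subst; auto.
      - intros [H1 H2]; exists x; eauto. }
    exists f; split; auto; split; [auto|split].
    + intros p Hp; apply E in Hp; destruct Hp as (x & H1 & y & H2 & ->).
      exists x, y; split; auto; apply pair_iff; auto.
    + intros x Hx; destruct (H x Hx) as (y & H1 & H2).
      exists y; split; [apply E'; auto|].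
      intros y' H3; apply E' in H3; apply H2, H3.
Qed.

Lemma function_dom f X x y : is_function_on f X -> rel f x y -> x ∈ X.
Proof.
  intros (_ & H & _) Hr; rewrite rel_iff in Hr; destruct (H _ Hr) as (x' & y' & H1 & H2).
  apply pair_iff, pr_inj in H2; destruct H2; subst; auto.
Qed.
Lemma function_total f X x : is_function_on f X -> x ∈ X -> exists y, rel f x y.
Proof. intros (_ & _ & H) Hx; destruct (H x Hx) as (y & Hy & _); eauto. Qed.
Lemma function_fun f X x y z :
  is_function_on f X -> rel f x y -> rel f x z -> y = z.
Proof.
  intros Hf H1 H2; pose proof (function_dom Hf H1) as Hx.
  destruct Hf as (_ & _ & H); destruct (H x Hx) as (u & _ & H3).
  rewrite <- (H3 _ H1); auto.
Qed.

Lemma relation_ext f g :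
  is_set f -> is_set g ->
  (forall p, p ∈ f -> exists x y, is_pair p x y) ->
  (forall p, p ∈ g -> exists x y, is_pair p x y) ->
  (forall x y, rel f x y <-> rel g x y) -> f = g.
Proof.
  intros Hf Hg Pf Pg E; apply ext; auto; intro p; split; intro Hp.
  - destruct (Pf p Hp) as (x & y & H); apply pair_iff in H; subst.
    apply rel_iff, E, rel_iff; auto.
  - destruct (Pg p Hp) as (x & y & H); apply pair_iff in H; subst.
    apply rel_iff, E, rel_iff; auto.
Qed.

Lemma function_ext f g X Y : is_function_on f X -> is_function_on g Y ->
  (forall x y, rel f x y <-> rel g x y) -> f = g.
Proof.
  intros (Sf & Pf & _) (Sg & Pg & _) E; apply relation_ext; auto;
    intros p Hp; [destruct (Pf p Hp) as (x & y & _ & H1)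
                 |destruct (Pg p Hp) as (x & y & _ & H1)]; eauto.
Qed.

Lemma bijection_exists (R : M -> M -> Prop) X Y :
  dfn (fun e => R (e 0) (e 1)) ->
  (forall x, x ∈ X -> exists! y, R x y) ->
  (forall x y, x ∈ X -> R x y -> y ∈ Y) ->
  (forall x x' y, x ∈ X -> x' ∈ X -> R x y -> R x' y -> x = x') ->
  (forall y, y ∈ Y -> exists x, x ∈ X /\ R x y) ->
  exists f, bijection f X Y /\ forall x y, rel f x y <-> x ∈ X /\ R x y.
Proof.
  intros D H1 H2 H3 H4.
  destruct (function_exists D H1) as (f & Hf & E).
  exists f; split; auto; split; [split; [split|]|]; auto.
  - intros x y H; apply E in H; destruct H; eauto.
  - intros x y z Hx Hy; apply E in Hx; apply E in Hy.
    destruct Hx, Hy; eauto.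
  - intros y Hy; destruct (H4 y Hy) as (x & Hx); exists x; apply E; auto.
Qed.

Lemma bijection_function f X Y : bijection f X Y -> is_function_on f X.
Proof. intros [[[H _] _] _]; auto. Qed.
Lemma bijection_range f X Y x y : bijection f X Y -> rel f x y -> y ∈ Y.
Proof. intros [[[_ H] _] _]; eauto. Qed.
Lemma bijection_inj f X Y x y z : bijection f X Y ->
  rel f x z -> rel f y z -> x = y.
Proof. intros [[_ H] _]; eauto. Qed.
Lemma bijection_surj f X Y y : bijection f X Y ->
  y ∈ Y -> exists x, rel f x y.
Proof. intros [_ H]; eauto. Qed.

Lemma inverse_iff f g : is_set g ->
  (forall p, p ∈ g -> exists x y, is_pair p x y) ->
  (is_inverse f g <-> forall x y, rel g x y <-> rel f y x).
Proof.
  intros Hg Pg; split.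
  - intros [_ H] x y; rewrite rel_iff, H; split.
    + intros (y' & x' & H1 & H2); apply pair_iff, pr_inj in H2.
      destruct H2; subst; auto.
    + intro H1; exists y, x; split; auto; apply pair_iff; auto.
  - intro H; split; auto; intro p; split.
    + intro Hp; destruct (Pg p Hp) as (x & y & E); exists y, x; split; auto.
      apply H; exists p; auto.
    + intros (x & y & H1 & H2); apply pair_iff in H2; subst.
      apply rel_iff, H; auto.
Qed.

Lemma composition_iff f g h : is_set h ->
  (forall p, p ∈ h -> exists x y, is_pair p x y) ->
  (is_composition f g h <->
   forall x z, rel h x z <-> exists y, rel g x y /\ rel f y z).
Proof.
  intros Hg Pg; split.
  - intros [_ H] x z; rewrite rel_iff, H; split.
    + intros (x' & y & z' & H1 & H2 & H3); apply pair_iff, pr_inj in H3.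
      destruct H3; subst; eauto.
    + intros (y & H1 & H2); exists x, y, z; repeat split; auto.
      apply pair_iff; auto.
  - intro H; split; auto; intro p; split.
    + intro Hp; destruct (Pg p Hp) as (x & z & E).
      assert (Hr : rel h x z) by (exists p; auto).
      apply H in Hr; destruct Hr as (y & H1 & H2).
      exists x, y, z; auto.
    + intros (x & y & z & H1 & H2 & H3); apply pair_iff in H3; subst.
      apply rel_iff, H; eauto.
Qed.

Lemma inverse_exists f X Y : bijection f X Y ->
  exists g, bijection g Y X /\ forall x y, rel g x y <-> rel f y x.
Proof.
  intro H; destruct (@bijection_exists (fun y x => rel f x y) Y X)
    as (g & Hg & E).
  - def.
  - intros y Hy; destruct (bijection_surj H Hy) as [x Hx].
    exists x; split; auto; intros; eapply bijection_inj; eauto.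
  - intros x y _ Hr; eapply function_dom; eauto using bijection_function.
  - intros x x' y _ _ H1 H2.
    eapply function_fun; eauto using bijection_function.
  - intros x Hx; destruct (function_total (bijection_function H) Hx) as [y Hy].
    exists y; split; auto. eapply bijection_range; eauto.
  - exists g; split; auto; intros x y; rewrite E; split; [tauto|].
    intro Hr; split; auto; eapply bijection_range; eauto.
Qed.

Lemma composition_exists f g X Y V : bijection g X Y -> bijection f Y V ->
  exists h, bijection h X V /\
    forall x z, rel h x z <-> exists y, rel g x y /\ rel f y z.
Proof.
  intros Hg Hf.
  destruct (@bijection_exists (fun x z => exists y, rel g x y /\ rel f y z) X V)
    as (h & Hh & E).
  - def.
  - intros x Hx; destruct (function_total (bijection_function Hg) Hx) as [y Hy].
    destruct (function_total (bijection_function Hf) (x := y)) as [z Hz].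
    + exact (bijection_range Hg Hy).
    + exists z; split; eauto. intros z' (y' & H1 & H2).
      rewrite (function_fun (bijection_function Hg) H1 Hy) in H2.
      exact (function_fun (bijection_function Hf) Hz H2).
  - intros x z _ (y & _ & H); exact (bijection_range Hf H).
  - intros x x' z _ _ (y & H1 & H2) (y' & H3 & H4).
    rewrite (bijection_inj Hf H4 H2) in H3. exact (bijection_inj Hg H1 H3).
  - intros z Hz; destruct (bijection_surj Hf Hz) as [y Hy].
    destruct (bijection_surj Hg (y := y)) as [x Hx].
    + exact (function_dom (bijection_function Hf) Hy).
    + exists x; split; eauto. exact (function_dom (bijection_function Hg) Hx).
  - exists h; split; auto; intros x z; rewrite E; split; [tauto|].
    intros (y & H1 & H2); split; eauto.
    exact (function_dom (bijection_function Hg) H1).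
Qed.

End Functions.

Section Finite.
Context {M : eps_structure} {Z : ZFA M}.
Implicit Types a x y z p u v w f g h d k n m r X Y : M.

Lemma finite_iff x : finite x <-> exists n f, n ∈ omega /\ bijection f x n.
Proof.
  unfold finite; split.
  - intros (w & n & f & Hw & H); apply omega_iff in Hw; subst; eauto.
  - intros (n & f & H); exists omega, n, f; split; auto using omega_spec.
Qed.

Lemma finite_emp : finite emp.
Proof.
  apply finite_iff; exists emp.
  destruct (@bijection_exists M Z (fun x y => x = y) emp emp) as (f & Hf & _).
  - def.
  - intros x Hx; destruct (emp_mem Hx).
  - intros x y Hx; destruct (emp_mem Hx).
  - intros x x' y Hx; destruct (emp_mem Hx).
  - intros x Hx; destruct (emp_mem Hx).
  - exists f; split; auto using omega_emp.
Qed.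

Lemma adj_in x a : is_set x -> a ∈ x -> adj x a = x.
Proof.
  intros Hx Ha; apply ext; auto using adj_set.
  intro z; rewrite adj_mem; intuition congruence.
Qed.

Lemma finite_adj x a : is_set x -> finite x -> finite (adj x a).
Proof.
  intros Sx Hx; destruct (classic (a ∈ x)) as [Ha|Ha].
  { rewrite adj_in; auto. }
  apply finite_iff in Hx; destruct Hx as (n & f & Hn & Hf).
  apply finite_iff; exists (suc n).
  destruct (@bijection_exists M Z
    (fun x y => rel f x y \/ (x = a /\ y = n)) (adj x a) (suc n))
    as (g & Hg & _).
  - def.
  - intros z Hz; apply adj_mem in Hz; destruct Hz as [Hz| ->].
    + destruct (function_total (bijection_function Hf) Hz) as [y Hy].
      exists y; split; auto. intros y' [H|[-> ->]]; [|contradiction].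
      eapply function_fun; eauto using bijection_function.
    + exists n; split; auto. intros y' [H|[_ ->]]; auto.
      destruct Ha; eapply function_dom; eauto using bijection_function.
  - intros z y _ [H|[-> ->]]; apply suc_mem; auto.
    left; eapply bijection_range; eauto.
  - intros z z' y _ _ [H1|[H1 ->]] [H2|[H2 E]]; subst; auto.
    + eapply bijection_inj; eauto.
    + destruct (@no_cycle1 M Z n); eapply bijection_range; eauto.
    + destruct (@no_cycle1 M Z n); eapply bijection_range; eauto.
  - intros y Hy; apply suc_mem in Hy; destruct Hy as [Hy| ->].
    + destruct (bijection_surj Hf Hy) as [z Hz]; exists z; split; auto.
      apply adj_mem; left; eapply function_dom; eauto using bijection_function.
    + exists a; split; auto; apply adj_mem; auto.
  - exists g; auto using omega_suc.
Qed.

(** Induction on the number of elements: removing the preimage of [n] from a set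
    in bijection with the successor of [n] leaves one in bijection with [n]. *)
Lemma finite_ind (P : M -> Prop) : dfn (fun e => P (e 0)) ->
  P emp -> (forall x a, is_set x -> P x -> P (adj x a)) ->
  forall x, is_set x -> finite x -> P x.
Proof.
  intros D H0 HS.
  assert (H : forall n, n ∈ omega -> forall x f, is_set x ->
                bijection f x n -> P x).
  { apply (omega_ind
      (P := fun n => forall x f, is_set x -> bijection f x n -> P x)).
    - def.
    - intros x f Hx Hf. rewrite (eq_emp Hx); auto.
      intros z Hz; destruct (function_total (bijection_function Hf) Hz) as [y Hy].
      apply (@emp_mem M Z y); eapply bijection_range; eauto.
    - intros n Hn IH x f Hx Hf.
      destruct (bijection_surj Hf (y := n)) as [a Ha]; [apply suc_mem; auto|].
      assert (Hax : a ∈ x)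
        by (eapply function_dom; eauto using bijection_function).
      destruct (@separation M Z (fun z => z <> a) x) as (y & Hy & E); [def|].
      assert (Ex : x = adj y a).
      { apply ext; auto using adj_set; intro z; rewrite adj_mem, E.
        destruct (classic (z = a)); subst; tauto. }
      rewrite Ex; apply HS; auto.
      destruct (@bijection_exists M Z (fun u v => rel f u v) y n)
        as (g & Hg & _).
      + def.
      + intros z Hz; apply E in Hz.
        destruct (function_total (bijection_function Hf) (proj1 Hz)) as [v Hv].
        exists v; split; auto; intros.
        eapply function_fun; eauto using bijection_function.
      + intros z v Hz Hv; apply E in Hz.
        pose proof (bijection_range Hf Hv) as H; apply suc_mem in H.
        destruct H as [H| ->]; auto.
        destruct Hz as [_ []]; eapply bijection_inj; eauto.
      + intros z z' v _ _ H1 H2; eapply bijection_inj; eauto.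
      + intros v Hv; destruct (bijection_surj Hf (y := v)) as [z Hz].
        * apply suc_mem; auto.
        * exists z; split; auto; apply E; split.
          -- eapply function_dom; eauto using bijection_function.
          -- intros ->; apply (@no_cycle1 M Z n).
             rewrite (function_fun (bijection_function Hf) Ha Hz) at 1; auto.
      + eapply IH; eauto. }
  intros x Hx Hf; apply finite_iff in Hf; destruct Hf as (n & f & Hn & Hf).
  eauto.
Qed.

Lemma finite_bun x y : is_set x -> finite x -> is_set y -> finite y ->
  finite (bun x y).
Proof.
  intros Hx Fx; revert y.
  apply (finite_ind (P := fun y => finite (bun x y))).
  - def.
  - replace (bun x emp) with x; auto. apply ext; auto using bun_set.
    intro z; rewrite bun_mem; pose proof (@emp_mem M Z z); tauto.
  - intros y a Hy IH.
    replace (bun x (adj y a)) with (adj (bun x y) a).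
    + apply finite_adj; auto using bun_set.
    + apply ext; auto using bun_set, adj_set.
      intro z; rewrite !adj_mem, !bun_mem, adj_mem; tauto.
Qed.

Lemma finite_image (R : M -> M -> Prop) x y : dfn (fun e => R (e 0) (e 1)) ->
  (forall u v w, R u v -> R u w -> v = w) ->
  is_set x -> finite x -> is_set y ->
  (forall v, v ∈ y <-> exists u, u ∈ x /\ R u v) -> finite y.
Proof.
  intros D HR Hx Fx; revert x Hx Fx y.
  apply (finite_ind (P := fun x => forall y, is_set y ->
    (forall v, v ∈ y <-> exists u, u ∈ x /\ R u v) -> finite y)).
  - def.
  - intros y Hy E; rewrite (eq_emp Hy); [apply finite_emp|].
    intros v Hv; apply E in Hv; destruct Hv as (u & Hu & _).
    apply (emp_mem Hu).
  - intros x a Hx IH y Hy E.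
    destruct (@replacement M Z R x) as (y' & Hy' & E'); eauto.
    specialize (IH y' Hy' E').
    destruct (classic (exists b, R a b)) as [[b Hb]|N].
    + replace y with (adj y' b); [apply finite_adj; auto|].
      apply ext; auto using adj_set; intro v; rewrite adj_mem, E, E'; split.
      * intros [(u & H1 & H2)| ->].
        -- exists u; rewrite adj_mem; auto.
        -- exists a; rewrite adj_mem; auto.
      * intros (u & H1 & H2); apply adj_mem in H1.
        destruct H1 as [H1| ->]; [left; eauto|right; eauto].
    + replace y with y'; auto.
      apply ext; auto; intro v; rewrite E, E'; split.
      * intros (u & H1 & H2); exists u; rewrite adj_mem; auto.
      * intros (u & H1 & H2); apply adj_mem in H1.
        destruct H1 as [H1| ->]; [eauto|destruct N; eauto].
Qed.

End Finite.

(** * The action of permutations of the atoms *)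

(** The right inverse [h'] supplies the witnesses for the quantifiers. *)
Lemma sat_automorphism (M : eps_structure) (h h' : M -> M) :
  (forall x, h (h' x) = x) ->
  (forall x y, x = y <-> h x = h y) ->
  (forall x y, x ∈ y <-> h x ∈ h y) ->
  (forall x, atom x <-> atom (h x)) ->
  forall p e, sat e p <-> sat (fun n => h (e n)) p.
Proof.
  intros C He Hm Ha; induction p; simpl; intro e; auto; try tauto.
  - rewrite IHp1, IHp2; tauto.
  - rewrite IHp1, IHp2; tauto.
  - rewrite IHp1, IHp2; tauto.
  - assert (E : forall x, sat (scons x e) p <->
                          sat (scons (h x) (fun n => h (e n))) p).
    { intro x; rewrite IHp; apply sat_ext; intros [|n]; reflexivity. }
    split; intros H x; [|apply E, H].
    rewrite <- (C x); apply E, H.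
  - assert (E : forall x, sat (scons x e) p <->
                          sat (scons (h x) (fun n => h (e n))) p).
    { intro x; rewrite IHp; apply sat_ext; intros [|n]; reflexivity. }
    split; intros [x H]; [exists (h x); apply E, H|].
    exists (h' x); apply E; rewrite C; auto.
Qed.

(** The parameters of the formula lie in [K], so [h] does not change them. *)
Lemma def_automorphism (M : eps_structure) (h h' : M -> M) (K : M -> Prop) P :
  (forall x, h (h' x) = x) ->
  (forall x y, x = y <-> h x = h y) ->
  (forall x y, x ∈ y <-> h x ∈ h y) ->
  (forall x, atom x <-> atom (h x)) ->
  (forall x, K x -> h x = x) ->
  Def K P -> forall e, P e <-> P (fun n => h (e n)).
Proof.
  intros C He Hm Ha HK (phi & l & Hl & H) e.
  rewrite <- !H, (sat_automorphism C He Hm Ha).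
  apply sat_ext; intro n; unfold params.
  destruct (Nat.ltb_spec n (length l)) as [L|L].
  - rewrite (nth_indep l (h (e (n - length l))) (e (n - length l)) L).
    apply HK. rewrite Forall_forall in Hl; apply Hl, nth_In; auto.
  - rewrite !nth_overflow; auto.
Qed.

Definition act (M : eps_structure) {Z : ZFA M} (pi x : M) : M :=
  the (fun y => acts pi x y).

Section Action.
Context {M : eps_structure} {Z : ZFA M}.
Implicit Types a x y z p u v w f g h d r : M.

Section OnePermutation.
Variables (A pi : M).
Hypothesis HA : is_atom_set A.
Hypothesis Hpi : bijection pi A A.

(** Values of the recursion do not depend on the approximation; by induction on
    the argument, since approximations have transitive domains. *)
Lemma approx_agree d h d' h' : action_approx pi d h -> action_approx pi d' h' ->
  forall x y y', rel h x y -> rel h' x y' -> y = y'.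
Proof.
  intros (Td & Fh & Ch) (Td' & Fh' & Ch').
  apply (eps_ind (P := fun x => forall y y', rel h x y -> rel h' x y' -> y = y')).
  { def. }
  intros x IH y y' H H'.
  destruct (Ch _ _ H) as [C1 C2], (Ch' _ _ H') as [C1' C2'].
  destruct (classic (atom x)) as [Hx|Hx].
  - apply (function_fun (bijection_function Hpi) (C1 Hx) (C1' Hx)).
  - destruct (C2 Hx) as [S1 E1], (C2' Hx) as [S2 E2].
    pose proof (function_dom Fh H) as Dx; pose proof (function_dom Fh' H') as Dx'.
    apply ext; auto; intro v; rewrite E1, E2; split; intros (u & H1 & H2).
    + destruct (function_total Fh' (x := u)) as [v' Hv']; [eapply Td'; eauto|].
      rewrite (IH u H1 v v' H2 Hv'); eauto.
    + destruct (function_total Fh (x := u)) as [v' Hv']; [eapply Td; eauto|].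
      rewrite <- (IH u H1 v' v Hv' H2); eauto.
Qed.

Lemma acts_fun x y y' : acts pi x y -> acts pi x y' -> y = y'.
Proof.
  intros (d & h & H1 & H2 & H3) (d' & h' & H1' & H2' & H3').
  eapply approx_agree; [exact H1|exact H1'|eauto|eauto].
Qed.

Lemma acts_atom x y : atom x -> acts pi x y -> rel pi x y.
Proof.
  intros Hx (d & h & (_ & _ & H) & _ & H2); apply (H _ _ H2); auto.
Qed.

Lemma acts_elem x y : acts pi x y -> forall u, u ∈ x -> exists v, acts pi u v.
Proof.
  intros (d & h & H1 & H2 & H3) u Hu.
  assert (Du : u ∈ d) by (destruct H1 as [T _]; eapply T; eauto).
  destruct (function_total (proj1 (proj2 H1)) Du) as [v Hv].
  exists v, d, h; auto.
Qed.

Lemma acts_set x y : is_set x -> acts pi x y ->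
  is_set y /\ forall v, v ∈ y <-> exists u, u ∈ x /\ acts pi u v.
Proof.
  intros Sx (d & h & H1 & H2 & H3).
  destruct H1 as (T & F & C).
  destruct (proj2 (C _ _ H3) Sx) as [S1 E]; split; auto.
  intro v; rewrite E; split; intros (u & Hu & Hv); exists u; split; auto.
  - exists d, h; split; [split|split]; auto. eapply T; eauto.
  - destruct (function_total F (x := u)) as [v' Hv']; [eapply T; eauto|].
    replace v with v'; auto.
    eapply acts_fun; [|exact Hv].
    exists d, h; split; [split|split]; auto. eapply T; eauto.
Qed.

(** If all elements of [x] have an image, so do all members of the transitive
    closure [t] of its singleton except perhaps [x].  Hence the images of these
    members, together with the image of [x] forced by the recursion clause, form
    an approximation with domain [t]. *)
Lemma acts_total x : exists y, acts pi x y.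
Proof.
  revert x; apply eps_ind; [def|]; intros x IH.
  apply NNPP; intro N.
  destruct (transitive_closure_exists (upr x x)) as (t & St & Tt & Hx & Mt).
  (* the members of t that are x or have an image form a transitive set *)
  assert (Ht : forall z, z ∈ t -> z = x \/ exists y, acts pi z y).
  { destruct (@separation M Z (fun z => z = x \/ exists y, acts pi z y) t)
      as (s & Ss & E); [def|].
    intros z Hz; apply E, Mt; auto.
    - intros u Hu w Hw; apply E in Hu; destruct Hu as [Hu1 Hu2].
      apply E; split; [eapply Tt; eauto|].
      destruct Hu2 as [-> | [v Hv]]; [auto|].
      right; eapply acts_elem; eauto.
    - intros u Hu; apply E; split; auto; apply upr_mem in Hu; tauto. }
  assert (Hv : exists v, (atom x -> rel pi x v) /\ (is_set x -> is_set v /\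
                 forall w, w ∈ v <-> exists u, u ∈ x /\ acts pi u w)).
  { destruct (classic (atom x)) as [Ax|Sx].
    - destruct (function_total (bijection_function Hpi) (x := x)) as [v Hv].
      + apply HA; auto.
      + exists v; split; auto; intro S; destruct (S Ax).
    - destruct (@replacement M Z (fun u w => acts pi u w) x) as (v & H1 & H2).
      + def.
      + intros; eapply acts_fun; eauto.
      + exists v; split; [intro; contradiction|]; auto. }
  destruct Hv as (v & Hv1 & Hv2).
  (* x itself has no image by assumption, so the two cases are disjoint *)
  destruct (@function_exists M Z
    (fun u w => (u <> x /\ acts pi u w) \/ (u = x /\ w = v)) t)
    as (h & Fh & Eh).
  { def. }
  { intros u Hu; destruct (classic (u = x)) as [-> | D].
    - exists v; split; auto; intros w [[H _]|[_ H]]; [destruct H|]; auto.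
    - destruct (Ht u Hu) as [E|[w Hw]]; [contradiction|].
      exists w; split; auto.
      intros w' [[_ H]|[H _]]; [eapply acts_fun; eauto|contradiction]. }
  assert (xt : x ∈ t) by (apply Hx, upr_mem; auto).
  apply N; exists v, t, h; split; [|split; auto; apply Eh; auto].
  split; [exact Tt|split; [exact Fh|]].
  intros u w H; apply Eh in H; destruct H as [Hu [[D Hw] | [-> ->]]].
  - split; [intro; apply acts_atom; auto|].
    intro Su; destruct (acts_set Su Hw) as [Sw Ew]; split; auto.
    intro z; rewrite Ew; split; intros (y & Hy & H); exists y; split; auto.
    + apply Eh; split; [eapply Tt; eauto|].
      left; split; auto; intros ->; eauto.
    + apply Eh in H; destruct H as [_ [[_ H] | [-> _]]]; auto.
      destruct N; exact (acts_elem Hw Hy).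
  - split; auto; intro Sx; destruct (Hv2 Sx) as [Sv Ev]; split; auto.
    intro z; rewrite Ev; split; intros (y & Hy & H); exists y; split; auto.
    + apply Eh; split; [eapply Tt; eauto|].
      left; split; auto; intros ->; destruct (no_cycle1 Hy).
    + apply Eh in H; destruct H as [_ [[_ H] | [-> _]]]; auto.
      destruct (no_cycle1 Hy).
Qed.

Lemma acts_iff x y : acts pi x y <-> y = act pi x.
Proof.
  destruct (acts_total x) as [z Hz].
  assert (E : act pi x = z).
  { apply the_eq; auto. intros; eapply acts_fun; eauto. }
  rewrite E; split; [intro; eapply acts_fun; eauto | intros ->; auto].
Qed.

Lemma act_atom x : atom x -> rel pi x (act pi x).
Proof. intro; apply acts_atom; auto; apply acts_iff; auto. Qed.

Lemma act_atom_iff x y : atom x -> (rel pi x y <-> y = act pi x).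
Proof.
  intro Hx; split.
  - intro H; apply (function_fun (bijection_function Hpi) H (act_atom Hx)).
  - intros ->; apply act_atom; auto.
Qed.

Lemma act_is_atom x : atom x -> atom (act pi x).
Proof.
  intro Hx; apply HA. apply (bijection_range Hpi (act_atom Hx)).
Qed.

Lemma act_is_set x : is_set x -> is_set (act pi x).
Proof.
  intro Hx; apply (@acts_set x); auto; apply acts_iff; auto.
Qed.

Lemma act_mem x v : is_set x ->
  (v ∈ act pi x <-> exists u, u ∈ x /\ v = act pi u).
Proof.
  intro Hx; rewrite (proj2 (acts_set Hx (proj2 (acts_iff x _) eq_refl))).
  split; intros (u & H1 & H2); exists u; split; auto; apply acts_iff; auto.
Qed.

End OnePermutation.

Section Group.
Variables A : M.
Hypothesis HA : is_atom_set A.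

(** By induction on membership, and likewise for the identity; thus [act] is an
    action of the group of permutations of the atoms on the universe. *)
Lemma act_comp s t r : bijection s A A -> bijection t A A -> bijection r A A ->
  (forall x z, rel r x z <-> exists y, rel t x y /\ rel s y z) ->
  forall x, act r x = act s (act t x).
Proof.
  intros Hs Ht Hr E; apply eps_ind; [def|]; intros x IH.
  destruct (classic (atom x)) as [Hx|Hx].
  - symmetry; apply (act_atom_iff HA Hr _ Hx), E.
    exists (act t x); split; [eapply act_atom; eauto|].
    eapply act_atom; eauto. eapply act_is_atom; eauto.
  - apply ext.
    + eapply act_is_set; eauto.
    + eapply act_is_set; eauto. eapply act_is_set; eauto.
    + intro v; rewrite (act_mem HA Hr v Hx).
      rewrite (act_mem HA Hs v (act_is_set HA Ht Hx)); split.
      * intros (u & Hu & ->); exists (act t u); rewrite IH; auto.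
        split; auto; apply (act_mem HA Ht); eauto.
      * intros (w & Hw & ->); apply (act_mem HA Ht) in Hw; auto.
        destruct Hw as (u & Hu & ->); exists u; rewrite IH; auto.
Qed.

Lemma act_id i : bijection i A A ->
  (forall x, x ∈ A -> rel i x x) -> forall x, act i x = x.
Proof.
  intros Hi E; apply eps_ind; [def|]; intros x IH.
  destruct (classic (atom x)) as [Hx|Hx].
  - symmetry; apply (act_atom_iff HA Hi _ Hx), E, HA; auto.
  - apply ext; auto.
    + eapply act_is_set; eauto.
    + intro v; rewrite (act_mem HA Hi v Hx); split.
      * intros (u & Hu & ->); rewrite IH; auto.
      * intros Hv; exists v; rewrite IH; auto.
Qed.

Lemma act_cancel s t : bijection s A A -> bijection t A A ->
  (forall x y, rel t x y <-> rel s y x) ->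
  forall x, act t (act s x) = x.
Proof.
  intros Hs Ht E x.
  destruct (composition_exists Hs Ht) as (i & Hi & Ei).
  rewrite <- (act_comp Ht Hs Hi Ei); apply act_id; auto.
  intros a Ha; apply Ei.
  destruct (function_total (bijection_function Hs) Ha) as [b Hb].
  exists b; split; auto; apply E; auto.
Qed.

Lemma act_inverse s : bijection s A A -> exists t, bijection t A A /\
  (forall x, act t (act s x) = x) /\ (forall x, act s (act t x) = x).
Proof.
  intro Hs; destruct (inverse_exists Hs) as (t & Ht & E).
  exists t; split; [|split]; auto; apply act_cancel; auto.
  intros x y; rewrite E; tauto.
Qed.

(** The action of a permutation is an automorphism of the structure. *)
Lemma def_act (K : M -> Prop) P s : bijection s A A ->
  (forall x, K x -> act s x = x) ->
  Def K P -> forall e, P e <-> P (fun n => act s (e n)).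
Proof.
  intros Hs HK D.
  destruct (act_inverse Hs) as (t & Ht & C1 & C2).
  apply (def_automorphism (h := act s) (h' := act t) (K := K)); auto.
  - intros x y; split; [congruence|].
    intro H; rewrite <- (C1 x), <- (C1 y), H; auto.
  - intros x y; split; intro H.
    + apply (act_mem HA Hs); [eapply mem_set; eauto|eauto].
    + assert (Hy : is_set y).
      { intro Hy; apply (mem_set H); eapply act_is_atom; eauto. }
      apply (act_mem HA Hs) in H; auto; destruct H as (u & Hu & H).
      rewrite <- (C1 x), H, C1; auto.
  - intros x; split; [eapply act_is_atom; eauto|].
    intro H; apply NNPP; intro N. apply (act_is_set HA Hs N); auto.
Qed.

(** An automorphism maps the unique solution of a condition with fixed
    parameters to a solution of the same condition. *)
Lemma act_fixes (K : M -> Prop) (P : M -> Prop) s x : bijection s A A ->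
  (forall y, K y -> act s y = y) -> Def K (fun e => P (e 0)) ->
  P x -> (forall y, P y -> y = x) -> act s x = x.
Proof.
  intros Hs HK D Hx Ux; apply Ux.
  apply (def_act Hs HK D (fun _ => x)); auto.
Qed.

End Group.
End Action.

(** * The permutation model satisfies ZFA *)

(** Satisfaction with all quantifiers restricted to the class [C]. *)
Fixpoint relsat (M : eps_structure) (C : M -> Prop) (e : nat -> M)
    (p : formula) : Prop :=
  match p with
  | fMem i j => e i ∈ e j
  | fEq i j => e i = e j
  | fAtom i => atom (e i)
  | fFalse => False
  | fImp p q => relsat C e p -> relsat C e q
  | fAnd p q => relsat C e p /\ relsat C e q
  | fOr p q => relsat C e p \/ relsat C e q
  | fAll p => forall x, C x -> relsat C (scons x e) p
  | fEx p => exists x, C x /\ relsat C (scons x e) p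
  end.

Lemma relsat_ext (M : eps_structure) (C : M -> Prop) p : forall e e',
  (forall n, e n = e' n) -> relsat C e p <-> relsat C e' p.
Proof.
  induction p; simpl; intros e e' H; rewrite ?H; try tauto.
  - rewrite (IHp1 _ _ H), (IHp2 _ _ H); tauto.
  - rewrite (IHp1 _ _ H), (IHp2 _ _ H); tauto.
  - rewrite (IHp1 _ _ H), (IHp2 _ _ H); tauto.
  - assert (E : forall x, relsat C (scons x e) p <-> relsat C (scons x e') p)
      by (intro x; apply IHp; intros [|n]; simpl; auto).
    split; intros H1 x Hx; apply E, H1, Hx.
  - assert (E : forall x, relsat C (scons x e) p <-> relsat C (scons x e') p)
      by (intro x; apply IHp; intros [|n]; simpl; auto).
    split; intros (x & Hx & H1); exists x; split; auto; apply E, H1.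
Qed.

(** The entries of the assignment are arbitrary definable terms, infinitely many
    of them; each formula reads only finitely many, and the induction on the
    formula takes care of this. *)
Lemma def_relsat (M : eps_structure) (C K : M -> Prop) p :
  Def K (fun e => C (e 0)) ->
  forall t : nat -> (nat -> M) -> M, (forall n, TDef K (t n)) ->
  Def K (fun e => relsat C (fun n => t n e) p).
Proof.
  intro D; induction p; simpl; intros t Ht.
  - apply def_mem; auto.
  - apply def_eq; auto.
  - apply def_atom; auto.
  - def.
  - apply def_imp; auto.
  - apply def_and; auto.
  - apply def_or; auto.
  - apply def_all, def_imp; [def|].
    apply def_ext with (fun e => relsat C (fun n => match n with
      | 0 => e 0 | S k => t k (fun i => e (S i)) end) p).
    + intro e; apply relsat_ext; intros [|n]; reflexivity.
    + apply (IHp (fun n e => match n with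
        | 0 => e 0 | S k => t k (fun i => e (S i)) end)).
      intros [|n]; [def|]. apply tdef_rename; auto.
  - apply def_ex, def_and; [def|].
    apply def_ext with (fun e => relsat C (fun n => match n with
      | 0 => e 0 | S k => t k (fun i => e (S i)) end) p).
    + intro e; apply relsat_ext; intros [|n]; reflexivity.
    + apply (IHp (fun n e => match n with
        | 0 => e 0 | S k => t k (fun i => e (S i)) end)).
      intros [|n]; [def|]. apply tdef_rename; auto.
Qed.

Section SymmetricModel.
Context {M : eps_structure} {Z : ZFA M}.
Variables (A le Sigma F : M).
Hypothesis A_atoms : is_atom_set A.
Hypothesis le_rel : is_relation_on le A A.
Hypothesis Sigma_aut : is_automorphism_group Sigma A le.
Hypothesis F_filter : is_filter_generated_by_stabilizers A Sigma F.

Notation Sym := (symmetric Sigma F).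
Notation HS := (hereditarily_symmetric Sigma F).
Implicit Types a x y z p u v w f g h d r s : M.

Lemma Sigma_iff s : s ∈ Sigma <-> is_automorphism s A le.
Proof. apply Sigma_aut. Qed.

Lemma Sigma_bijection s : s ∈ Sigma -> bijection s A A.
Proof. intro H; apply Sigma_iff in H; apply H. Qed.

Lemma Sigma_identity : exists i, is_identity i A /\ i ∈ Sigma /\
  forall x, x ∈ A -> rel i x x.
Proof.
  destruct (@bijection_exists M Z (fun x y => x = y) A A) as (i & Hi & E).
  - def.
  - intros x _; exists x; split; auto.
  - intros; subst; auto.
  - intros; subst; auto.
  - eauto.
  - assert (Pi : forall p, p ∈ i <-> exists x, x ∈ A /\ is_pair p x x).
    { intro p; split.
      - intro Hp. destruct (bijection_function Hi) as (_ & H & _).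
        destruct (H p Hp) as (x & y & Hx & Hxy); exists x; split; auto.
        assert (R : rel i x y) by (exists p; auto).
        apply E in R; destruct R as [_ ->]; auto.
      - intros (x & Hx & Hp); apply pair_iff in Hp; subst.
        apply rel_iff, E; auto. }
    exists i; split; [split; auto; apply (bijection_function Hi)|].
    split; [|intros; apply E; auto].
    apply Sigma_iff; split; auto.
    intros x y x' y' H1 H2; apply E in H1; apply E in H2.
    destruct H1 as [_ ->], H2 as [_ ->]; tauto.
Qed.

Lemma Sigma_composition f g h : f ∈ Sigma -> g ∈ Sigma ->
  is_composition f g h -> h ∈ Sigma /\
  forall x z, rel h x z <-> exists y, rel g x y /\ rel f y z.
Proof.
  intros Hf Hg Hh.
  assert (Ph : forall p, p ∈ h -> exists x y, is_pair p x y).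
  { intros p Hp; apply Hh in Hp; destruct Hp as (x & y & z & _ & _ & H); eauto. }
  pose proof (proj1 (composition_iff f g (proj1 Hh) Ph) Hh) as E.
  split; auto.
  destruct (composition_exists (Sigma_bijection Hg) (Sigma_bijection Hf))
    as (h' & Hb & E').
  assert (h = h').
  { apply relation_ext; auto.
    - apply Hh.
    - apply (bijection_function Hb).
    - intros p Hp. destruct (bijection_function Hb) as (_ & H & _).
      destruct (H p Hp) as (x & y & _ & Hxy); eauto.
    - intros; rewrite E, E'; tauto. }
  subst h'; apply Sigma_iff; split; auto.
  apply Sigma_iff in Hf; apply Sigma_iff in Hg.
  intros x y x' y' H1 H2; apply E in H1; apply E in H2.
  destruct H1 as (u & H1 & H1'), H2 as (v & H2 & H2').
  rewrite (proj2 Hg x y u v), (proj2 Hf u v x' y'); tauto.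
Qed.

Lemma Sigma_inverse f g : f ∈ Sigma -> is_inverse f g -> g ∈ Sigma /\
  forall x y, rel g x y <-> rel f y x.
Proof.
  intros Hf Hg.
  assert (Ph : forall p, p ∈ g -> exists x y, is_pair p x y).
  { intros p Hp; apply Hg in Hp; destruct Hp as (x & y & _ & H); eauto. }
  pose proof (proj1 (inverse_iff f (proj1 Hg) Ph) Hg) as E.
  split; auto.
  destruct (inverse_exists (Sigma_bijection Hf)) as (g' & Hb & E').
  assert (g = g').
  { apply relation_ext; auto.
    - apply Hg.
    - apply (bijection_function Hb).
    - intros p Hp. destruct (bijection_function Hb) as (_ & H & _).
      destruct (H p Hp) as (x & y & _ & Hxy); eauto.
    - intros; rewrite E, E'; tauto. }
  subst g'; apply Sigma_iff; split; auto.
  apply Sigma_iff in Hf.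
  intros x y x' y' H1 H2; apply E in H1; apply E in H2.
  symmetry; apply Hf; auto.
Qed.

(** The finite set [e] of atoms is a support of [x]. *)
Definition supports (e x : M) : Prop := is_set e /\ subset e A /\ finite e /\
  forall s, s ∈ Sigma -> (forall a, a ∈ e -> rel s a a) -> act s x = x.

(** A stabilizer is always a subgroup, so membership in the filter only says
    that it contains the pointwise stabilizer of a finite set. *)
Lemma symmetric_iff x : Sym x <-> exists e, supports e x.
Proof.
  destruct F_filter as [_ HF]; split.
  - intros (H & Hst & Hin); apply HF in Hin.
    destruct Hin as (_ & e & Se & eA & Fe & He).
    exists e; split; [|split; [|split]]; auto.
    intros s Hs Ha; symmetry.
    apply (acts_iff A_atoms (Sigma_bijection Hs)), Hst, He; auto.
    intros a S HeA HS; apply HS; split; auto.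
    apply (acts_iff A_atoms (Sigma_bijection Hs)).
    apply (act_atom_iff A_atoms (Sigma_bijection Hs)); auto.
    apply A_atoms; auto.
  - intros (e & Se & eA & Fe & He).
    destruct (@separation M Z (fun s => acts s x x) Sigma) as (H & SH & EH);
      [def|].
    exists H; split; [split; auto|].
    assert (HH : forall s, s ∈ H <-> s ∈ Sigma /\ act s x = x).
    { intro s; rewrite EH; split; intros [H1 H2]; split; auto.
      - symmetry; apply (acts_iff A_atoms (Sigma_bijection H1)); auto.
      - apply (acts_iff A_atoms (Sigma_bijection H1)); auto. }
    apply HF; split; [|exists e].
    + split; [auto|split; [|split; [|split]]].
      * intros s Hs; apply HH in Hs; apply Hs.
      * destruct Sigma_identity as (i & H1 & H2 & H3).
        exists i; split; auto; apply HH; split; auto.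
      * intros f g h Hf Hg Hh; apply HH in Hf; apply HH in Hg; apply HH.
        destruct Hf as [Hf Ef], Hg as [Hg Eg].
        destruct (Sigma_composition Hf Hg Hh) as [Hs E]; split; auto.
        rewrite (act_comp A_atoms (Sigma_bijection Hf) (Sigma_bijection Hg)
          (Sigma_bijection Hs) E), Eg; auto.
      * intros f g Hf Hg; apply HH in Hf; apply HH.
        destruct Hf as [Hf Ef].
        destruct (Sigma_inverse Hf Hg) as [Hs E]; split; auto.
        rewrite <- Ef at 1.
        apply (act_cancel A_atoms (Sigma_bijection Hf) (Sigma_bijection Hs)).
        auto.
    + split; [|split; [|split]]; auto.
      intros s Hs Ha; apply HH; split; auto; apply He; auto.
      intros a HaE. assert (Aa : atom a) by (apply A_atoms; auto).
      destruct (@separation M Z (fun s => acts s a a) Sigma) as (S & SS & ES);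
        [def|].
      assert (Hsa : s ∈ S) by (apply (Ha a S); auto; split; auto).
      apply ES in Hsa; destruct Hsa as [_ Hsa].
      apply (act_atom_iff A_atoms (Sigma_bijection Hs)); auto.
      apply (acts_iff A_atoms (Sigma_bijection Hs)); auto.
Qed.

Lemma common_support l : Forall Sym l -> exists e,
  is_set e /\ subset e A /\ finite e /\
  forall s, s ∈ Sigma -> (forall a, a ∈ e -> rel s a a) ->
  forall x, In x l -> act s x = x.
Proof.
  induction 1 as [|x l Hx _ (e & Se & eA & Fe & He)].
  - exists emp; split; [apply emp_set|split; [|split]].
    + intros z Hz; destruct (emp_mem Hz).
    + apply finite_emp.
    + intros s _ _ x [].
  - apply symmetric_iff in Hx; destruct Hx as (e' & Se' & eA' & Fe' & He').
    exists (bun e e'); split; [apply bun_set|split; [|split]].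
    + intros z Hz; apply bun_mem in Hz; destruct Hz; auto.
    + apply finite_bun; auto.
    + intros s Hs Ha y [<-|Hy].
      * apply He'; auto; intros; apply Ha, bun_mem; auto.
      * apply He; auto; intros; apply Ha, bun_mem; auto.
Qed.

(** The union of supports of the finitely many parameters supports [x], by
    [act_fixes].  This replaces all computations of supports below. *)
Lemma symmetric_def (P : M -> Prop) x : Def Sym (fun e => P (e 0)) ->
  P x -> (forall y, P y -> y = x) -> Sym x.
Proof.
  intros (phi & l & Hl & H) Hx Ux.
  destruct (common_support Hl) as (e & Se & eA & Fe & He).
  apply symmetric_iff; exists e; split; [|split; [|split]]; auto.
  intros s Hs Ha.
  apply (act_fixes A_atoms (Sigma_bijection Hs) (K := fun y => In y l) (P := P));
    auto.
  exists phi, l; split; auto. apply Forall_forall; auto.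
Qed.

Lemma symmetric_set (P : M -> Prop) x : Def Sym (fun e => P (e 0)) ->
  is_set x -> (forall z, z ∈ x <-> P z) -> Sym x.
Proof.
  intros D Sx E.
  apply (symmetric_def (P := fun x => is_set x /\ forall z, z ∈ x <-> P z)).
  - def.
  - auto.
  - intros y [Sy Ey]; apply ext; auto; intro z; rewrite Ey, E; tauto.
Qed.

Lemma act_pr s x y : bijection s A A ->
  act s (pr x y) = pr (act s x) (act s y).
Proof.
  intro Hs; apply pair_iff.
  assert (D : Def (fun _ : M => False)
                (fun e => is_pair (e 0) (e 1) (e 2))) by def.
  apply (def_act A_atoms Hs (K := fun _ => False)
    (fun x H => match H with end) D
    (fun n => match n with 0 => pr x y | 1 => x | _ => y end)).
  apply pair_iff; auto.
Qed.

Lemma act_rel s r x y : bijection s A A -> act s r = r ->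
  rel r x y -> rel r (act s x) (act s y).
Proof.
  intros Hs E H; rewrite rel_iff in *.
  rewrite <- act_pr, <- E; auto. apply (act_mem A_atoms Hs); eauto.
  eapply mem_set; eauto.
Qed.

Lemma symmetric_A : Sym A.
Proof.
  apply (symmetric_def (P := fun x => is_atom_set x)).
  - def.
  - apply A_atoms.
  - intros y Hy; apply ext; [apply Hy|apply A_atoms|].
    intro z; rewrite (proj2 Hy), (proj2 A_atoms); tauto.
Qed.

(** The order has the empty support because [Sigma] consists of its
    automorphisms. *)
Lemma symmetric_le : Sym le.
Proof.
  destruct le_rel as [Sle Ple].
  apply symmetric_iff; exists emp; split; [apply emp_set|split; [|split]].
  - intros z Hz; destruct (emp_mem Hz).
  - apply finite_emp.
  - intros s Hs _. pose proof (Sigma_bijection Hs) as Bs.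
    apply Sigma_iff in Hs. apply ext; auto.
    + apply (act_is_set A_atoms Bs); auto.
    + intro v; rewrite (act_mem A_atoms Bs v Sle); split.
      * intros (p & Hp & ->).
        destruct (Ple p Hp) as (x & y & Hx & Hy & E).
        apply pair_iff in E; subst.
        rewrite act_pr, <- rel_iff in *; auto.
        apply A_atoms in Hx; apply A_atoms in Hy.
        apply (proj2 Hs x y); auto; apply (act_atom A_atoms Bs); auto.
      * intro Hv; destruct (Ple v Hv) as (x & y & Hx & Hy & E).
        apply pair_iff in E; subst.
        destruct (bijection_surj Bs Hx) as [x' Hx'].
        destruct (bijection_surj Bs Hy) as [y' Hy'].
        exists (pr x' y'); split.
        -- rewrite <- rel_iff in *.
           apply (proj2 Hs x' y' x y); auto.
        -- rewrite act_pr; auto. f_equal.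
           ++ apply (act_atom_iff A_atoms Bs); auto.
              apply A_atoms; eapply function_dom; eauto using bijection_function.
           ++ apply (act_atom_iff A_atoms Bs); auto.
              apply A_atoms; eapply function_dom; eauto using bijection_function.
Qed.

Lemma symmetric_Sigma : Sym Sigma.
Proof.
  pose proof symmetric_A; pose proof symmetric_le.
  apply (symmetric_set (P := fun s => is_automorphism s A le)).
  - def.
  - apply (proj1 Sigma_aut).
  - exact Sigma_iff.
Qed.

(** [Sigma] and [F] are definable from the order, hence symmetric, so the class
    of hereditarily symmetric objects is itself definable from symmetric
    parameters. *)
Lemma symmetric_F : Sym F.
Proof.
  pose proof symmetric_A; pose proof symmetric_Sigma.
  apply (symmetric_def
    (P := fun F => is_filter_generated_by_stabilizers A Sigma F)).
  - def.
  - exact F_filter.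
  - intros G HG; apply ext; [apply (proj1 HG) | apply (proj1 F_filter)|].
    intro z; rewrite (proj2 HG), (proj2 F_filter); tauto.
Qed.

Lemma hs_elem x y : HS x -> y ∈ x -> HS y.
Proof.
  intros (_ & t & (St & Tt & xt & Mt) & Ht) Hy.
  split; [apply Ht, xt; auto|].
  destruct (transitive_closure_exists y) as (t' & Ht').
  exists t'; split; auto. intros z Hz; apply Ht.
  destruct Ht' as (_ & _ & _ & Mt'); apply Mt'; auto.
Qed.

(** The hereditarily symmetric members of the transitive closure form a
    transitive set that includes [x], so there are no other members. *)
Lemma hs_intro x : Sym x -> (forall y, y ∈ x -> HS y) -> HS x.
Proof.
  intros Sx Hx; split; auto.
  destruct (transitive_closure_exists x) as (t & Ht).
  exists t; split; auto.
  destruct Ht as (St & Tt & xt & Mt).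
  destruct (@separation M Z (fun z => HS z) t) as (s & Ss & Es); [def|].
  intros y Hy; enough (HS y) by (destruct H; auto).
  apply Es, Mt; auto.
  - intros z Hz w Hw; apply Es in Hz; destruct Hz as [H1 H2]; apply Es.
    split; [eapply Tt; eauto | eapply hs_elem; eauto].
  - intros z Hz; apply Es; split; auto.
Qed.

Lemma hs_sym x : HS x -> Sym x.
Proof. intros [H _]; auto. Qed.

Lemma symmetric_atom x : atom x -> Sym x.
Proof.
  intro Hx; apply symmetric_iff; exists (upr x x).
  split; [apply (@mem_set _ _ x), upr_mem; auto|split; [|split]].
  - intros z Hz; apply upr_mem in Hz; apply A_atoms; destruct Hz; subst; auto.
  - replace (upr x x) with (adj emp x).
    + apply finite_adj; [apply emp_set | apply finite_emp].
    + apply ext; [apply adj_set| apply (@mem_set _ _ x), upr_mem; auto|].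
      intro z; rewrite adj_mem, upr_mem.
      pose proof (@emp_mem _ _ z); tauto.
  - intros s Hs H; symmetry.
    apply (act_atom_iff A_atoms (Sigma_bijection Hs)); auto.
    apply H, upr_mem; auto.
Qed.

Lemma hs_atom x : atom x -> HS x.
Proof.
  intro Hx; apply hs_intro; [apply symmetric_atom; auto|].
  intros y Hy; destruct (mem_set Hy Hx).
Qed.

Lemma hs_A : HS A.
Proof.
  apply hs_intro; [apply symmetric_A|].
  intros y Hy; apply hs_atom, A_atoms; auto.
Qed.

Lemma hs_upr x y : HS x -> HS y -> HS (upr x y).
Proof.
  intros Hx Hy. pose proof (hs_sym Hx); pose proof (hs_sym Hy).
  apply hs_intro.
  - apply (symmetric_set (P := fun z => z = x \/ z = y)).
    + def.
    + apply (@mem_set _ _ x), upr_mem; auto.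
    + intro; apply upr_mem.
  - intros z Hz; apply upr_mem in Hz; destruct Hz; subst; auto.
Qed.

Lemma hs_pr x y : HS x -> HS y -> HS (pr x y).
Proof. intros; apply hs_upr; apply hs_upr; auto. Qed.

Lemma hs_le : HS le.
Proof.
  apply hs_intro; [apply symmetric_le|].
  destruct le_rel as [_ Ple].
  intros p Hp; destruct (Ple p Hp) as (x & y & Hx & Hy & E).
  apply pair_iff in E; subst; apply hs_pr; eapply hs_elem; eauto using hs_A.
Qed.

Lemma hs_emp : HS emp.
Proof.
  apply hs_intro; [|intros y Hy; destruct (emp_mem Hy)].
  apply (symmetric_set (P := fun _ => False)); [def|apply emp_set|].
  intro z; pose proof (@emp_mem _ _ z); tauto.
Qed.

Lemma hs_suc x : HS x -> HS (suc x).
Proof.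
  intro Hx; pose proof (hs_sym Hx); apply hs_intro.
  - apply (symmetric_set (P := fun z => z ∈ x \/ z = x)).
    + def.
    + apply adj_set.
    + intro; apply suc_mem.
  - intros z Hz; apply suc_mem in Hz; destruct Hz; subst; auto.
    eapply hs_elem; eauto.
Qed.

Lemma hs_omega : HS omega.
Proof.
  apply hs_intro.
  - apply (symmetric_def (P := fun w => is_omega w)).
    + def.
    + apply omega_spec.
    + apply omega_iff.
  - apply omega_ind; [def | apply hs_emp | intros; apply hs_suc; auto].
Qed.

Let N := permutation_model Sigma F.
Let val (x : N) : M := proj1_sig x.

Lemma model_eq (x y : N) : val x = val y -> x = y.
Proof.
  destruct x as [x Hx], y as [y Hy]; simpl; intros <-.
  f_equal; apply proof_irrelevance.
Qed.

Lemma model_hs (x : N) : HS (val x).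
Proof. exact (proj2_sig x). Qed.

Lemma model_sym (x : N) : Sym (val x).
Proof. apply hs_sym, model_hs. Qed.

Lemma model_sat (p : formula) : forall e : nat -> N,
  sat e p <-> relsat HS (fun n => val (e n)) p.
Proof.
  induction p; simpl; intro e; try tauto.
  - split; [congruence | apply model_eq].
  - rewrite IHp1, IHp2; tauto.
  - rewrite IHp1, IHp2; tauto.
  - rewrite IHp1, IHp2; tauto.
  - assert (E : forall x : N, sat (scons x e) p <->
                  relsat HS (scons (val x) (fun n => val (e n))) p).
    { intro x; rewrite IHp; apply relsat_ext; intros [|n]; reflexivity. }
    split; intros H x; [|apply E, H, model_hs].
    intro Hx; apply (E (exist _ x Hx)), H.
  - assert (E : forall x : N, sat (scons x e) p <->
                  relsat HS (scons (val x) (fun n => val (e n))) p).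
    { intro x; rewrite IHp; apply relsat_ext; intros [|n]; reflexivity. }
    split; [intros [x H]; exists (val x); split; [apply model_hs|apply E, H]|].
    intros (x & Hx & H); exists (exist _ x Hx); apply E, H.
Qed.

(** Comprehension in the permutation model: a set of the ground model whose
    members are described from symmetric parameters and are hereditarily
    symmetric belongs to the permutation model. *)
Lemma model_set (P : M -> Prop) x : Def Sym (fun e => P (e 0)) ->
  is_set x -> (forall z, z ∈ x <-> P z) -> (forall z, P z -> HS z) ->
  exists X : N, is_set X /\ forall z : N, z ∈ X <-> P (val z).
Proof.
  intros D Sx E HP.
  assert (Hx : HS x).
  { apply hs_intro; [eapply symmetric_set; eauto|].
    intros y Hy; apply HP, E, Hy. }
  exists (exist _ x Hx); split; auto.
  intro z; apply E.
Qed.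

(** The sets required by the axioms exist in the ground model, and each is
    definable from symmetric parameters.  For separation and replacement the
    defining formula is the given one, relativized to the permutation model. *)
Lemma model_ZFA : ZFA N.
Proof.
  pose proof symmetric_Sigma as SSig; pose proof symmetric_F as SF.
  split.
  - exists (exist _ A hs_A); split; [apply A_atoms|].
    intro x; apply A_atoms.
  - intros a Ha x; apply (zfa_atom_empty Z); auto.
  - intros x y Hx Hy E; apply model_eq, ext; auto.
    intro z; split; intro Hz.
    + apply (E (exist _ z (hs_elem (model_hs x) Hz))); auto.
    + apply (E (exist _ z (hs_elem (model_hs y) Hz))); auto.
  - exists (exist _ emp hs_emp); split; [apply emp_set|].
    intro z; apply emp_mem.
  - intros x y; exists (exist _ _ (hs_upr (model_hs x) (model_hs y))).
    intro z; simpl; rewrite upr_mem; split;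
      (intros [H|H]; [left|right]); subst; auto; apply model_eq; auto.
  - intro x; pose proof (model_sym x).
    destruct (@model_set (fun z => exists y, y ∈ val x /\ z ∈ y) (U (val x)))
      as (u & Su & Eu).
    + def.
    + apply U_set.
    + intro; apply U_mem.
    + intros z (y & Hy & Hz); eapply hs_elem; eauto.
      eapply hs_elem; eauto using model_hs.
    + exists u; split; auto; intro z; rewrite Eu; split.
      * intros (y & Hy & Hz).
        exists (exist _ y (hs_elem (model_hs x) Hy)); auto.
      * intros (y & Hy & Hz); exists (val y); auto.
  - intro x; pose proof (model_sym x).
    destruct (zfa_power Z (val x)) as (q & Sq & Eq).
    destruct (@separation M Z (fun z => HS z) q) as (u & Su & Eu); [def|].
    destruct (@model_set (fun z => (is_set z /\ subset z (val x)) /\ HS z) u)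
      as (u' & Su' & Eu').
    + def.
    + auto.
    + intro z; rewrite Eu, Eq; tauto.
    + tauto.
    + exists u'; split; auto; intro z; rewrite Eu'; split.
      * intros [[H1 H2] _]; split; auto. intros y Hy; apply H2; auto.
      * intros [H1 H2]; split; [split; auto|apply model_hs].
        intros y Hy; apply (H2 (exist _ y (hs_elem (model_hs z) Hy))); auto.
  - exists (exist _ omega hs_omega); split.
    + exists (exist _ emp hs_emp); split; [|apply omega_emp].
      split; [apply emp_set|]. intro z; apply emp_mem.
    + intros n Hn; exists (exist _ _ (hs_suc (model_hs n))); split.
      * intro z; simpl; rewrite suc_mem; split; (intros [H|H]; [auto|right]);
          subst; auto; apply model_eq; auto.
      * apply omega_suc; auto.
  - intros x [y Hy].
    destruct (zfa_foundation Z (x := val x)) as (z & Hz & Ez); [exists (val y); auto|].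
    exists (exist _ z (hs_elem (model_hs x) Hz)); split; auto.
    intros w Hw; apply Ez; auto.
  - intros phi env x; pose proof (model_sym x).
    set (P := fun z => relsat HS (scons z (fun n => val (env n))) phi).
    assert (D : Def Sym (fun e => P (e 0))).
    { apply def_ext with (fun e => relsat HS (fun n => match n with
        | 0 => e 0 | S k => val (env k) end) phi).
      - intro e; apply relsat_ext; intros [|n]; reflexivity.
      - apply (@def_relsat M HS Sym phi ltac:(def) (fun n e => match n with
          | 0 => e 0 | S k => val (env k) end)).
        intros [|n]; [def|]. apply tdef_const, model_sym. }
    destruct (@separation M Z P (val x)) as (y & Sy & Ey).
    { eapply def_mono; [|exact D]; auto. }
    destruct (@model_set (fun z => z ∈ val x /\ P z) y) as (y' & Sy' & Ey').
    + def.
    + auto.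
    + auto.
    + intros z [Hz _]; eapply hs_elem; eauto using model_hs.
    + exists y'; split; auto; intro z; rewrite Ey', model_sat.
      apply and_iff_compat_l, relsat_ext; intros [|n]; reflexivity.
  - intros phi env x Hf; pose proof (model_sym x).
    set (P := fun u v => HS v /\
      relsat HS (scons u (scons v (fun n => val (env n)))) phi).
    assert (EP : forall u v : N,
      sat (scons u (scons v env)) phi <-> P (val u) (val v)).
    { intros u v; rewrite model_sat; unfold P.
      assert (E : relsat HS (fun n => val (scons u (scons v env) n)) phi <->
        relsat HS (scons (val u) (scons (val v) (fun n => val (env n)))) phi)
        by (apply relsat_ext; intros [|[|n]]; reflexivity).
      pose proof (model_hs v); tauto. }
    assert (D : Def Sym (fun e => P (e 0) (e 1))).
    { apply def_and; [def|].
      apply def_ext with (fun e => relsat HS (fun n => match n with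
        | 0 => e 0 | 1 => e 1 | S (S k) => val (env k) end) phi).
      - intro e; apply relsat_ext; intros [|[|n]]; reflexivity.
      - apply (@def_relsat M HS Sym phi ltac:(def) (fun n e => match n with
          | 0 => e 0 | 1 => e 1 | S (S k) => val (env k) end)).
        intros [|[|n]]; [def|def|]. apply tdef_const, model_sym. }
    destruct (@replacement M Z P (val x)) as (y & Sy & Ey).
    { eapply def_mono; [|exact D]; auto. }
    { intros u v w Hu Hv Hw.
      pose (u' := exist _ u (hs_elem (model_hs x) Hu) : N).
      pose (v' := exist _ v (proj1 Hv) : N).
      pose (w' := exist _ w (proj1 Hw) : N).
      enough (v' = w') by (apply (f_equal val) in H0; auto).
      apply (Hf u'); auto; apply EP; auto. }
    destruct (@model_set (fun v => exists u, u ∈ val x /\ P u v) y)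
      as (y' & Sy' & Ey').
    + def.
    + auto.
    + auto.
    + intros z (u & _ & Hz & _); auto.
    + exists y'; split; auto; intro v; rewrite Ey'; split.
      * intros (u & Hu & H1).
        exists (exist _ u (hs_elem (model_hs x) Hu)); split; auto.
        apply EP; auto.
      * intros (u & Hu & H1); exists (val u); split; auto; apply EP; auto.
Qed.

End SymmetricModel.

(** * Back-and-forth in a countable dense order *)

Section DenseOrder.
Context {M : eps_structure} {Z : ZFA M}.
Variables (A le : M).
Hypothesis DLO : dense_linear_order_without_endpoints A le.
Implicit Types a b c x y z p u v w f g h d r s q : M.

Notation lt := (strict le).

Lemma le_dom x y : rel le x y -> x ∈ A /\ y ∈ A.
Proof.
  destruct DLO as [[[_ H] _] _]; intros (p & Hp & Hr).
  destruct (H p Hr) as (x' & y' & Hx & Hy & E).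
  apply pair_iff in Hp; apply pair_iff in E; subst.
  apply pr_inj in E; destruct E; subst; auto.
Qed.
Lemma le_refl x : x ∈ A -> rel le x x.
Proof. destruct DLO as [(_ & H & _) _]; auto. Qed.
Lemma le_antisym x y : rel le x y -> rel le y x -> x = y.
Proof. destruct DLO as [(_ & _ & H & _) _]; auto. Qed.
Lemma le_trans x y z : rel le x y -> rel le y z -> rel le x z.
Proof. destruct DLO as [(_ & _ & _ & H & _) _]; eauto. Qed.
Lemma le_or_lt x y : x ∈ A -> y ∈ A -> rel le x y \/ lt y x.
Proof.
  intros Hx Hy; destruct DLO as [(_ & _ & _ & _ & H) _].
  destruct (classic (x = y)) as [<-|D]; [left; apply le_refl; auto|].
  destruct (H x y Hx Hy); [auto|right; split; auto].
Qed.
Lemma lt_not_le x y : lt x y -> ~ rel le y x.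
Proof. intros [H1 H2] H3; apply H2, le_antisym; auto. Qed.
Lemma lt_le_trans x y z : lt x y -> rel le y z -> lt x z.
Proof.
  intros [H1 H2] H3; split; [eapply le_trans; eauto|].
  intros ->; apply H2, le_antisym; auto.
Qed.
Lemma le_lt_trans x y z : rel le x y -> lt y z -> lt x z.
Proof.
  intros H1 [H2 H3]; split; [eapply le_trans; eauto|].
  intros ->; apply H3, le_antisym; auto.
Qed.
Lemma lt_trans x y z : lt x y -> lt y z -> lt x z.
Proof. intros H [H1 _]; eapply lt_le_trans; eauto. Qed.
Lemma lt_between x y : lt x y -> exists z, lt x z /\ lt z y.
Proof. destruct DLO as (_ & H & _); auto. Qed.
Lemma lt_above x : x ∈ A -> exists y, lt x y.
Proof. destruct DLO as (_ & _ & H); intro Hx; apply (H x Hx). Qed.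
Lemma lt_below x : x ∈ A -> exists y, lt y x.
Proof. destruct DLO as (_ & _ & H); intro Hx; apply (H x Hx). Qed.
Lemma lt_dom x y : lt x y -> x ∈ A /\ y ∈ A.
Proof. intros [H _]; apply le_dom; auto. Qed.

(** If the point found between [x] and [y] is the new point [a], look again
    between [x] and [a]. *)
Lemma lt_between_avoid d : is_set d -> finite d ->
  forall x y, lt x y -> exists z, lt x z /\ lt z y /\ z ∉ d.
Proof.
  revert d; apply (finite_ind (P := fun d => forall x y, lt x y ->
    exists z, lt x z /\ lt z y /\ z ∉ d)).
  - def.
  - intros x y H; destruct (lt_between H) as (z & H1 & H2).
    exists z; auto using emp_mem.
  - intros d a _ IH x y H; destruct (IH x y H) as (z & H1 & H2 & H3).
    destruct (classic (z = a)) as [->|D].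
    + destruct (IH x a H1) as (z & H4 & [H5 H6] & H7).
      exists z; split; [|split]; auto.
      * eapply le_lt_trans; eauto.
      * rewrite adj_mem; tauto.
    + exists z; rewrite adj_mem; tauto.
Qed.

Lemma gap_above a d : a ∈ A -> is_set d -> finite d ->
  exists r, lt a r /\ forall z, z ∈ d -> lt a z -> ~ lt z r.
Proof.
  intro Ha; revert d; apply (finite_ind (P := fun d =>
    exists r, lt a r /\ forall z, z ∈ d -> lt a z -> ~ lt z r)).
  - def.
  - destruct (lt_above Ha) as [r Hr]; exists r; split; auto.
    intros z Hz; destruct (emp_mem Hz).
  - intros d p _ (r & Hr & H).
    destruct (classic (lt a p /\ lt p r)) as [[H1 H2]|N].
    + exists p; split; auto; intros z Hz H3 H4.
      apply adj_mem in Hz; destruct Hz as [Hz| ->].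
      * apply (H z Hz H3). eapply lt_trans; eauto.
      * destruct H4; auto.
    + exists r; split; auto; intros z Hz H3 H4.
      apply adj_mem in Hz; destruct Hz as [Hz| ->]; [apply (H z)|]; auto.
Qed.

Lemma finite_maximum (C : M -> Prop) (L : M -> M -> Prop) :
  dfn (fun e => C (e 0)) -> dfn (fun e => L (e 0) (e 1)) ->
  (forall x, C x -> L x x) ->
  (forall x y, C x -> C y -> L x y \/ L y x) ->
  (forall x y z, L x y -> L y z -> L x z) ->
  forall d, is_set d -> finite d ->
  (forall z, z ∈ d -> ~ C z) \/
  exists z, z ∈ d /\ C z /\ forall y, y ∈ d -> C y -> L y z.
Proof.
  intros DC DL R T Tr; apply (finite_ind (P := fun d =>
    (forall z, z ∈ d -> ~ C z) \/
    exists z, z ∈ d /\ C z /\ forall y, y ∈ d -> C y -> L y z)).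
  - def.
  - left; intros z Hz; destruct (emp_mem Hz).
  - intros d a _ IH. destruct (classic (C a)) as [Ca|Ca].
    + right; destruct IH as [N|(z & Hz & Cz & H)].
      * exists a; rewrite adj_mem; split; [|split]; auto.
        intros y Hy Cy; apply adj_mem in Hy; destruct Hy as [Hy| ->]; auto.
        destruct (N y); auto.
      * destruct (T a z Ca Cz) as [H1|H1].
        -- exists z; rewrite adj_mem; split; [|split]; auto.
           intros y Hy Cy; apply adj_mem in Hy.
           destruct Hy as [Hy| ->]; auto.
        -- exists a; rewrite adj_mem; split; [|split]; auto.
           intros y Hy Cy; apply adj_mem in Hy.
           destruct Hy as [Hy| ->]; auto. eapply Tr; eauto.
    + destruct IH as [N|(z & Hz & Cz & H)]; [left|right].
      * intros y Hy; apply adj_mem in Hy; destruct Hy as [Hy| ->]; auto.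
      * exists z; rewrite adj_mem; split; [|split]; auto.
        intros y Hy Cy; apply adj_mem in Hy; destruct Hy as [Hy| ->]; auto.
        contradiction.
Qed.

Lemma finite_projection (Q : M -> M -> Prop) p :
  dfn (fun e => Q (e 0) (e 1)) ->
  (forall u v w, Q u v -> Q u w -> v = w) -> is_set p -> finite p ->
  exists d, is_set d /\ finite d /\ forall v, v ∈ d <-> exists u, u ∈ p /\ Q u v.
Proof.
  intros D H Sp Fp.
  destruct (replacement (x := p) D) as (d & Sd & Ed); [eauto|].
  exists d; split; [auto|split; auto]. exact (finite_image D H Sp Fp Sd Ed).
Qed.

(** Adding the pair of [a] and [b] to the order-preserving relation [R] keeps it
    order-preserving. *)
Definition matches (R : M -> M -> Prop) a b : Prop :=
  forall x y, R x y -> (rel le x a <-> rel le y b) /\ (rel le a x <-> rel le b y).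

(** One step of back-and-forth.  Unless [a] is already an argument, [b] has to lie above the value of the largest
    argument below [a] and below the value of the smallest argument above [a];
    density, or the absence of endpoints if one of the two is missing, provides
    it. *)
Lemma matches_exists (R : M -> M -> Prop) a :
  (forall x y, R x y -> x ∈ A /\ y ∈ A) ->
  (forall x y x' y', R x y -> R x' y' -> (rel le x x' <-> rel le y y')) ->
  (exists d, is_set d /\ finite d /\ forall x, x ∈ d <-> exists y, R x y) ->
  a ∈ A -> exists b, b ∈ A /\ matches R a b.
Proof.
  intros HA HR (d & Sd & Fd & Ed) Ha.
  destruct (classic (exists y, R a y)) as [[b Hb]|N].
  { exists b; split; [apply (HA a b Hb)|].
    intros x y H; split; apply HR; auto. }
  (* PL and PU are the sets of values that b has to exceed and to precede *)
  assert (Low : exists P : M -> Prop, (forall x y, R x y -> lt x a -> P y) /\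
    ((forall y, ~ P y) \/ exists x0 y0, R x0 y0 /\ lt x0 a /\
       forall y, P y -> rel le y y0)).
  { exists (fun y => exists x, R x y /\ lt x a); split; [eauto|].
    destruct (@finite_maximum (fun x => lt x a) (fun x y => rel le x y))
      with (d := d) as [H|(x0 & H1 & H2 & H3)]; auto.
    - def.
    - def.
    - intros x [H _]; apply le_refl; apply le_dom in H; tauto.
    - intros x y H1 H2; apply lt_dom in H1; apply lt_dom in H2.
      destruct (@le_or_lt x y) as [H|[H _]]; tauto.
    - apply le_trans.
    - left; intros y (x & H1 & H2); apply (H x); auto; apply Ed; eauto.
    - right; apply Ed in H1; destruct H1 as [y0 H1]; exists x0, y0.
      split; [|split]; auto. intros y (x & H4 & H5).
      apply (HR x y x0 y0); auto; apply H3; auto; apply Ed; eauto. }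
  assert (Upp : exists P : M -> Prop, (forall x y, R x y -> lt a x -> P y) /\
    ((forall y, ~ P y) \/ exists x0 y0, R x0 y0 /\ lt a x0 /\
       forall y, P y -> rel le y0 y)).
  { exists (fun y => exists x, R x y /\ lt a x); split; [eauto|].
    destruct (@finite_maximum (fun x => lt a x) (fun x y => rel le y x))
      with (d := d) as [H|(x0 & H1 & H2 & H3)]; auto.
    - def.
    - def.
    - intros x [H _]; apply le_refl; apply le_dom in H; tauto.
    - intros x y H1 H2; apply lt_dom in H1; apply lt_dom in H2.
      destruct (@le_or_lt x y) as [H|[H _]]; tauto.
    - intros x y z H1 H2; eapply le_trans; eauto.
    - left; intros y (x & H1 & H2); apply (H x); auto; apply Ed; eauto.
    - right; apply Ed in H1; destruct H1 as [y0 H1]; exists x0, y0.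
      split; [|split]; auto. intros y (x & H4 & H5).
      apply (HR x0 y0 x y); auto; apply H3; auto; apply Ed; eauto. }
  destruct Low as (PL & HL & CL), Upp as (PU & HU & CU).
  assert (B : exists b, b ∈ A /\ (forall y, PL y -> lt y b) /\
                        (forall y, PU y -> lt b y)).
  { destruct CL as [NL|(x0 & y0 & R0 & L0 & M0)],
             CU as [NU|(x1 & y1 & R1 & L1 & M1)].
    - exists a; split; [|split]; auto; intros y Hy; [destruct (NL y Hy)|destruct (NU y Hy)].
    - destruct (@lt_below y1) as [b Hb]; [apply (HA _ _ R1)|].
      exists b; split; [apply (lt_dom Hb)|split].
      + intros y Hy; destruct (NL y Hy).
      + intros y Hy; eapply lt_le_trans; eauto.
    - destruct (@lt_above y0) as [b Hb]; [apply (HA _ _ R0)|].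
      exists b; split; [apply (lt_dom Hb)|split].
      + intros y Hy; eapply le_lt_trans; eauto.
      + intros y Hy; destruct (NU y Hy).
    - assert (L : lt y0 y1).
      { destruct (lt_trans L0 L1) as [H1 H2]; split.
        - apply (HR x0 y0 x1 y1); auto.
        - intros <-; apply H2, le_antisym; auto.
          apply (HR x1 y0 x0 y0); auto; apply le_refl, (HA _ _ R0). }
      destruct (lt_between L) as (b & H1 & H2).
      exists b; split; [apply (lt_dom H1)|split].
      + intros y Hy; eapply le_lt_trans; eauto.
      + intros y Hy; eapply lt_le_trans; eauto. }
  destruct B as (b & Hb & B1 & B2); exists b; split; auto.
  intros x y Hxy; destruct (HA x y Hxy) as [Hx Hy].
  assert (D : x <> a) by (intros ->; eauto).
  destruct (le_or_lt Hx Ha) as [H|H].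
  - assert (H1 : lt x a) by (split; auto).
    pose proof (B1 y (HL x y Hxy H1)) as H2.
    pose proof (lt_not_le H1); pose proof (lt_not_le H2).
    destruct H2; tauto.
  - pose proof (B2 y (HU x y Hxy H)) as H2.
    pose proof (lt_not_le H); pose proof (lt_not_le H2).
    destruct H2, H; tauto.
Qed.

Definition partial_iso p : Prop := is_set p /\ finite p /\
  (forall x y, rel p x y -> x ∈ A /\ y ∈ A) /\
  (forall x y x' y', rel p x y -> rel p x' y' -> (rel le x x' <-> rel le y y')).

Lemma rel_adj p a b x y :
  rel (adj p (pr a b)) x y <-> rel p x y \/ (x = a /\ y = b).
Proof.
  rewrite !rel_iff, adj_mem; split; (intros [H|H]; [auto|right]).
  - apply pr_inj; auto.
  - destruct H; subst; auto.
Qed.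

Lemma partial_iso_adj p a b : partial_iso p -> a ∈ A -> b ∈ A ->
  matches (rel p) a b -> partial_iso (adj p (pr a b)).
Proof.
  intros (Sp & Fp & Ap & Ip) Ha Hb Hm; split; [apply adj_set|].
  split; [apply finite_adj; auto|split].
  - intros x y H; apply rel_adj in H; destruct H as [H|[-> ->]]; auto.
  - intros x y x' y' H H'; apply rel_adj in H; apply rel_adj in H'.
    destruct H as [H|[-> ->]], H' as [H'|[-> ->]].
    + apply Ip; auto.
    + apply (Hm x y); auto.
    + apply (Hm x' y'); auto.
    + split; intro; apply le_refl; auto.
Qed.

Lemma extend_forward p a : partial_iso p -> a ∈ A ->
  exists b, b ∈ A /\ matches (rel p) a b.
Proof.
  intros (Sp & Fp & Ap & Ip) Ha; apply matches_exists; auto.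
  destruct (@finite_projection (fun u v => exists y, u = pr v y) p)
    as (d & Sd & Fd & Ed); auto.
  - def.
  - intros u v w (y & ->) (y' & E); apply pr_inj in E; tauto.
  - exists d; split; [|split]; auto; intro x; rewrite Ed; split.
    + intros (u & Hu & y & ->); exists y; apply rel_iff; auto.
    + intros (y & H); apply rel_iff in H; eauto.
Qed.

Lemma matches_flip (R : M -> M -> Prop) a b :
  matches (fun x y => R y x) a b <-> matches R b a.
Proof. split; intros H x y Hxy; destruct (H y x Hxy); tauto. Qed.

Lemma extend_backward p a : partial_iso p -> a ∈ A ->
  exists b, b ∈ A /\ matches (rel p) b a.
Proof.
  intros (Sp & Fp & Ap & Ip) Ha.
  destruct (@matches_exists (fun x y => rel p y x) a) as (b & Hb & Hm); auto.
  - intros x y H; apply Ap in H; tauto.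
  - intros x y x' y' H H'; symmetry; apply Ip; auto.
  - destruct (@finite_projection (fun u v => exists y, u = pr y v) p)
      as (d & Sd & Fd & Ed); auto.
    + def.
    + intros u v w (y & ->) (y' & E); apply pr_inj in E; tauto.
    + exists d; split; [|split]; auto; intro x; rewrite Ed; split.
      * intros (u & Hu & y & ->); exists y; apply rel_iff; auto.
      * intros (y & H); apply rel_iff in H; eauto.
  - exists b; split; auto; apply matches_flip; auto.
Qed.

Variable c : M.
Hypothesis Hc : injection c A omega.

(** [b] has the least code among the solutions of [S]; the codes given by the
    injection [c] replace the axiom of choice in the recursion. *)
Definition least (S : M -> Prop) b : Prop := b ∈ A /\ S b /\
  forall b' m n, b' ∈ A -> S b' -> rel c b' m -> rel c b n -> m ∉ n.

Lemma code_exists a : a ∈ A -> exists n, n ∈ omega /\ rel c a n.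
Proof.
  intro Ha; destruct Hc as [[Fc Rc] _].
  destruct (function_total Fc Ha) as [n Hn]; exists n; eauto.
Qed.

Lemma least_exists (S : M -> Prop) : dfn (fun e => S (e 0)) ->
  (exists b, b ∈ A /\ S b) -> exists b, least S b.
Proof.
  intros D (b & Hb & Sb).
  destruct (@separation M Z (fun n => exists b, b ∈ A /\ S b /\ rel c b n) omega)
    as (w & Sw & Ew); [def|].
  destruct (code_exists Hb) as (n & Hn & Cn).
  destruct (zfa_foundation Z (x := w)) as (m & Hm & Em).
  - exists n; apply Ew; split; eauto.
  - apply Ew in Hm; destruct Hm as (Hm & b0 & H1 & H2 & H3).
    exists b0; split; [|split]; auto.
    intros b' k l H4 H5 H6 H7 H8.
    apply (Em k); [apply Ew; split; eauto|].
    + destruct Hc as [[_ Rc] _]; eauto.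
    + destruct Hc as [[Fc _] _]; rewrite (function_fun Fc H3 H7); auto.
Qed.

Lemma least_unique (S : M -> Prop) a b : least S a -> least S b -> a = b.
Proof.
  intros (H1 & H2 & H3) (H1' & H2' & H3').
  destruct (code_exists H1) as (n & Hn & Cn).
  destruct (code_exists H1') as (m & Hm & Cm).
  destruct (omega_trichotomy Hn Hm) as [H|[H|H]].
  - destruct (H3 b m n); auto.
  - subst; destruct Hc as [_ I]; eauto.
  - destruct (H3' a n m); auto.
Qed.

(** Stage [n] puts the atom with code [n], if there is one, first into the
    domain and then into the range, with the partner of least code each time. *)
Definition step n p q : Prop :=
  (exists a b b', rel c a n /\ least (matches (rel p) a) b /\
     least (fun b' => matches (rel (adj p (pr a b))) b' a) b' /\
     q = adj (adj p (pr a b)) (pr b' a)) \/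
  (~ (exists a, rel c a n) /\ q = p).

Lemma step_exists n p : partial_iso p -> exists q, step n p q.
Proof.
  intro Hp; destruct (classic (exists a, rel c a n)) as [[a Ha]|N].
  - assert (Aa : a ∈ A) by (destruct Hc as [[Fc _] _]; eapply function_dom; eauto).
    destruct (@least_exists (matches (rel p) a)) as [b Hb].
    { def. }
    { apply extend_forward; auto. }
    assert (Hq : partial_iso (adj p (pr a b)))
      by (apply partial_iso_adj; auto; apply Hb).
    destruct (@least_exists (fun b' => matches (rel (adj p (pr a b))) b' a))
      as [b' Hb'].
    { def. }
    { apply extend_backward; auto. }
    eexists; left; exists a, b, b'; split; [|split; [|split]]; eauto.
  - exists p; right; auto.
Qed.

Lemma step_spec n p q : partial_iso p -> step n p q ->
  partial_iso q /\ subset p q /\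
  forall a, rel c a n -> (exists b, rel q a b) /\ exists b, rel q b a.
Proof.
  intros Hp [(a & b & b' & H1 & H2 & H3 & ->)|[N ->]].
  - assert (Aa : a ∈ A) by (destruct Hc as [[Fc _] _]; eapply function_dom; eauto).
    assert (Hq : partial_iso (adj p (pr a b)))
      by (apply partial_iso_adj; auto; apply H2).
    split; [|split].
    + apply partial_iso_adj; auto; apply H3.
    + intros z Hz; rewrite !adj_mem; auto.
    + intros a' Ha'; assert (a' = a) as -> by (destruct Hc as [_ I]; eauto).
      split; [exists b|exists b']; rewrite !rel_adj; auto.
  - split; [|split]; auto; [intros z Hz; auto|].
    intros a Ha; destruct N; eauto.
Qed.

Lemma step_fun n p q q' : step n p q -> step n p q' -> q = q'.
Proof.
  intros [(a & b & b' & H1 & H2 & H3 & ->)|[N ->]]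
         [(a1 & b1 & b1' & H1' & H2' & H3' & ->)|[N' ->]]; auto.
  - assert (a1 = a) as -> by (destruct Hc as [_ I]; eauto).
    assert (b1 = b) as -> by (eapply least_unique; eauto).
    assert (b1' = b') as -> by (eapply least_unique; eauto).
    auto.
  - destruct N'; eauto.
  - destruct N; eauto.
Qed.

(** The union of the stages of the recursion started at the given finite partial
    isomorphism. *)
Theorem partial_iso_extends p0 : partial_iso p0 -> exists s,
  is_automorphism s A le /\ forall x y, rel p0 x y -> rel s x y.
Proof.
  intro Hp0. set (it := iterate p0 step).
  assert (D : dfn (fun e => it (e 0) (e 1))).
  { apply def_iterate; def. }
  assert (Dp : dfn (fun e => partial_iso (e 0))) by def.
  assert (I1 : forall n, n ∈ omega ->
    (exists p, it n p) /\ forall p, it n p -> partial_iso p).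
  { apply (omega_ind (P := fun n =>
      (exists p, it n p) /\ forall p, it n p -> partial_iso p)); [def| |].
    - split; [exists p0; apply iterate_emp|].
      intros p H; apply iterate_emp_inv in H; subst; auto.
    - intros n Hn [[p Hp] IH]; split.
      + destruct (step_exists n (IH p Hp)) as [q Hq].
        exists q; eapply iterate_suc; eauto.
      + intros q Hq; apply iterate_suc_inv in Hq; auto.
        destruct Hq as (p' & H1 & H2). apply (step_spec (IH p' H1) H2). }
  assert (I2 : forall n, n ∈ omega -> forall p q, it n p -> it n q -> p = q).
  { apply (omega_ind (P := fun n => forall p q, it n p -> it n q -> p = q));
      [def| |].
    - intros p q H H'; apply iterate_emp_inv in H; apply iterate_emp_inv in H'.
      congruence.
    - intros n Hn IH p q H H'; apply iterate_suc_inv in H; auto.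
      apply iterate_suc_inv in H'; auto.
      destruct H as (p' & H1 & H2), H' as (q' & H3 & H4).
      rewrite (IH q' p') in H4; auto. eapply step_fun; eauto. }
  (* the stages increase, so any two pairs of R lie in a common stage *)
  assert (I3 : forall n, n ∈ omega -> forall m p q, m ∈ n ->
                 it m p -> it n q -> subset p q).
  { apply (omega_ind (P := fun n => forall m p q, m ∈ n ->
                 it m p -> it n q -> subset p q)); [def| |].
    - intros m p q Hm; destruct (emp_mem Hm).
    - intros n Hn IH m p q Hm Hp Hq; apply iterate_suc_inv in Hq; auto.
      destruct Hq as (q' & H1 & H2).
      assert (S : subset q' q).
      { apply (step_spec (proj2 (I1 n Hn) q' H1) H2). }
      apply suc_mem in Hm; destruct Hm as [Hm| ->].
      + intros z Hz; apply S; eapply IH; eauto.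
      + rewrite (I2 n Hn p q'); auto. }
  set (R := fun x y => exists n p, n ∈ omega /\ it n p /\ rel p x y).
  assert (DR : dfn (fun e => R (e 0) (e 1))).
  { def. }
  assert (C : forall x y x' y', R x y -> R x' y' ->
    exists n p, n ∈ omega /\ it n p /\ rel p x y /\ rel p x' y').
  { intros x y x' y' (n & p & Hn & Hp & Hr) (n' & p' & Hn' & Hp' & Hr').
    rewrite rel_iff in Hr; rewrite rel_iff in Hr'.
    destruct (omega_trichotomy Hn Hn') as [H|[H|H]].
    - exists n, p; rewrite !rel_iff; split; [|split; [|split]]; auto.
      eapply I3; [exact Hn|exact H| | |]; eauto.
    - subst n'; rewrite (I2 n Hn p' p) in Hr'; auto.
      exists n, p; rewrite !rel_iff; auto.
    - exists n', p'; rewrite !rel_iff; split; [|split; [|split]]; auto.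
      eapply I3; [exact Hn'|exact H| | |]; eauto. }
  assert (RI : forall x y x' y', R x y -> R x' y' ->
                 (rel le x x' <-> rel le y y')).
  { intros x y x' y' H H'; destruct (C x y x' y') as (n & p & Hn & Hp & H1 & H2); auto.
    destruct (proj2 (I1 n Hn) p Hp) as (_ & _ & _ & I); auto. }
  assert (RA : forall x y, R x y -> x ∈ A /\ y ∈ A).
  { intros x y (n & p & Hn & Hp & H).
    destruct (proj2 (I1 n Hn) p Hp) as (_ & _ & I & _); auto. }
  assert (RT : forall a, a ∈ A -> (exists b, R a b) /\ exists b, R b a).
  { intros a Ha; destruct (code_exists Ha) as (n & Hn & Cn).
    destruct (I1 n Hn) as [[p Hp] Gp]; specialize (Gp p Hp).
    destruct (step_exists n Gp) as [q Hq].
    destruct (step_spec Gp Hq) as (_ & _ & H); destruct (H a Cn) as [[b Hb] [b' Hb']].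
    assert (Hs : it (suc n) q) by (eapply iterate_suc; eauto).
    split; [exists b|exists b']; exists (suc n), q; auto using omega_suc. }
  destruct (@bijection_exists M Z R A A) as (s & Hs & Es); auto.
  - intros x Hx; destruct (RT x Hx) as [[y Hy] _]; exists y; split; auto.
    intros y' Hy'; destruct (RA _ _ Hy), (RA _ _ Hy').
    apply le_antisym; [apply (RI x y x y')|apply (RI x y' x y)]; auto;
      apply le_refl; auto.
  - intros x y _ H; apply (RA x y H).
  - intros x x' y Hx Hx' H H'.
    destruct (RA _ _ H).
    apply le_antisym; [apply (RI x y x' y)|apply (RI x' y x y)]; auto;
      apply le_refl; auto.
  - intros y Hy; destruct (RT y Hy) as [_ [x Hx]]; exists x; split; auto.
    apply (RA x y Hx).
  - exists s; split; [split|]; auto.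
    + intros x y x' y' H H'; apply Es in H; apply Es in H'.
      apply RI; tauto.
    + intros x y H; assert (R x y).
      { exists emp, p0; split; [apply omega_emp|split; auto].
        apply iterate_emp. }
      apply Es; split; auto. apply (RA x y); auto.
Qed.

(** The identity on [d] together with a pair of [a] and a slightly larger [b] is
    a finite partial isomorphism as long as no point of [d] lies between [a] and
    [b]. *)
Lemma moving_automorphism d a : is_set d -> subset d A -> finite d ->
  a ∈ A -> a ∉ d -> exists s b, is_automorphism s A le /\
    (forall x, x ∈ d -> rel s x x) /\ rel s a b /\ b <> a.
Proof.
  intros Sd dA Fd Ha Nd.
  destruct (gap_above Ha Sd Fd) as (r & Hr & G).
  destruct (lt_between Hr) as (b & H1 & H2).
  destruct (@finite_projection (fun x p => p = pr x x) d)
    as (q & Sq & Fq & Eq); auto.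
  { def. }
  { intros; congruence. }
  assert (Rq : forall x y, rel q x y <-> x ∈ d /\ y = x).
  { intros x y; rewrite rel_iff, Eq; split.
    - intros (u & Hu & E); apply pr_inj in E; destruct E; subst; auto.
    - intros [Hx ->]; eauto. }
  assert (Pq : partial_iso q).
  { split; [|split; [|split]]; auto.
    - intros x y H; apply Rq in H; destruct H; subst; auto.
    - intros x y x' y' H H'; apply Rq in H; apply Rq in H'.
      destruct H as [_ ->], H' as [_ ->]; tauto. }
  assert (Hb : b ∈ A) by apply (lt_dom H1).
  destruct (@partial_iso_extends (adj q (pr a b))) as (s & Hs & Es).
  - apply partial_iso_adj; auto.
    intros x y H; apply Rq in H; destruct H as [Hx ->].
    assert (Ax : x ∈ A) by auto.
    assert (Nx : x <> a) by (intros ->; auto).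
    destruct (le_or_lt Ax Ha) as [H|H].
    + assert (Hl : lt x a) by (split; auto).
      pose proof (lt_trans Hl H1) as H3.
      pose proof (lt_not_le Hl); pose proof (lt_not_le H3).
      destruct H3; tauto.
    + assert (H3 : lt b x).
      { destruct (le_or_lt Ax Hb) as [H3|H3]; auto.
        destruct (G x Hx H). eapply le_lt_trans; eauto. }
      pose proof (lt_not_le H); pose proof (lt_not_le H3).
      destruct H3, H; tauto.
  - exists s, b; split; [auto|split; [|split]].
    + intros x Hx; apply Es, rel_adj; left; apply Rq; auto.
    + apply Es, rel_adj; auto.
    + intros ->; destruct H1; auto.
Qed.

End DenseOrder.

(** * Rigidity of the atoms in the permutation model *)

Section Rigidity.
Context {M : eps_structure} {Z : ZFA M}.
Variables (A le Sigma F : M).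
Hypothesis A_atoms : is_atom_set A.
Hypothesis A_countable : countable A.
Hypothesis DLO : dense_linear_order_without_endpoints A le.
Hypothesis Sigma_aut : is_automorphism_group Sigma A le.
Hypothesis F_filter : is_filter_generated_by_stabilizers A Sigma F.

Lemma symmetric_automorphism_trivial f : symmetric Sigma F f ->
  is_automorphism f A le -> forall a, a ∈ A -> rel f a a.
Proof.
  intros Sf Af.
  destruct A_countable as (w & c & Hw & Hc); apply omega_iff in Hw; subst w.
  apply (symmetric_iff A_atoms Sigma_aut F_filter) in Sf.
  destruct Sf as (e & Se & eA & Fe & He).
  destruct Af as [Bf If].
  (* if a went to b, an automorphism fixing e and b but moving a would fix f
     and contradict its injectivity *)
  assert (Off : forall a, a ∈ A -> a ∉ e -> rel f a a).
  { intros a Ha Nae.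
    destruct (function_total (bijection_function Bf) Ha) as [b Hb].
    destruct (classic (b = a)) as [E|D]; [congruence|].
    assert (Ab : b ∈ A) by (eapply bijection_range; eauto).
    destruct (moving_automorphism DLO Hc (d := adj e b) (a := a))
      as (s & a' & Hs & H1 & H2 & H3); auto using adj_set.
    - intros z Hz; apply adj_mem in Hz; destruct Hz; subst; auto.
    - apply finite_adj; auto.
    - rewrite adj_mem; intuition congruence.
    - assert (Ss : s ∈ Sigma) by (apply Sigma_aut; auto).
      pose proof (Sigma_bijection Sigma_aut Ss) as Bs.
      assert (Ef : act s f = f).
      { apply He; auto; intros; apply H1, adj_mem; auto. }
      pose proof (act_rel A_atoms Bs Ef Hb) as H4.
      assert (Ea : act s a = a').
      { symmetry; apply (act_atom_iff A_atoms Bs); auto; apply A_atoms; auto. }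
      assert (Eb : act s b = b).
      { symmetry; apply (act_atom_iff A_atoms Bs); [apply A_atoms; auto|].
        apply H1, adj_mem; auto. }
      rewrite Ea, Eb in H4; destruct H3. exact (bijection_inj Bf H4 Hb). }
  intros a Ha.
  destruct (function_total (bijection_function Bf) Ha) as [b Hb].
  assert (Ab : b ∈ A) by (eapply bijection_range; eauto).
  destruct (classic (a = b)) as [E|D]; [congruence|].
  (* a fixed point strictly between a and its image contradicts monotonicity *)
  destruct (le_or_lt DLO Ha Ab) as [H|H].
  - destruct (lt_between_avoid DLO Se Fe (x := a) (y := b))
      as (z & H1 & H2 & H3); [split; auto|].
    assert (Hz : rel f z z) by (apply Off; auto; apply (lt_dom DLO H1)).
    destruct (lt_not_le DLO H2).
    apply (If a z b z); auto. apply H1.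
  - destruct (lt_between_avoid DLO Se Fe H) as (z & H1 & H2 & H3).
    assert (Hz : rel f z z) by (apply Off; auto; apply (lt_dom DLO H1)).
    destruct (lt_not_le DLO H1).
    apply (If z a z b); auto. apply H2.
Qed.

End Rigidity.

(** * The graph of a group *)

(** The points are [Elt x] for [x] in a transitive set [T], a marker [Star], and
    two copies [Src g], [Tgt g] of the group.  The other vertices are the blocks;
    their points are listed by [incid] below. *)
Inductive vertex (M : Type) : Type :=
| Elt (x : M) | Star | Src (g : M) | Tgt (g : M)
| StarBlock | SetBlock (x : M) | AtomBlock (a : M) | SrcBlock | ArrowBlock (g c : M).
Arguments Star {M}.
Arguments StarBlock {M}.
Arguments SrcBlock {M}.

(** Vertices live outside the model, so a quantifier over them is turned into a
    disjunction over the kinds of vertices. *)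
Lemma def_ex_vertex (M : eps_structure) (K : M -> Prop)
    (Q : vertex M -> (nat -> M) -> Prop) :
  Def K (fun e => Q (Elt (e 0)) (fun n => e (S n))) ->
  Def K (fun e => Q Star e) ->
  Def K (fun e => Q (Src (e 0)) (fun n => e (S n))) ->
  Def K (fun e => Q (Tgt (e 0)) (fun n => e (S n))) ->
  Def K (fun e => Q StarBlock e) ->
  Def K (fun e => Q (SetBlock (e 0)) (fun n => e (S n))) ->
  Def K (fun e => Q (AtomBlock (e 0)) (fun n => e (S n))) ->
  Def K (fun e => Q SrcBlock e) ->
  Def K (fun e => Q (ArrowBlock (e 1) (e 0)) (fun n => e (S (S n)))) ->
  Def K (fun e => exists v, Q v e).
Proof.
  intros H1 H2 H3 H4 H5 H6 H7 H8 H9.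
  apply def_ext with (fun e => (exists x, Q (Elt x) e) \/ Q Star e \/
    (exists x, Q (Src x) e) \/ (exists x, Q (Tgt x) e) \/ Q StarBlock e \/
    (exists x, Q (SetBlock x) e) \/ (exists x, Q (AtomBlock x) e) \/ Q SrcBlock e \/
    (exists x c, Q (ArrowBlock x c) e)).
  - intro e; split.
    + intros [[x H]|[H|[[x H]|[[x H]|[H|[[x H]|[[x H]|[H|(x & c & H)]]]]]]]];
        eauto.
    + intros [[x| |x|x| |x|x| |x c] H]; eauto 12.
  - repeat apply def_or; auto.
    1-5: apply def_ex; auto.
    apply def_ex, def_ex; auto.
Qed.

Fixpoint num (M : eps_structure) {Z : ZFA M} (n : nat) : M :=
  match n with O => emp | S k => suc (num k) end.

Definition gmul (M : eps_structure) {Z : ZFA M} (m x y : M) : M :=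
  the (fun z => op m x y z).

Section Frucht.
Context {M : eps_structure} {Z : ZFA M}.
Variables (A le : M).
Hypothesis A_atoms : is_atom_set A.
Hypothesis le_in : forall x y, rel le x y -> x ∈ A /\ y ∈ A.
Hypothesis le_refl : forall x, x ∈ A -> rel le x x.
Hypothesis le_antisym : forall x y, rel le x y -> rel le y x -> x = y.
Hypothesis le_trans : forall x y z, rel le x y -> rel le y z -> rel le x z.
Hypothesis le_no_min : forall x, x ∈ A -> exists y, rel le y x /\ y <> x.
Hypothesis rigid : forall f, is_automorphism f A le ->
  forall x, x ∈ A -> rel f x x.
Variables (G m : M).
Hypothesis HG : is_group G m.

Notation mul := (gmul m).

Lemma num_omega n : num n ∈ omega.
Proof. induction n; simpl; auto using omega_emp, omega_suc. Qed.
Lemma num_inj i : forall j, num i = num j -> i = j.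
Proof.
  induction i as [|i IH]; intros [|j] H; simpl in H; auto.
  - symmetry in H; destruct (suc_not_emp H).
  - destruct (suc_not_emp H).
  - f_equal; apply IH.
    apply suc_inj; auto; apply omega_set, num_omega.
Qed.

Lemma product_exists X Y : exists P, is_set P /\
  forall x y, pr x y ∈ P <-> x ∈ X /\ y ∈ Y.
Proof.
  destruct (zfa_power Z (bun X Y)) as (p & Sp & Ep).
  destruct (zfa_power Z p) as (q & Sq & Eq).
  destruct (@separation M Z
    (fun z => exists x y, x ∈ X /\ y ∈ Y /\ z = pr x y) q) as (P & SP & EP).
  { def. }
  exists P; split; auto; intros x y; rewrite EP; split.
  - intros (_ & x' & y' & H1 & H2 & H); apply pr_inj in H.
    destruct H; subst; auto.
  - intros [Hx Hy]; split; [|eauto 6].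
    assert (SU : forall u v, is_set (upr u v))
      by (intros u v; apply (@mem_set _ _ u), upr_mem; auto).
    apply Eq; split; [apply SU|]. intros z Hz; apply upr_mem in Hz.
    apply Ep; destruct Hz; subst; split; auto; intros w Hw;
      apply upr_mem in Hw; apply bun_mem; destruct Hw; subst; auto.
Qed.

Lemma op_iff x y z : op m x y z <-> rel m (pr x y) z.
Proof.
  unfold op; split; [intros (p & Hp & H); apply pair_iff in Hp; subst; auto|].
  intro H; exists (pr x y); split; auto; apply pair_iff; auto.
Qed.

Lemma mul_op x y z : x ∈ G -> y ∈ G -> (op m x y z <-> z = mul x y).
Proof.
  intros Hx Hy; destruct HG as (_ & (P & HP & HM & _) & _).
  assert (Hp : pr x y ∈ P).
  { apply HP; exists x, y; rewrite pair_iff; auto. }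
  destruct (function_total HM Hp) as [w Hw].
  assert (E : forall z', op m x y z' -> z' = w).
  { intros z' H; apply op_iff in H; apply (function_fun HM H Hw). }
  assert (E' : mul x y = w) by (apply the_eq; auto; apply op_iff; auto).
  rewrite E'; split; auto; intros ->; apply op_iff; auto.
Qed.

Lemma mul_in x y : x ∈ G -> y ∈ G -> mul x y ∈ G.
Proof.
  intros Hx Hy; pose proof (proj2 (mul_op _ Hx Hy) eq_refl) as H.
  destruct HG as (_ & (P & HP & HM) & _).
  apply op_iff in H; destruct HM; eauto.
Qed.

Lemma mul_assoc x y z : x ∈ G -> y ∈ G -> z ∈ G ->
  mul (mul x y) z = mul x (mul y z).
Proof.
  intros Hx Hy Hz; pose proof (mul_in Hx Hy); pose proof (mul_in Hy Hz).
  destruct HG as (_ & _ & H3 & _).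
  apply (H3 x y z (mul x y) (mul y z)); apply mul_op; auto.
Qed.

Lemma unit_exists : exists e, e ∈ G /\
  (forall x, x ∈ G -> mul e x = x /\ mul x e = x) /\
  forall x, x ∈ G -> exists y, y ∈ G /\ mul y x = e /\ mul x y = e.
Proof.
  destruct HG as (_ & _ & _ & e & He & H1 & H2).
  exists e; split; [auto|split].
  - intros x Hx; destruct (H1 x Hx) as [H3 H4].
    apply mul_op in H3; apply mul_op in H4; auto.
  - intros x Hx; destruct (H2 x Hx) as (y & Hy & H3 & H4); exists y.
    apply mul_op in H3; apply mul_op in H4; auto.
Qed.

(** The pairs of group elements are included so that the labels of all vertices
    lie in [T]. *)
Lemma universe_exists : exists T, transitive T /\ A ∈ T /\ G ∈ T /\
  forall x y, x ∈ G -> y ∈ G -> pr x y ∈ T.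
Proof.
  destruct HG as (_ & (P & HP & _) & _).
  destruct (transitive_closure_exists (upr (upr A G) (upr P P)))
    as (T & ST & TT & HT & _).
  exists T; split; auto.
  assert (H1 : upr A G ∈ T) by (apply HT, upr_mem; auto).
  assert (H2 : upr P P ∈ T) by (apply HT, upr_mem; auto).
  assert (H3 : P ∈ T) by (apply (TT _ H2), upr_mem; auto).
  split; [|split]; [apply (TT _ H1), upr_mem; auto..|].
  intros x y Hx Hy; apply (TT _ H3), HP.
  exists x, y; rewrite pair_iff; auto.
Qed.

Section Graph.
Variable T : M.
Hypothesis T_trans : transitive T.
Hypothesis T_A : A ∈ T.
Hypothesis T_G : G ∈ T.
Hypothesis T_pr : forall x y, x ∈ G -> y ∈ G -> pr x y ∈ T.
Variable e : M.
Hypothesis e_G : e ∈ G.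
Hypothesis e_unit : forall x, x ∈ G -> mul e x = x /\ mul x e = x.
Hypothesis e_inv :
  forall x, x ∈ G -> exists y, y ∈ G /\ mul y x = e /\ mul x y = e.

Implicit Types v w p q : vertex M.

Lemma atom_in_T a : a ∈ A -> a ∈ T.
Proof. apply (T_trans T_A). Qed.
Lemma group_in_T a : a ∈ G -> a ∈ T.
Proof. apply (T_trans T_G). Qed.

(** The label [A] of [Star], [StarBlock] and [SrcBlock] is a dummy element of
    [T]. *)
Definition code v : M :=
  match v with
  | Elt x => pr (num 0) x
  | Star => pr (num 1) A
  | Src g => pr (num 2) g
  | Tgt g => pr (num 3) g
  | StarBlock => pr (num 4) A
  | SetBlock x => pr (num 5) x
  | AtomBlock a => pr (num 6) a
  | SrcBlock => pr (num 7) A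
  | ArrowBlock g c => pr (num 8) (pr g c)
  end.

Lemma code_inj v w : code v = code w -> v = w.
Proof.
  destruct v, w; cbn [code]; intro H; apply pr_inj in H;
    destruct H as [H1 H2]; apply num_inj in H1; try discriminate; subst; auto.
  apply pr_inj in H2; destruct H2; subst; auto.
Qed.

Definition valid v : Prop :=
  match v with
  | Elt x => x ∈ T
  | Src g | Tgt g => g ∈ G
  | SetBlock x => x ∈ T /\ is_set x
  | AtomBlock a => a ∈ A
  | ArrowBlock g c => g ∈ G /\ c ∈ G
  | _ => True
  end.

Definition point v : Prop :=
  match v with Elt _ | Star | Src _ | Tgt _ => True | _ => False end.

(** The set [x] is represented by the block of its elements, itself and [Star],
    the atom [a] by the block of the atoms up to it, and the arrow of colour [c]
    starting at [g] by its source, its target and its colour.  [StarBlock] makes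
    [Star] recognizable and [SrcBlock] separates the two copies of the group. *)
Definition incid v w : Prop :=
  match v, w with
  | Star, StarBlock => True
  | Elt z, SetBlock x => z ∈ x \/ z = x
  | Star, SetBlock _ => True
  | Elt z, AtomBlock a => rel le z a
  | Elt _, SrcBlock => True
  | Src _, SrcBlock => True
  | Src z, ArrowBlock g c => z = g
  | Tgt z, ArrowBlock g c => z = mul g c
  | Elt z, ArrowBlock g c => z = c
  | _, _ => False
  end.

(** Distinctness of points is expressed through codes so that it is a condition
    inside the model. *)
Definition adjacent v w : Prop :=
  (point v /\ point w /\ code v <> code w) \/ incid v w \/ incid w v.

Definition translate u v : vertex M :=
  match v with
  | Src g => Src (mul u g)
  | Tgt g => Tgt (mul u g)
  | ArrowBlock g c => ArrowBlock (mul u g) c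
  | _ => v
  end.

Lemma incid_point v w : incid v w -> point v.
Proof. destruct v, w; simpl; tauto. Qed.
Lemma incid_block v w : incid v w -> ~ point w.
Proof. destruct v, w; simpl; tauto. Qed.

Lemma adjacent_points v w : point v -> point w -> (adjacent v w <-> v <> w).
Proof.
  intros Hv Hw; unfold adjacent; split.
  - intros [(_ & _ & H)|[H|H]]; [congruence| |];
      apply incid_block in H; contradiction.
  - intro H; left; split; [|split]; auto. intro E; apply H, code_inj, E.
Qed.
Lemma adjacent_incid v w : point v -> ~ point w ->
  (adjacent v w <-> incid v w).
Proof.
  intros Hv Hw; unfold adjacent; split; [|tauto].
  intros [H|[H|H]]; [tauto|tauto|]. apply incid_block in H; contradiction.
Qed.
Lemma adjacent_sym v w : adjacent v w <-> adjacent w v.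
Proof. unfold adjacent; intuition congruence. Qed.
Lemma adjacent_blocks v w : ~ point v -> ~ point w -> ~ adjacent v w.
Proof.
  intros Hv Hw [H|[H|H]]; [tauto| |]; apply incid_point in H; contradiction.
Qed.

(** This recognizes the blocks from the graph alone.  All neighbours of a block
    are points.  A point [v] has two neighbours that are not adjacent: a block
    that contains [v] and a point outside that block. *)
Lemma block_iff v : valid v -> (~ point v <->
  forall x y, valid x -> valid y -> adjacent v x -> adjacent v y -> x <> y ->
    adjacent x y).
Proof.
  intro Hv; split.
  - intros Nv x y _ _ Hx Hy D.
    assert (P : forall z, adjacent v z -> point z).
    { intros z Hz; apply NNPP; intro Nz.
      apply (adjacent_blocks Nv Nz Hz). }
    apply adjacent_points; auto.
  - intros H Pv.
    assert (E : exists b q, valid b /\ valid q /\ incid v b /\ point q /\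
                            q <> v /\ ~ incid q b).
    { destruct v as [x| |g|g| |x|x| |g c]; simpl in *; try contradiction.
      - destruct (classic (atom x)) as [Hx|Hx].
        + exists (AtomBlock x), Star; simpl; repeat split; auto; try discriminate.
          * apply A_atoms; auto.
          * apply le_refl, A_atoms; auto.
        + exists (SetBlock x), (Src e); simpl; repeat split; auto; discriminate.
      - exists StarBlock, (Src e); simpl; repeat split; auto; discriminate.
      - exists SrcBlock, Star; simpl; repeat split; auto; discriminate.
      - exists (ArrowBlock g e), Star; simpl; repeat split; auto; try discriminate.
        symmetry; apply e_unit; auto. }
    destruct E as (b & q & Hb & Hq & Ib & Pq & D & Nq).
    pose proof (incid_block Ib) as Nb.
    apply Nq, adjacent_incid; auto.
    apply adjacent_sym, H; auto.
    + apply adjacent_incid; auto.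
    + apply adjacent_points; auto.
    + intros ->; auto.
Qed.

(** An automorphism of the graph with its inverse.  Keeping both makes every
    property of the automorphism available for the inverse. *)
Definition symmetry_pair (F H : vertex M -> vertex M) : Prop :=
  (forall v, valid v -> valid (F v) /\ valid (H v) /\ H (F v) = v /\ F (H v) = v)
  /\ forall v w, valid v -> valid w -> (adjacent v w <-> adjacent (F v) (F w)).

Lemma symmetry_pair_sym F H : symmetry_pair F H -> symmetry_pair H F.
Proof.
  intros [S1 S2]; split.
  - intros v Hv; destruct (S1 v Hv) as (H1 & H2 & H3 & H4); auto.
  - intros v w Hv Hw; destruct (S1 v Hv) as (H1 & H2 & H3 & H4).
    destruct (S1 w Hw) as (H1' & H2' & H3' & H4').
    rewrite (S2 (H v) (H w)), H4, H4'; tauto.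
Qed.

Section Pair.
Variables F H : vertex M -> vertex M.
Hypothesis FH : symmetry_pair F H.

Lemma sym_valid v : valid v -> valid (F v).
Proof. apply FH. Qed.
Lemma sym_inv_valid v : valid v -> valid (H v).
Proof. apply FH. Qed.
Lemma sym_cancel v : valid v -> H (F v) = v.
Proof. apply FH. Qed.
Lemma sym_inv_cancel v : valid v -> F (H v) = v.
Proof. apply FH. Qed.
Lemma sym_inj v w : valid v -> valid w -> F v = F w -> v = w.
Proof.
  intros Hv Hw E; rewrite <- (sym_cancel Hv), <- (sym_cancel Hw), E; auto.
Qed.

Lemma sym_block v : valid v -> ~ point v -> ~ point (F v).
Proof.
  intros Hv Nv; apply block_iff; [apply sym_valid; auto|].
  intros x y Hx Hy Ax Ay D.
  pose proof (sym_inv_valid Hx) as Vx; pose proof (sym_inv_valid Hy) as Vy.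
  rewrite <- (sym_inv_cancel Hx), <- (sym_inv_cancel Hy).
  rewrite <- (sym_inv_cancel Hx) in Ax; rewrite <- (sym_inv_cancel Hy) in Ay.
  destruct FH as [_ Hadj].
  apply (proj1 (Hadj _ _ Vx Vy)), (proj1 (block_iff Hv) Nv); auto.
  - apply (proj2 (Hadj _ _ Hv Vx)), Ax.
  - apply (proj2 (Hadj _ _ Hv Vy)), Ay.
  - intro E; apply D; rewrite <- (sym_inv_cancel Hx), <- (sym_inv_cancel Hy), E; auto.
Qed.

End Pair.

Lemma sym_point F H v : symmetry_pair F H -> valid v -> point v -> point (F v).
Proof.
  intros S Hv Pv; apply NNPP; intro N.
  apply (sym_block (symmetry_pair_sym S) (sym_valid S Hv) N).
  rewrite (sym_cancel S Hv); auto.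
Qed.

Lemma sym_incid F H v w : symmetry_pair F H -> valid v -> valid w ->
  incid v w -> incid (F v) (F w).
Proof.
  intros S Hv Hw I.
  pose proof (incid_point I) as Pv; pose proof (incid_block I) as Nw.
  apply adjacent_incid.
  - eapply sym_point; eauto.
  - eapply sym_block; eauto.
  - apply (proj1 (proj2 S v w Hv Hw)), adjacent_incid; auto.
Qed.

Lemma sym_incid_inv F H v w : symmetry_pair F H -> valid v -> valid w ->
  incid (F v) (F w) -> incid v w.
Proof.
  intros S Hv Hw I; rewrite <- (sym_cancel S Hv), <- (sym_cancel S Hw).
  apply (sym_incid (symmetry_pair_sym S)); auto; apply (sym_valid S); auto.
Qed.

(** [StarBlock] is the only block with at most one point; here it matters that
    no atom is minimal. *)
Lemma sym_StarBlock F H : symmetry_pair F H -> F StarBlock = StarBlock.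
Proof.
  intro S.
  assert (V : valid (F StarBlock)) by (apply (sym_valid S); simpl; auto).
  assert (N : ~ point (F StarBlock)) by (apply (sym_block S); simpl; auto).
  assert (U : forall p q, valid p -> valid q -> point p -> point q ->
    incid p (F StarBlock) -> incid q (F StarBlock) -> p = q).
  { intros p q Hp Hq Pp Pq Ip Iq.
    rewrite <- (sym_inv_cancel S Hp), <- (sym_inv_cancel S Hq); f_equal.
    rewrite <- (sym_inv_cancel S Hp) in Ip; rewrite <- (sym_inv_cancel S Hq) in Iq.
    apply (sym_incid_inv S) in Ip; simpl; auto; [|apply (sym_inv_valid S); auto].
    apply (sym_incid_inv S) in Iq; simpl; auto; [|apply (sym_inv_valid S); auto].
    destruct (H p), (H q); simpl in *; tauto. }
  destruct (F StarBlock) as [x| |g|g| |x|x| |g c]; simpl in *; try tauto.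
  - specialize (U (Elt x) Star); simpl in U.
    discriminate U; auto; tauto.
  - destruct (le_no_min V) as (y & H1 & H2).
    specialize (U (Elt y) (Elt x)); simpl in U.
    assert (E : Elt y = Elt x).
    { apply U; auto; apply atom_in_T; auto; apply (le_in H1). }
    congruence.
  - specialize (U (Elt A) (Src e)); simpl in U; discriminate U; auto.
  - specialize (U (Src g) (Tgt (mul g c))); simpl in U; discriminate U; auto;
      try tauto; apply mul_in; tauto.
Qed.

Lemma sym_Star F H : symmetry_pair F H -> F Star = Star.
Proof.
  intro S. assert (I : incid (F Star) (F StarBlock)).
  { apply (sym_incid S); simpl; auto. }
  rewrite (sym_StarBlock S) in I; destruct (F Star); simpl in I; tauto.
Qed.

(** Apart from [StarBlock], the blocks that contain [Star] are those of sets. *)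
Lemma sym_SetBlock F H x : symmetry_pair F H -> x ∈ T -> is_set x ->
  exists y, y ∈ T /\ is_set y /\ F (SetBlock x) = SetBlock y.
Proof.
  intros S Hx Sx. assert (V : valid (SetBlock x)) by (simpl; auto).
  assert (I : incid (F Star) (F (SetBlock x))).
  { apply (sym_incid S); simpl; auto. }
  assert (D : F (SetBlock x) <> StarBlock).
  { intro E; rewrite <- (sym_StarBlock S) in E; apply (sym_inj S) in E; simpl; auto.
    discriminate. }
  pose proof (sym_valid S V) as V'.
  rewrite (sym_Star S) in I; destruct (F (SetBlock x)) as [| | | | |y| | |];
    simpl in I, V'; try tauto.
  exists y; tauto.
Qed.

(** Apart from [Star], the points of blocks of sets are the elements of [T]; an
    atom is in the block of [A]. *)
Lemma sym_Elt F H x : symmetry_pair F H -> x ∈ T ->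
  exists y, y ∈ T /\ F (Elt x) = Elt y.
Proof.
  intros S Hx.
  assert (E : exists z, z ∈ T /\ is_set z /\ incid (Elt x) (SetBlock z)).
  { destruct (classic (atom x)) as [Ax|Sx].
    - exists A; split; [|split]; auto; [apply A_atoms|].
      left; apply A_atoms; auto.
    - exists x; simpl; auto. }
  destruct E as (z & Hz & Sz & I).
  apply (sym_incid S) in I; simpl; auto.
  destruct (sym_SetBlock S Hz Sz) as (y & Hy & Sy & E); rewrite E in I.
  assert (V : valid (F (Elt x))) by (apply (sym_valid S); auto).
  assert (D : F (Elt x) <> Star).
  { intro E'; rewrite <- (sym_Star S) in E'; apply (sym_inj S) in E'; simpl; auto.
    discriminate. }
  destruct (F (Elt x)) as [u| | | | | | | |]; simpl in I, V; try tauto.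
  exists u; auto.
Qed.

Lemma sym_Elt_inv F H v x : symmetry_pair F H -> valid v -> F v = Elt x ->
  x ∈ T -> exists y, v = Elt y.
Proof.
  intros S Hv E Hx.
  destruct (sym_Elt (symmetry_pair_sym S) Hx) as (y & _ & Ey).
  exists y; rewrite <- Ey, <- E, (sym_cancel S Hv); auto.
Qed.

Lemma sym_Star_incid F H b : symmetry_pair F H -> valid b -> ~ point b ->
  (incid Star b <-> incid Star (F b)).
Proof.
  intros S Hb Nb; rewrite <- (sym_Star S) at 2; split.
  - apply (sym_incid S); simpl; auto.
  - apply (sym_incid_inv S); simpl; auto.
Qed.

(** [SrcBlock] is the only block that contains all elements of [T] but not
    [Star]: an arrow block contains only one element of [T], while [G] and its
    unit are two distinct ones. *)
Lemma sym_SrcBlock F H : symmetry_pair F H -> F SrcBlock = SrcBlock.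
Proof.
  intro S.
  assert (V : valid (F SrcBlock)) by (apply (sym_valid S); simpl; auto).
  assert (N : ~ point (F SrcBlock)) by (apply (sym_block S); simpl; auto).
  assert (NS : ~ incid Star (F SrcBlock)).
  { rewrite <- (sym_Star_incid S); simpl; auto. }
  assert (IT : forall x, x ∈ T -> incid (Elt x) (F SrcBlock)).
  { intros x Hx; destruct (sym_Elt (symmetry_pair_sym S) Hx) as (y & Hy & E).
    assert (E' : F (Elt y) = Elt x) by (rewrite <- E; apply (sym_inv_cancel S); auto).
    rewrite <- E'; apply (sym_incid S); simpl; auto. }
  pose proof (IT A T_A) as I1; pose proof (IT G T_G) as I2.
  pose proof (IT e (group_in_T e_G)) as I3.
  destruct (F SrcBlock) as [| | | | |x|a| |g c]; simpl in *; try tauto.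
  - destruct (@no_cycle1 M Z A); apply (le_in I1).
  - destruct (@no_cycle1 M Z G); congruence.
Qed.

Lemma sym_Src F H g : symmetry_pair F H -> g ∈ G ->
  exists g', g' ∈ G /\ F (Src g) = Src g'.
Proof.
  intros S Hg.
  assert (I : incid (F (Src g)) (F SrcBlock)) by (apply (sym_incid S); simpl; auto).
  assert (V : valid (F (Src g))) by (apply (sym_valid S); auto).
  rewrite (sym_SrcBlock S) in I.
  destruct (F (Src g)) as [x| |g'| | | | | |] eqn:E; simpl in *; try tauto.
  - apply (sym_Elt_inv S) in E; simpl; auto. destruct E; discriminate.
  - eauto.
Qed.

Lemma sym_Tgt F H g : symmetry_pair F H -> g ∈ G ->
  exists g', g' ∈ G /\ F (Tgt g) = Tgt g'.
Proof.
  intros S Hg.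
  assert (V : valid (F (Tgt g))) by (apply (sym_valid S); auto).
  assert (P : point (F (Tgt g))) by (apply (sym_point S); simpl; auto).
  destruct (F (Tgt g)) as [x| |g'|g'| | | | |] eqn:E; simpl in *; try tauto.
  - apply (sym_Elt_inv S) in E; simpl; auto. destruct E; discriminate.
  - rewrite <- (sym_Star S) in E; apply (sym_inj S) in E; simpl; auto; discriminate.
  - destruct (sym_Src (symmetry_pair_sym S) V) as (h & Hh & E').
    rewrite <- E in E'; rewrite (sym_cancel S) in E'; [discriminate|auto].
  - eauto.
Qed.

Lemma sym_SrcBlock_inv F H b : symmetry_pair F H -> valid b -> F b = SrcBlock -> b = SrcBlock.
Proof.
  intros S Hb E; rewrite <- (sym_SrcBlock S) in E.
  apply (sym_inj S) in E; simpl; auto.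
Qed.

Lemma sym_AtomBlock F H a : symmetry_pair F H -> a ∈ A ->
  exists a', a' ∈ A /\ F (AtomBlock a) = AtomBlock a'.
Proof.
  intros S Ha.
  assert (Vb : valid (AtomBlock a)) by auto.
  assert (V : valid (F (AtomBlock a))) by (apply (sym_valid S); auto).
  assert (N : ~ point (F (AtomBlock a))) by (apply (sym_block S); simpl; auto).
  assert (NS : ~ incid Star (F (AtomBlock a))).
  { rewrite <- (sym_Star_incid S); simpl; auto. }
  destruct (F (AtomBlock a)) as [| | | | |x|a'| |g c] eqn:E; simpl in *; try tauto.
  - eauto.
  - apply (sym_SrcBlock_inv S) in E; auto; discriminate.
  - destruct (sym_Src (symmetry_pair_sym S) (proj1 V)) as (h & Hh & E').
    assert (E'' : F (Src h) = Src g) by (rewrite <- E'; apply (sym_inv_cancel S), V).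
    assert (I : incid (F (Src h)) (F (AtomBlock a))) by (rewrite E, E''; simpl; auto).
    apply (sym_incid_inv S) in I; simpl; auto; tauto.
Qed.

Lemma sym_ArrowBlock F H g c : symmetry_pair F H -> g ∈ G -> c ∈ G ->
  exists g' c', g' ∈ G /\ c' ∈ G /\ F (ArrowBlock g c) = ArrowBlock g' c'.
Proof.
  intros S Hg Hc.
  assert (Vb : valid (ArrowBlock g c)) by (simpl; auto).
  assert (V : valid (F (ArrowBlock g c))) by (apply (sym_valid S); auto).
  assert (N : ~ point (F (ArrowBlock g c))) by (apply (sym_block S); simpl; auto).
  assert (NS : ~ incid Star (F (ArrowBlock g c))).
  { rewrite <- (sym_Star_incid S); simpl; auto. }
  destruct (sym_Src S Hg) as (h & Hh & E').
  assert (I : incid (F (Src g)) (F (ArrowBlock g c))).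
  { apply (sym_incid S); simpl; auto. }
  rewrite E' in I.
  destruct (F (ArrowBlock g c)) as [| | | | |x|a'| |g' c'] eqn:E; simpl in *; try tauto.
  - apply (sym_SrcBlock_inv S) in E; auto; discriminate.
  - exists g', c'; tauto.
Qed.

Lemma sym_atom F H a : symmetry_pair F H -> a ∈ A ->
  exists b, b ∈ A /\ F (Elt a) = Elt b.
Proof.
  intros S Ha; destruct (sym_AtomBlock S Ha) as (a' & Ha' & E).
  assert (Ta : a ∈ T) by (apply atom_in_T; auto).
  destruct (sym_Elt S Ta) as (b & Hb & Eb).
  assert (I : incid (F (Elt a)) (F (AtomBlock a))).
  { apply (sym_incid S); simpl; auto. }
  rewrite E, Eb in I; simpl in I; exists b; split; auto; apply (le_in I).
Qed.

Lemma sym_atom_surj F H a : symmetry_pair F H -> a ∈ A ->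
  exists b, b ∈ A /\ F (Elt b) = Elt a.
Proof.
  intros S Ha; destruct (sym_atom (symmetry_pair_sym S) Ha) as (b & Hb & E).
  exists b; split; auto; rewrite <- E; apply (sym_inv_cancel S); simpl.
  apply atom_in_T; auto.
Qed.

Lemma sym_atom_le F H a b a' b' : symmetry_pair F H -> a ∈ A -> b ∈ A ->
  F (Elt b) = Elt b' -> F (AtomBlock a) = AtomBlock a' -> (rel le b a <-> rel le b' a').
Proof.
  intros S Ha Hb E1 E2.
  pose proof (atom_in_T Hb) as Tb; split; intro I.
  - apply (sym_incid (v := Elt b) (w := AtomBlock a) S) in I; auto.
    rewrite E1, E2 in I; auto.
  - apply (sym_incid_inv (v := Elt b) (w := AtomBlock a) S); auto.
    rewrite E1, E2; auto.
Qed.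

(** The blocks of atoms are the principal down-sets of a partial order, and a
    principal down-set is mapped to the one generated by the image of its
    largest element. *)
Lemma sym_AtomBlock_eq F H a b : symmetry_pair F H -> a ∈ A ->
  F (Elt a) = Elt b -> F (AtomBlock a) = AtomBlock b.
Proof.
  intros S Ha Eb; destruct (sym_AtomBlock S Ha) as (c & Hc & Ec).
  (* the blocks of z and a turn out to have the same image, so z is a *)
  destruct (sym_atom_surj S Hc) as (z & Hz & Ez).
  destruct (sym_AtomBlock S Hz) as (d & Hd & Ed).
  assert (za : rel le z a) by (apply (sym_atom_le S Ha Hz Ez Ec); auto).
  assert (cd : rel le c d) by (apply (sym_atom_le S Hz Hz Ez Ed); auto).
  destruct (sym_atom_surj S Hd) as (w & Hw & Ew).
  assert (wz : rel le w z) by (apply (sym_atom_le S Hz Hw Ew Ed); auto).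
  assert (dc : rel le d c).
  { apply (sym_atom_le S Ha Hw Ew Ec); eauto. }
  assert (c = d) by auto; subst d.
  rewrite <- Ec in Ed; apply (sym_inj S) in Ed; simpl; auto.
  injection Ed as ->; congruence.
Qed.

(** Induction on membership.  Let [x] be a set whose elements are fixed, with
    [Elt x] mapped to [Elt z] and the block of [x] to the block of [y].  Then
    [z] and [y] are not in [x], as they would be fixed and [x] would be an
    element of itself.  The block of [y] thus consists of the elements of [x],
    [z] and [Star], and it contains [y]; so [y] is [z], and [x] and [y] have the
    same elements. *)
Lemma sym_universe F H : symmetry_pair F H ->
  dfn (fun s => s 0 ∈ T -> F (Elt (s 0)) = Elt (s 0) /\
         (is_set (s 0) -> F (SetBlock (s 0)) = SetBlock (s 0))) ->
  (forall a, a ∈ A -> F (Elt a) = Elt a) ->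
  forall x, x ∈ T -> F (Elt x) = Elt x /\ (is_set x -> F (SetBlock x) = SetBlock x).
Proof.
  intros S D Fa; apply (eps_ind (P := fun x => x ∈ T -> F (Elt x) = Elt x /\
    (is_set x -> F (SetBlock x) = SetBlock x))); auto.
  intros x IH Hx.
  destruct (classic (atom x)) as [Ax|Sx].
  { split; [apply Fa, A_atoms; auto|intro N; destruct (N Ax)]. }
  assert (IH' : forall y, y ∈ x -> F (Elt y) = Elt y /\
                  (is_set y -> F (SetBlock y) = SetBlock y)).
  { intros y Hy; apply IH; auto. apply (T_trans Hx Hy). }
  destruct (sym_Elt S Hx) as (z & Hz & Ez).
  destruct (sym_SetBlock S Hx Sx) as (y & Hy & Sy & Ey).
  assert (Nz : z ∉ x).
  { intro H1; pose proof (proj1 (IH' z H1)) as H2; rewrite <- Ez in H2 at 2.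
    apply (sym_inj S) in H2; simpl; auto. injection H2 as ->.
    destruct (no_cycle1 H1). }
  assert (Ny : y ∉ x).
  { intro H1; pose proof (proj2 (IH' y H1) Sy) as H2; rewrite <- Ey in H2 at 2.
    apply (sym_inj S) in H2; simpl; auto. injection H2 as ->.
    destruct (no_cycle1 H1). }
  assert (E : forall w : M, w ∈ T -> forall w' : M, F (Elt w) = Elt w' ->
                ((w ∈ x \/ w = x) <-> (w' ∈ y \/ w' = y))).
  { intros w Hw w' Ew; split; intro I.
    - apply (sym_incid (v := Elt w) (w := SetBlock x) S) in I; simpl; auto.
      rewrite Ew, Ey in I; auto.
    - apply (sym_incid_inv (v := Elt w) (w := SetBlock x) S); simpl; auto.
      rewrite Ew, Ey; auto. }
  assert (Ex : forall w : M, w ∈ x -> w ∈ y \/ w = y).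
  { intros w Hw; apply (E w (T_trans Hx Hw)); [|auto].
    apply IH'; auto. }
  assert (Ezy : z = y).
  { destruct (sym_Elt (symmetry_pair_sym S) Hy) as (w & Hw & Ew).
    assert (Fw : F (Elt w) = Elt y) by (rewrite <- Ew; apply (sym_inv_cancel S); auto).
    destruct (proj2 (E w Hw y Fw)) as [H1|H1]; auto.
    - rewrite (proj1 (IH' w H1)) in Fw; injection Fw as ->; contradiction.
    - subst w; congruence. }
  subst z.
  enough (x = y) by (subst y; auto).
  apply ext; auto; intro w; split; intro Hw.
  - destruct (Ex w Hw) as [H1| ->]; [auto|contradiction].
  - destruct (sym_Elt (symmetry_pair_sym S) (T_trans Hy Hw)) as (v & Hv & Ev).
    assert (Fv : F (Elt v) = Elt w).
    { rewrite <- Ev; apply (sym_inv_cancel S). apply (T_trans Hy Hw). }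
    destruct (proj2 (E v Hv w Fv)) as [H1| ->]; auto.
    + rewrite (proj1 (IH' v H1)) in Fv; injection Fv as ->; auto.
    + rewrite Ez in Fv; injection Fv as ->; destruct (no_cycle1 Hw).
Qed.

(** As the colours are fixed, the arrow from [Src g] to [Tgt (g c)] goes to an
    arrow of colour [c].  If [Src e] goes to [Src u], the arrows from the unit
    [e] show that [Tgt c] goes to [Tgt (u c)], and the arrows of colour [e]
    show that [Src g] goes to [Src (u g)]. *)
Lemma sym_translation F H : symmetry_pair F H ->
  (forall a, a ∈ A -> F (Elt a) = Elt a) ->
  (forall x, x ∈ T -> F (Elt x) = Elt x /\ (is_set x -> F (SetBlock x) = SetBlock x)) ->
  exists u, u ∈ G /\ forall v, valid v -> F v = translate u v.
Proof.
  intros S Fa FT; destruct (sym_Src S e_G) as (u & Hu & Eu); exists u.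
  split; auto.
  assert (Tri : forall x c, x ∈ G -> c ∈ G -> exists x', x' ∈ G /\
    F (Src x) = Src x' /\ F (ArrowBlock x c) = ArrowBlock x' c /\
    F (Tgt (mul x c)) = Tgt (mul x' c)).
  { intros x c Hx Hc; destruct (sym_Src S Hx) as (x' & Hx' & E1).
    destruct (sym_Tgt S (mul_in Hx Hc)) as (y & Hy & E2).
    destruct (sym_ArrowBlock S Hx Hc) as (x'' & c' & Hx'' & Hc' & E3).
    destruct (FT c (group_in_T Hc)) as [E4 _].
    assert (I1 : incid (F (Src x)) (F (ArrowBlock x c)))
      by (apply (sym_incid S); simpl; auto).
    assert (I2 : incid (F (Tgt (mul x c))) (F (ArrowBlock x c)))
      by (apply (sym_incid S); simpl; auto using mul_in).
    assert (I3 : incid (F (Elt c)) (F (ArrowBlock x c)))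
      by (apply (sym_incid S); simpl; auto using group_in_T).
    rewrite E1, E3 in I1; rewrite E2, E3 in I2; rewrite E4, E3 in I3.
    simpl in *; subst x'' c' y; exists x'; auto. }
  assert (P1 : forall c, c ∈ G -> F (Tgt c) = Tgt (mul u c)).
  { intros c Hc; destruct (Tri e c e_G Hc) as (x' & Hx' & E1 & E2 & E3).
    rewrite (proj1 (e_unit Hc)) in E3; congruence. }
  assert (P0 : forall x, x ∈ G -> F (Src x) = Src (mul u x)).
  { intros x Hx; destruct (Tri x e Hx e_G) as (x' & Hx' & E1 & E2 & E3).
    rewrite (proj2 (e_unit Hx)), (proj2 (e_unit Hx')), P1 in E3; auto.
    injection E3 as <-; auto. }
  intros [x| |g|g| |x|a| |g c] Hv; simpl in *.
  - apply FT; auto.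
  - apply (sym_Star S).
  - apply P0; auto.
  - apply P1; auto.
  - apply (sym_StarBlock S).
  - apply FT; tauto.
  - apply (sym_AtomBlock_eq S); auto.
  - apply (sym_SrcBlock S).
  - destruct Hv as [Hg Hc]; destruct (Tri g c Hg Hc) as (x' & _ & E1 & E2 & _).
    rewrite (P0 g Hg) in E1; congruence.
Qed.

Lemma translate_valid u v : u ∈ G -> valid v -> valid (translate u v).
Proof.
  intros Hu; destruct v; simpl; try tauto; try (apply mul_in; auto).
  intros [H1 H2]; split; auto; apply mul_in; auto.
Qed.

Lemma translate_mul x y v : x ∈ G -> y ∈ G -> valid v ->
  translate (mul x y) v = translate x (translate y v).
Proof.
  intros Hx Hy; destruct v; simpl; intro Hv; auto; f_equal;
    apply mul_assoc; tauto.
Qed.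

Lemma translate_unit v : valid v -> translate e v = v.
Proof.
  destruct v; simpl; intro Hv; auto; f_equal; apply e_unit; tauto.
Qed.

Lemma translate_incid u v w : u ∈ G -> valid v -> valid w ->
  incid v w -> incid (translate u v) (translate u w).
Proof.
  intros Hu Hv Hw; destruct v, w; simpl in *; auto.
  - congruence.
  - intros ->; symmetry; apply mul_assoc; tauto.
Qed.

Lemma translate_point u v : point v -> point (translate u v).
Proof. destruct v; simpl; auto. Qed.

Lemma translate_adjacent u v w : u ∈ G -> valid v -> valid w ->
  adjacent v w -> adjacent (translate u v) (translate u w).
Proof.
  intros Hu Hv Hw [(Pv & Pw & D)|[I|I]].
  - left; split; [apply translate_point; auto|split; [apply translate_point; auto|]].
    intro E; apply D; f_equal; apply code_inj in E.
    destruct (e_inv Hu) as (u' & Hu' & E' & _).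
    rewrite <- (translate_unit Hv), <- (translate_unit Hw), <- E', !translate_mul; auto.
    congruence.
  - right; left; apply translate_incid; auto.
  - right; right; apply translate_incid; auto.
Qed.

Lemma translate_adjacent_iff u v w : u ∈ G -> valid v -> valid w ->
  (adjacent v w <-> adjacent (translate u v) (translate u w)).
Proof.
  intros Hu Hv Hw; split; [apply translate_adjacent; auto|].
  destruct (e_inv Hu) as (u' & Hu' & E' & _); intro H.
  rewrite <- (translate_unit Hv), <- (translate_unit Hw), <- E', !translate_mul; auto.
  apply translate_adjacent; auto using translate_valid.
Qed.

(** The graph of [translate u], as a relation between codes. *)
Definition translates u x y : Prop :=
  exists v, valid v /\ x = code v /\ y = code (translate u v).

Lemma def_translates : dfn (fun s => translates (s 0) (s 1) (s 2)).
Proof.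
  unfold translates; apply def_ex_vertex; cbn [valid code translate]; def.
Qed.

Lemma translates_code u v y : valid v ->
  (translates u (code v) y <-> y = code (translate u v)).
Proof.
  intro Hv; split; [|intros ->; exists v; auto].
  intros (w & Hw & E & ->); apply code_inj in E; subst; auto.
Qed.

(** The codes of vertices lie in a set, the product of the natural numbers and
    [T]. *)
Lemma code_range v : valid v -> exists n x, x ∈ T /\ code v = pr (num n) x.
Proof.
  intro Hv; destruct v as [x| |g|g| |x|x| |g c]; simpl in Hv; cbn [code];
    do 2 eexists; (split; [|reflexivity]); auto using group_in_T, atom_in_T.
  - tauto.
  - apply T_pr; tauto.
Qed.

Lemma graph_exists : exists V E,
  (forall x, x ∈ V <-> exists v, valid v /\ x = code v) /\ is_graph V E /\
  forall v w, valid v -> valid w -> (rel E (code v) (code w) <-> adjacent v w).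
Proof.
  destruct (product_exists omega T) as (Q & SQ & EQ).
  destruct (@separation M Z (fun x => exists v, valid v /\ x = code v) Q)
    as (V & SV & EV).
  { apply def_ex_vertex; cbn [valid code]; def. }
  assert (HV : forall x, x ∈ V <-> exists v, valid v /\ x = code v).
  { intro x; rewrite EV; split; [tauto|]. intros (v & Hv & ->).
    split; [|eauto]. destruct (code_range Hv) as (n & y & Hy & ->).
    apply EQ; split; auto using num_omega. }
  destruct (product_exists V V) as (W & SW & EW).
  destruct (@separation M Z (fun z => exists v, exists w, valid v /\ valid w /\
    adjacent v w /\ z = pr (code v) (code w)) W) as (E & SE & EE).
  { apply def_ex_vertex; apply def_ex_vertex;
      cbn [valid code adjacent point incid]; unfold adjacent;
      cbn [code point incid]; def. }
  assert (HE : forall x y, rel E x y <-> exists v, exists w, valid v /\ valid w /\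
    adjacent v w /\ x = code v /\ y = code w).
  { intros x y; rewrite rel_iff, EE; split.
    - intros (_ & v & w & H1 & H2 & H3 & H4); apply pr_inj in H4.
      exists v, w; tauto.
    - intros (v & w & H1 & H2 & H3 & -> & ->); split.
      + apply EW; split; apply HV; eauto.
      + exists v, w; auto. }
  exists V, E; split; [auto|split].
  - split; [auto|split; [split; [auto|]|split]].
    + intros p Hp; apply EE in Hp; destruct Hp as (_ & v & w & H1 & H2 & H3 & ->).
      exists (code v), (code w); split; [|split].
      * apply HV; eauto.
      * apply HV; eauto.
      * apply pair_iff; auto.
    + intros x y H; apply HE in H; apply HE.
      destruct H as (v & w & H1 & H2 & H3 & -> & ->).
      exists w, v; rewrite adjacent_sym; auto.
    + intros x H; apply HE in H.
      destruct H as (v & w & H1 & H2 & H3 & -> & H4); apply code_inj in H4.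
      subst w. destruct H3 as [(_ & _ & H)|[H|H]]; auto.
      * apply (incid_block H (incid_point H)).
      * apply (incid_block H (incid_point H)).
  - intros v w Hv Hw; rewrite HE; split; [|exists v, w; auto].
    intros (v' & w' & H1 & H2 & H3 & H4 & H5).
    apply code_inj in H4; apply code_inj in H5; subst; auto.
Qed.

Section Automorphisms.
Variables V E : M.
Hypothesis HV : forall x, x ∈ V <-> exists v, valid v /\ x = code v.
Hypothesis HE : forall v w, valid v -> valid w ->
  (rel E (code v) (code w) <-> adjacent v w).

Lemma code_V v : valid v -> code v ∈ V.
Proof. intro Hv; apply HV; eauto. Qed.

(** The map on vertices given by an automorphism [f] inside the model. *)
Definition induced (f : M) v : vertex M :=
  epsilon (inhabits Star) (fun w => valid w /\ rel f (code v) (code w)).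

Lemma induced_spec f v : bijection f V V -> valid v ->
  valid (induced f v) /\ rel f (code v) (code (induced f v)).
Proof.
  intros Hf Hv; unfold induced.
  apply (epsilon_spec (inhabits Star)
    (fun w => valid w /\ rel f (code v) (code w))).
  destruct (function_total (bijection_function Hf) (code_V Hv)) as [y Hy].
  pose proof (bijection_range Hf Hy) as Vy; apply HV in Vy.
  destruct Vy as (w & Hw & ->); eauto.
Qed.

Lemma induced_iff f v w : bijection f V V -> valid v ->
  (rel f (code v) (code w) <-> w = induced f v).
Proof.
  intros Hf Hv; destruct (induced_spec Hf Hv) as [H1 H2]; split.
  - intro H; apply code_inj, (function_fun (bijection_function Hf) H H2).
  - intros ->; auto.
Qed.

Lemma induced_symmetry f : is_automorphism f V E ->
  exists H, symmetry_pair (induced f) H.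
Proof.
  intros [Hf Af]; destruct (inverse_exists Hf) as (g & Hg & Eg).
  exists (induced g); split.
  - intros v Hv; destruct (induced_spec Hf Hv) as [H1 H2].
    destruct (induced_spec Hg Hv) as [H3 H4].
    split; [|split; [|split]]; auto; symmetry.
    + apply induced_iff; auto. apply Eg; auto.
    + apply induced_iff; auto. apply Eg; auto.
  - intros v w Hv Hw; destruct (induced_spec Hf Hv) as [H1 H2].
    destruct (induced_spec Hf Hw) as [H3 H4].
    rewrite <- (HE Hv Hw), <- (HE H1 H3); apply Af; auto.
Qed.

(** The restriction of [f] to the atoms is an automorphism of the order that
    lies in the model, so rigidity applies. *)
Lemma automorphism_fixes_atoms f : is_automorphism f V E ->
  forall a, a ∈ A -> induced f (Elt a) = Elt a.
Proof.
  intros Hf; destruct (induced_symmetry Hf) as (H & S).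
  assert (Bf : bijection f V V) by apply Hf.
  assert (R : forall x y, x ∈ A ->
    (rel f (pr (num 0) x) (pr (num 0) y) <-> induced f (Elt x) = Elt y)).
  { intros x y Hx; rewrite (induced_iff (v := Elt x) (Elt y) Bf).
    - split; auto.
    - apply atom_in_T; auto. }
  destruct (@bijection_exists M Z
    (fun x y => rel f (pr (num 0) x) (pr (num 0) y)) A A) as (h & Hh & Eh).
  - def.
  - intros x Hx; destruct (sym_atom S Hx) as (y & Hy & Ey).
    exists y; split; [apply R; auto|]. intros y' Hy'; apply R in Hy'; congruence.
  - intros x y Hx H1; apply R in H1; auto.
    destruct (sym_atom S Hx) as (y' & Hy' & Ey'); congruence.
  - intros x x' y Hx Hx' H1 H2; apply R in H1; apply R in H2; auto.
    rewrite <- H1 in H2; apply (sym_inj S) in H2; simpl; auto using atom_in_T.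
    congruence.
  - intros y Hy; destruct (sym_atom_surj S Hy) as (x & Hx & Ex).
    exists x; split; auto; apply R; auto.
  - assert (Ah : is_automorphism h A le).
    { split; auto; intros x y x' y' H1 H2; apply Eh in H1; apply Eh in H2.
      destruct H1 as [Hx H1], H2 as [Hy H2].
      apply R in H1; apply R in H2; auto.
      apply (sym_atom_le S Hy Hx H1). apply (sym_AtomBlock_eq S); auto. }
    intros a Ha; pose proof (rigid Ah Ha) as H1; apply Eh in H1.
    apply R; tauto.
Qed.

(** The induction in [sym_universe] needs a formula, which is obtained from the
    set [f]. *)
Lemma automorphism_translation f : is_automorphism f V E ->
  exists u, u ∈ G /\ forall v, valid v -> rel f (code v) (code (translate u v)).
Proof.
  intro Hf; destruct (induced_symmetry Hf) as (H & S).
  pose proof (automorphism_fixes_atoms Hf) as Fa.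
  assert (Bf : bijection f V V) by apply Hf.
  destruct (sym_translation S Fa) as (u & Hu & Eu).
  { apply (sym_universe S); auto.
    apply def_ext with (fun s => s 0 ∈ T ->
      rel f (pr (num 0) (s 0)) (pr (num 0) (s 0)) /\
      (is_set (s 0) -> rel f (pr (num 5) (s 0)) (pr (num 5) (s 0)))); [|def].
    intro s.
    pose proof (@induced_iff f (Elt (s 0)) (Elt (s 0)) Bf) as I1.
    pose proof (@induced_iff f (SetBlock (s 0)) (SetBlock (s 0)) Bf) as I2.
    cbn [code] in I1, I2; simpl valid in I1, I2.
    split; intros H1 H2; destruct (H1 H2) as [H3 H4]; split.
    - symmetry; apply I1; auto.
    - intro H5; symmetry; apply I2; auto.
    - apply I1; auto.
    - intro H5; apply I2; auto; symmetry; auto. }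
  exists u; split; auto; intros v Hv; apply induced_iff; auto.
  symmetry; auto.
Qed.

Lemma translation_exists u : u ∈ G -> exists f, is_automorphism f V E /\
  forall x y, rel f x y <-> translates u x y.
Proof.
  intro Hu; destruct (e_inv Hu) as (u' & Hu' & E' & E'').
  pose proof def_translates as D.
  destruct (@bijection_exists M Z (fun x y => translates u x y) V V)
    as (f & Hf & Ef).
  - def.
  - intros x Hx; apply HV in Hx; destruct Hx as (v & Hv & ->).
    exists (code (translate u v)); split; [apply translates_code; auto|].
    intros y Hy; apply translates_code in Hy; auto.
  - intros x y _ (v & Hv & _ & ->); apply code_V, translate_valid; auto.
  - intros x x' y _ _ (v & Hv & -> & ->) (w & Hw & -> & H).
    apply code_inj in H; f_equal.
    rewrite <- (translate_unit Hv), <- (translate_unit Hw), <- E', !translate_mul; auto.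
    congruence.
  - intros y Hy; apply HV in Hy; destruct Hy as (v & Hv & ->).
    exists (code (translate u' v)); split; [apply code_V, translate_valid; auto|].
    apply translates_code; [apply translate_valid; auto|].
    rewrite <- translate_mul, E'', translate_unit; auto.
  - assert (Ef' : forall x y, rel f x y <-> translates u x y).
    { intros x y; rewrite Ef; split; [tauto|]; intro H; split; auto.
      destruct H as (v & Hv & -> & _); apply code_V; auto. }
    exists f; split; [split|]; auto.
    intros x y x' y' H1 H2; apply Ef' in H1; apply Ef' in H2.
    destruct H1 as (v & Hv & -> & ->), H2 as (w & Hw & -> & ->).
    rewrite !HE; auto using translate_valid. apply translate_adjacent_iff; auto.
Qed.

Lemma automorphism_group_iso : exists S phi,
  is_automorphism_group S V E /\ is_isomorphism_to_permutations phi G m S.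
Proof.
  pose proof def_translates as D.
  set (R := fun u f => is_automorphism f V E /\
              forall x y, rel f x y <-> translates u x y).
  assert (DR : dfn (fun s => R (s 0) (s 1))) by def.
  assert (RF : forall u f g, R u f -> R u g -> f = g).
  { intros u f g [[Bf _] Ef] [[Bg _] Eg].
    apply (function_ext (bijection_function Bf) (bijection_function Bg)).
    intros x y; rewrite Ef, Eg; tauto. }
  assert (RI : forall u u' f, u ∈ G -> u' ∈ G -> R u f -> R u' f -> u = u').
  { intros u u' f Hu Hu' [_ Ef] [_ Ef'].
    assert (H : translates u' (code (Src e)) (code (translate u (Src e)))).
    { apply Ef', Ef, translates_code; simpl; auto. }
    apply translates_code in H; [|simpl; auto].
    apply code_inj in H; simpl in H; injection H as H.
    rewrite (proj2 (e_unit Hu)), (proj2 (e_unit Hu')) in H; auto. }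
  destruct (replacement (x := G) DR) as (S & SS & ES); [eauto|].
  assert (HS : forall f, f ∈ S <-> is_automorphism f V E).
  { intro f; rewrite ES; split; [intros (u & _ & H & _); auto|].
    intro Hf; destruct (automorphism_translation Hf) as (u & Hu & H).
    exists u; split; auto; split; auto.
    assert (Bf : bijection f V V) by apply Hf.
    intros x y; split.
    - intro Hr; pose proof (function_dom (bijection_function Bf) Hr) as Hx.
      apply HV in Hx; destruct Hx as (v & Hv & ->).
      apply translates_code; auto.
      apply (function_fun (bijection_function Bf) Hr (H v Hv)).
    - intros (v & Hv & -> & ->); auto. }
  destruct (@bijection_exists M Z R G S) as (phi & Hphi & Ephi); auto.
  - intros u Hu; destruct (translation_exists Hu) as (f & Hf).
    exists f; split; [exact Hf|]. intros g Hg; eapply RF; eauto; exact Hf.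
  - intros u f _ [H _]; apply HS; auto.
  - intros f Hf; apply ES in Hf; auto.
  - exists S, phi; split; [split; auto|split; auto].
    intros x y z f g h Hop Hf Hg Hh.
    apply Ephi in Hf; apply Ephi in Hg; apply Ephi in Hh.
    destruct Hf as [Hx [_ Ef]], Hg as [Hy [_ Eg]], Hh as [Hz [Ah Eh]].
    apply mul_op in Hop; auto; subst z.
    assert (Bh : bijection h V V) by apply Ah.
    destruct (bijection_function Bh) as (Sh & Ph & _).
    apply composition_iff; auto.
    { intros p Hp; destruct (Ph p Hp) as (a & b & _ & H); eauto. }
    intros a b; rewrite Eh; split.
    + intros (v & Hv & -> & ->); exists (code (translate y v)).
      rewrite Eg, Ef, !translates_code; auto using translate_valid.
      rewrite translate_mul; auto.
    + intros (c & H1 & H2); apply Eg in H1; apply Ef in H2.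
      destruct H1 as (v & Hv & -> & ->).
      apply translates_code in H2; auto using translate_valid.
      exists v; rewrite translate_mul; auto.
Qed.

End Automorphisms.
End Graph.

Theorem group_is_automorphism_group : exists V E : M, is_graph V E /\
  exists S phi : M, is_automorphism_group S V E /\
    is_isomorphism_to_permutations phi G m S.
Proof.
  destruct universe_exists as (T & TT & TA & TG & TP).
  destruct unit_exists as (e & He & E1 & E2).
  destruct (graph_exists TT TA TG TP) as (V & E & HV & HGr & HE).
  exists V, E; split; auto.
  apply (automorphism_group_iso TT TA TG He E1 E2 HV HE).
Qed.

End Frucht.

(** * Frucht's theorem in the permutation model *)

Section Absoluteness.
Context {M : eps_structure} {Z : ZFA M}.
Variables (A le Sigma F : M).
Hypothesis A_atoms : is_atom_set A.
Hypothesis Sigma_aut : is_automorphism_group Sigma A le.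
Hypothesis F_filter : is_filter_generated_by_stabilizers A Sigma F.

Let N := permutation_model Sigma F.
Let val (x : N) : M := proj1_sig x.

Context {ZN : ZFA N}.

(** Pairs of elements of the permutation model are pairs in the ground model; as
    the model is transitive, so are applications of functions and the notion of
    automorphism. *)
Lemma val_pr (p x y : N) : is_pair p x y <-> is_pair (val p) (val x) (val y).
Proof.
  assert (U : forall x y, val (upr x y) = upr (val x) (val y)).
  { intros u v; symmetry.
    set (q := exist _ _ (hs_upr A_atoms Sigma_aut F_filter
               (model_hs u) (model_hs v)) : N).
    change (val q = val (upr u v)); f_equal; apply upair_iff.
    intro z; transitivity (val z ∈ upr (val u) (val v)); [reflexivity|].
    rewrite upr_mem; split; (intros [H|H]; [left|right]);
      try (apply model_eq; exact H); congruence. }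
  rewrite !pair_iff; unfold pr; rewrite <- !U; split; [congruence|].
  apply model_eq.
Qed.

Lemma val_rel (r x y : N) : rel r x y <-> rel (val r) (val x) (val y).
Proof.
  split.
  - intros (p & H1 & H2); exists (val p); split; auto; apply val_pr; auto.
  - intros (p & H1 & H2).
    exists (exist _ p (hs_elem (model_hs r) H2)); split; auto.
    apply val_pr; auto.
Qed.

Lemma val_automorphism (f X r : N) : is_automorphism f X r ->
  is_automorphism (val f) (val X) (val r).
Proof.
  intros [Bf If].
  assert (Df : forall x y, rel (val f) x y -> exists x' y' : N,
            x = val x' /\ y = val y' /\ rel f x' y').
  { intros x y H.
    assert (Hp : pr x y ∈ val f) by (apply rel_iff; auto).
    pose (p := exist _ _ (hs_elem (model_hs f) Hp) : N).
    destruct (bijection_function Bf) as (_ & Pf & _).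
    destruct (Pf p Hp) as (x' & y' & _ & E).
    assert (E' : is_pair (val p) (val x') (val y')) by (apply val_pr; auto).
    apply pair_iff, pr_inj in E'; destruct E' as [-> ->].
    exists x', y'; split; [|split]; auto. exists p; auto. }
  split; [split; [split; [split; [split; [|split]|]|]|]|].
  - exact (proj1 (bijection_function Bf)).
  - intros p Hp.
    destruct (bijection_function Bf) as (_ & Pf & _).
    destruct (Pf (exist _ p (hs_elem (model_hs f) Hp)) Hp) as (x & y & Hx & E).
    exists (val x), (val y); split; [exact Hx|apply val_pr in E; exact E].
  - intros x Hx.
    pose (u := exist _ x (hs_elem (model_hs X) Hx) : N).
    destruct (function_total (bijection_function Bf) (x := u) Hx) as [y Hy].
    exists (val y); split; [apply val_rel in Hy; exact Hy|].
    intros y' Hy'; destruct (Df x y' Hy') as (x1 & y1 & Ex & -> & H1).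
    f_equal; apply (function_fun (bijection_function Bf) Hy).
    replace u with x1; auto. apply model_eq; auto.
  - intros x y H; destruct (Df x y H) as (x1 & y1 & -> & -> & H1).
    apply (bijection_range Bf H1).
  - intros x y z H H'; destruct (Df x z H) as (x1 & z1 & -> & -> & H1).
    destruct (Df y (val z1) H') as (y2 & z2 & -> & E & H2).
    apply model_eq in E; subst z2; f_equal; apply (bijection_inj Bf H1 H2).
  - intros y Hy.
    pose (u := exist _ y (hs_elem (model_hs X) Hy) : N).
    destruct (bijection_surj Bf (y := u) Hy) as [x Hx]; exists (val x); apply val_rel in Hx; auto.
  - intros x y x' y' H H'; destruct (Df x x' H) as (x1 & x2 & -> & -> & H1).
    destruct (Df y y' H') as (y1 & y2 & -> & -> & H2).
    rewrite <- !val_rel; auto.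
Qed.

End Absoluteness.

(** The atoms and their order are hereditarily symmetric, so they are objects of
    the permutation model, where the order is rigid. *)
Theorem mainTheorem7 (M : eps_structure) (A le Sigma F : M)
  (M_ZFA : ZFA M)
  (A_atoms : is_atom_set A)
  (A_countable : countable A)
  (le_DLO : dense_linear_order_without_endpoints A le)
  (Sigma_aut : is_automorphism_group Sigma A le)
  (F_filter : is_filter_generated_by_stabilizers A Sigma F) :
  Frucht (permutation_model Sigma F).
Proof.
  intros G m HG.
  assert (le_rel : is_relation_on le A A) by apply le_DLO.
  pose proof (model_ZFA A_atoms le_rel Sigma_aut F_filter) as ZN.
  set (AN := exist _ A (hs_A A_atoms Sigma_aut F_filter)
         : permutation_model Sigma F).
  set (leN := exist _ le (hs_le A_atoms le_rel Sigma_aut F_filter)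
         : permutation_model Sigma F).
  pose proof (val_rel A_atoms Sigma_aut F_filter leN) as E.
  apply (group_is_automorphism_group (A := AN) (le := leN)); auto.
  - split; [apply A_atoms|]. intro x; apply A_atoms.
  - intros x y H; apply E in H; apply (le_dom le_DLO H).
  - intros x Hx; apply E, (le_refl le_DLO); auto.
  - intros x y H1 H2; apply E in H1; apply E in H2.
    apply model_eq, (le_antisym le_DLO H1 H2).
  - intros x y z H1 H2; apply E in H1; apply E in H2.
    apply E, (le_trans le_DLO H1 H2).
  - intros x Hx; destruct (lt_below le_DLO Hx) as (y & H1 & H2).
    exists (exist _ y (hs_elem (hs_A A_atoms Sigma_aut F_filter)
              (proj1 (le_dom le_DLO H1)))); split.
    + apply E; auto.
    + intro H; apply H2; rewrite <- H; auto.
  - intros f Hf x Hx.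
    apply (val_rel A_atoms Sigma_aut F_filter).
    apply (symmetric_automorphism_trivial A_atoms A_countable le_DLO
      Sigma_aut F_filter); auto.
    + apply model_sym.
    + apply (val_automorphism A_atoms Sigma_aut F_filter Hf).
Qed.
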